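(* Let $\mathcal U$ be the real form of $sl(n,\mathbb C)$ defined by $\tau$, and $U/K$ the symmetric space defined by $\tau,\sigma$. Let $u$ be a (local) solution of the $j$-th flow in the $\mathcal U$-hierarchy (respectively, in the $U/K$-hierarchy), admitting a local reduced wave function, and let $h_{\alpha_1,\alpha_2,\pi}$ be a simple element satisfying the $U$-reality condition (respectively, the $U/K$-reality condition). Then $h_{\alpha_1,\alpha_2,\pi}*u$ is again a solution of the $j$-th flow in the $\mathcal U$-hierarchy (respectively, the $U/K$-hierarchy).
   Context: Let $\tau$ be a conjugate-linear Lie algebra involution of $sl(n,\mathbb C)$ with fixed point set $\mathcal U$ (a real form), and $\sigma$ a complex linear Lie algebra involution of $sl(n,\mathbb C)$ with $\sigma\tau=\tau\sigma$; $\mathcal K,\mathcal P$ are the $+1,-1$ eigenspaces of $\sigma$ on $\mathcal U$, and $U/K$ is the corresponding symmetric space. Let $\hat\tau,\hat\sigma$ be the induced involutions of the group $GL(n,\mathbb C)$. A $GL(n,\mathbb C)$-valued function $h(\lambda)$ satisfies the $U$-reality condition if $\hat\tau(h(\bar\lambda))=h(\lambda)$, and the $U/K$-reality condition if in addition $\hat\sigma(h(-\lambda))=h(\lambda)$. Fix a nonzero diagonal $a\in sl(n,\mathbb C)$, and $b$ a polynomial in $a$. $sl(n)_a^\perp$ is the orthogonal complement (trace form) of the centralizer of $a$ in $sl(n,\mathbb C)$. For smooth $u$ with values in $sl(n)_a^\perp$: $Q_{b,0}(u)=b$, and $Q_{b,k}(u)$, $k\ge1$, are the unique matrix-valued polynomials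 without constant term in the entries of $u$ and their $x$-derivatives such that $(Q_{b,k}(u))_x+[u,Q_{b,k}(u)]=[Q_{b,k+1}(u),a]$ for all $k\ge0$. The $j$-th flow is $u_t=(Q_{b,j}(u))_x+[u,Q_{b,j}(u)]$. In the $\mathcal U$-hierarchy, $a,b\in\mathcal U$ and solutions take values in $\mathcal U_a^\perp=sl(n)_a^\perp\cap\mathcal U$. In the $U/K$-hierarchy, $j$ is odd, $a,b\in\mathcal P$ and solutions take values in $\mathcal K\cap\mathcal U_a^\perp$. The trivialization $E(x,t,\lambda)$ of a solution $u$ defined near $(0,0)$ solves $E_x=E(a\lambda+u)$, $E_t=E(b\lambda^j+Q_{b,1}(u)\lambda^{j-1}+\dots+Q_{b,j}(u))$, $E(0,0,\lambda)=I$. A local reduced wave function of $u$ is a smooth $GL(n,\mathbb C)$-valued $m(x,t,\lambda)$ (away from poles), meromorphic in $\lambda\in\mathbb C\setminus\Gamma_a$, where $\Gamma_a=\{\lambda:\mathrm{Re}(\lambda(a_i-a_k))=0\text{ for some }a_i\neq a_k\}$ ($a_i$ the diagonal entries of $a$), with asymptotic expansion $I+m_1\lambda^{-1}+\cdots$ at $\lambda=\infty$, $u=[a,m_1]$, and $E=m(0,0,\lambda)^{-1}e^{a\lambda x+b\lambda^jt}m(x,t,\lambda)$. For $\alpha_1,\alpha_2\in\mathbb C$ and a complex linear projection $\pi$ ($\pi^2=\pi$) with $V_1=\mathrm{Im}\,\pi$, $V_2=\mathrm{Im}(I-\pi)$, the simple element is $h_{\alpha_1,\alpha_2,\pi}(\lambda)=I+\frac{\alpha_1-\alpha_2}{\lambda-\alpha_1}(I-\pi)$.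 On a neighbourhood of $(0,0)$ where $\tilde V_i(x,t)=E(x,t,\alpha_i)^{-1}(V_i)$ satisfy $\tilde V_1\cap\tilde V_2=0$, define $h_{\alpha_1,\alpha_2,\pi}*u=u+(\alpha_1-\alpha_2)[a,\tilde\pi]$, with $\tilde\pi(x,t)$ the projection onto $\tilde V_1(x,t)$ along $\tilde V_2(x,t)$; this is a local solution of the $j$-th flow in the $sl(n,\mathbb C)$-hierarchy. *)

(* Defs.v *)
(* The complex numbers are R[i] for R : realType. *)
From mathcomp Require Import all_boot all_order all_algebra.
From mathcomp Require Import complex.
From mathcomp Require Import all_classical all_reals all_analysis.
Import Order.TTheory GRing.Theory Num.Theory numFieldNormedType.Exports.

Set Implicit Arguments.
Unset Strict Implicit.
Unset Printing Implicit Defensive.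

Local Open Scope ring_scope.
Local Open Scope classical_set_scope.
Local Open Scope complex_scope.

Local Notation Re := complex.Re.
Local Notation Im := complex.Im.

Section Calculus.
Variable R : realType.
Local Notation C := R[i].

Definition cexp (z : C) : C :=
  (expR (Re z) * cos (Im z)) +i* (expR (Re z) * sin (Im z)).

(* R[i] is not a normed module over R in the library, so derivatives with
   respect to a real variable are taken on real and imaginary parts. *)
Definition cderiven (k : nat) (f : R -> C) (x : R) : C :=
  derive1n k (fun y => Re (f y)) x +i* derive1n k (fun y => Im (f y)) x.

Definition mderive (m n : nat) (F : R -> 'M[C]_(m, n)) (x : R) : 'M[C]_(m, n) :=
  \matrix_(i, j) cderiven 1 (fun y => F y i j) x.

Definition smooth1 (f : R -> R) : Prop :=
  forall k x, derivable (derive1n k f) x 1.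

Definition msmooth1 (m n : nat) (F : R -> 'M[C]_(m, n)) : Prop :=
  forall i j, smooth1 (fun x => Re (F x i j)) /\ smooth1 (fun x => Im (F x i j)).

(* Iterated partial derivatives of f (x, t), one for each word:
   true differentiates in x, false in t. *)
Fixpoint pderive (w : seq bool) (f : R -> R -> R) : R -> R -> R :=
  match w with
  | [::] => f
  | true :: w' => fun x t => derive1 (fun y => pderive w' f y t) x
  | false :: w' => fun x t => derive1 (fun s => pderive w' f x s) t
  end.

(* C^infinity on the open set D: all iterated partial derivatives exist and
   are continuous. *)
Definition smooth2 (D : set (R * R)) (f : R -> R -> R) : Prop :=
  forall w x t, D (x, t) ->
    [/\ derivable (fun y => pderive w f y t) x 1,
        derivable (fun s => pderive w f x s) t 1
      & {for (x, t), continuous (fun p : R * R => pderive w f p.1 p.2)}].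

Definition msmooth2 (m n : nat) (D : set (R * R))
    (F : R -> R -> 'M[C]_(m, n)) : Prop :=
  forall i j, smooth2 D (fun x t => Re (F x t i j)) /\
              smooth2 D (fun x t => Im (F x t i j)).

(* Complex differentiability: R[i]^o is R[i] as a normed module over itself. *)
Definition holomorphic_at (f : C -> C) (z : C) : Prop :=
  derivable (f : C^o -> C^o) z 1.

Definition meromorphic_at (f : C -> C) (p : C) : Prop :=
  exists (N : nat) (r : R) (g : C -> C),
    [/\ 0 < r,
        forall z, `|z - p| < r%:C -> holomorphic_at g z
      & forall z, 0 < `|z - p| < r%:C -> f z = g z / (z - p) ^+ N].

End Calculus.

Section LieAlgebra.
Variables (R : realType) (n : nat).
Local Notation C := R[i].
Local Notation M := 'M[C]_n.+1.

Definition lie (X Y : M) : M := X *m Y - Y *m X.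

Definition in_sl (X : M) : Prop := \tr X = 0.

(* Lie algebra involution of sl(n+1, C), semilinear with respect to s: complex
   linear for s = id, conjugate-linear for s = conjc.  The values of phi
   outside sl are irrelevant. *)
Record lie_involution (s : C -> C) (phi : M -> M) : Prop := LieInvolution {
  lie_inv_sl : forall X, in_sl X -> in_sl (phi X);
  lie_inv_semilinear : forall c X Y, in_sl X -> in_sl Y ->
    phi (c *: X + Y) = s c *: phi X + phi Y;
  lie_inv_bracket : forall X Y, in_sl X -> in_sl Y ->
    phi (lie X Y) = lie (phi X) (phi Y);
  lie_invK : forall X, in_sl X -> phi (phi X) = X }.

(* dPhi is the Frechet differential of Phi at the identity, for the max norm
   on matrix entries. *)
Definition differential_at_1 (Phi dPhi : M -> M) : Prop :=
  forall eps : R, 0 < eps -> exists2 delta : R, 0 < delta &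
    forall (r : R) (H : M), 0 <= r <= delta ->
      (forall i j, `|H i j| <= r%:C) ->
      forall i j, `|(Phi (1%:M + H) - 1%:M - dPhi H) i j| <= (eps * r)%:C.

(* Phi is an involution of the group GL(n+1, C) induced by the involution phi
   of sl(n+1, C): a holomorphic (s = id) or antiholomorphic (s = conjc) group
   automorphism whose differential at the identity extends phi. *)
Record induced_involution (s : C -> C) (phi Phi : M -> M) : Prop :=
  InducedInvolution {
  ind_inv_unit : forall g, g \in unitmx -> Phi g \in unitmx;
  ind_inv_mul : forall g h, g \in unitmx -> h \in unitmx ->
    Phi (g *m h) = Phi g *m Phi h;
  ind_invK : forall g, g \in unitmx -> Phi (Phi g) = g;
  ind_inv_diff : exists dPhi : M -> M,
    [/\ forall c X Y, dPhi (c *: X + Y) = s c *: dPhi X + dPhi Y,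
        forall X, in_sl X -> dPhi X = phi X
      & differential_at_1 Phi dPhi] }.

Definition in_U (tau : M -> M) (X : M) : Prop := in_sl X /\ tau X = X.

Definition in_K (tau sigma : M -> M) (X : M) : Prop :=
  in_U tau X /\ sigma X = X.

Definition in_P (tau sigma : M -> M) (X : M) : Prop :=
  in_U tau X /\ sigma X = - X.

Definition in_sl_perp (a X : M) : Prop :=
  in_sl X /\ forall Y, in_sl Y -> lie a Y = 0 -> \tr (X *m Y) = 0.

Definition in_U_perp (tau : M -> M) (a X : M) : Prop :=
  in_sl_perp a X /\ in_U tau X.

(* Reality conditions for h : C \ S -> GL(n+1, C), where the finite set S
   contains the points at which h or h^-1 is singular. *)
Definition U_reality (tauhat : M -> M) (S : seq C) (h : C -> M) : Prop :=
  forall l, l \notin S -> conjc l \notin S -> tauhat (h (conjc l)) = h l.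

Definition UK_reality (tauhat sigmahat : M -> M) (S : seq C) (h : C -> M)
    : Prop :=
  U_reality tauhat S h /\
  forall l, l \notin S -> - l \notin S -> sigmahat (h (- l)) = h l.

End LieAlgebra.

Section Hierarchy.
Variables (R : realType) (n : nat).
Local Notation C := R[i].
Local Notation M := 'M[C]_n.+1.

(* Polynomial expressions in the jet variables: DVar i j k stands for the k-th
   x-derivative of the (i, j) entry of u.  They are only used through their
   values. *)
Inductive dpoly : Type :=
  | DConst of C
  | DVar of 'I_n.+1 & 'I_n.+1 & nat
  | DAdd of dpoly & dpoly
  | DMul of dpoly & dpoly.

Fixpoint deval (J : 'I_n.+1 -> 'I_n.+1 -> nat -> C) (p : dpoly) : C :=
  match p with
  | DConst c => c
  | DVar i j k => J i j k
  | DAdd p q => deval J p + deval J q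
  | DMul p q => deval J p * deval J q
  end.

Definition jet (v : R -> M) (x : R) (i j : 'I_n.+1) (k : nat) : C :=
  cderiven k (fun y => v y i j) x.

Definition dmx_eval (P : 'M[dpoly]_n.+1) (v : R -> M) (x : R) : M :=
  map_mx (deval (jet v x)) P.

(* Q k is Q_{b,k}.  These clauses determine the values of all Q_{b,k} on
   functions with values in sl(n+1)_a^perp. *)
Record is_Q_family (a b : M) (Q : nat -> 'M[dpoly]_n.+1) : Prop := IsQFamily {
  Q_zero : forall J, map_mx (deval J) (Q 0) = b;
  Q_no_constant_term : forall k,
    map_mx (deval (fun _ _ _ => 0)) (Q k.+1) = 0;
  Q_recursion : forall v : R -> M,
    msmooth1 v -> (forall x, in_sl_perp a (v x)) ->
    forall k x,
      mderive (dmx_eval (Q k) v) x + lie (v x) (dmx_eval (Q k) v x)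
      = lie (dmx_eval (Q k.+1) v x) a }.

(* Q_{b,k}(u) at (x, t), the variable t being a parameter. *)
Definition Qval (Q : nat -> 'M[dpoly]_n.+1) (k : nat) (u : R -> R -> M)
    (x t : R) : M :=
  dmx_eval (Q k) (fun y => u y t) x.

Definition flow_solution (Q : nat -> 'M[dpoly]_n.+1) (j : nat)
    (D : set (R * R)) (u : R -> R -> M) : Prop :=
  msmooth2 D u /\
  forall x t, D (x, t) ->
    mderive (fun s => u x s) t
    = mderive (fun y => Qval Q j u y t) x + lie (u x t) (Qval Q j u x t).

Definition U_solution (tau : M -> M) (a b : M) (Q : nat -> 'M[dpoly]_n.+1)
    (j : nat) (D : set (R * R)) (u : R -> R -> M) : Prop :=
  [/\ in_U tau a, in_U tau b,
      forall x t, D (x, t) -> in_U_perp tau a (u x t)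
    & flow_solution Q j D u].

Definition UK_solution (tau sigma : M -> M) (a b : M)
    (Q : nat -> 'M[dpoly]_n.+1) (j : nat) (D : set (R * R))
    (u : R -> R -> M) : Prop :=
  [/\ odd j, in_P tau sigma a, in_P tau sigma b,
      forall x t, D (x, t) ->
        in_K tau sigma (u x t) /\ in_U_perp tau a (u x t)
    & flow_solution Q j D u].

(* Connectedness makes the trivialization unique on D. *)
Definition local_domain (D : set (R * R)) : Prop :=
  [/\ open D, connected D & D (0, 0)].

Definition trivialization (a : M) (Q : nat -> 'M[dpoly]_n.+1) (j : nat)
    (D : set (R * R)) (u : R -> R -> M) (E : R -> R -> C -> M) : Prop :=
  forall l : C,
    [/\ E 0 0 l = 1%:M,
        msmooth2 D (fun x t => E x t l),
        forall x t, D (x, t) ->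
          mderive (fun y => E y t l) x = E x t l *m (l *: a + u x t)
      & forall x t, D (x, t) ->
          mderive (fun s => E x s l) t
          = E x t l *m \sum_(k < j.+1) l ^+ (j - k) *: Qval Q k u x t].

Definition Gamma (a : M) : set C :=
  [set l | exists i k, a i i != a k k /\ Re (l * (a i i - a k k)) = 0].

(* The exponential of a diagonal matrix. *)
Definition mexp_diag (d : M) : M := diag_mx (\row_i cexp (d i i)).

(* Local reduced wave function on the neighbourhood O of (0, 0).  P contains
   the poles of m and of m^-1; by the last clause they do not depend on
   (x, t). *)
Record reduced_wave_function_on (a b : M) (j : nat) (u : R -> R -> M)
    (E : R -> R -> C -> M) (O : set (R * R)) (P : set C)
    (m : R -> R -> C -> M) : Prop := ReducedWaveFunction {
  wave_isolated : forall p, ~ Gamma a p -> exists2 r : R, 0 < r &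
    forall z, 0 < `|z - p| < r%:C -> ~ P z;
  wave_GL : forall x t l, O (x, t) -> ~ Gamma a l -> ~ P l ->
    m x t l \in unitmx;
  wave_smooth : forall l, ~ Gamma a l -> ~ P l ->
    msmooth2 O (fun x t => m x t l);
  wave_holomorphic : forall x t l i k, O (x, t) -> ~ Gamma a l -> ~ P l ->
    holomorphic_at (fun z => m x t z i k) l;
  wave_meromorphic : forall x t p i k, O (x, t) -> ~ Gamma a p ->
    meromorphic_at (fun z => m x t z i k) p;
  wave_asymptotic : exists mc : nat -> R -> R -> M,
    [/\ forall x t, O (x, t) -> mc 0%N x t = 1%:M,
        forall x t, O (x, t) -> forall N : nat, exists K B : R,
          forall l, ~ Gamma a l -> ~ P l -> K%:C < `|l| -> forall i k,
            `|(m x t l - \sum_(q < N.+1) l ^- q *: mc q x t) i k|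
              <= B%:C * `|l| ^- N.+1
      & forall x t, O (x, t) -> u x t = lie a (mc 1%N x t)];
  wave_trivialization : forall x t l, O (x, t) -> ~ Gamma a l -> ~ P l ->
    E x t l = invmx (m 0 0 l)
              *m mexp_diag ((l * x%:C) *: a + (l ^+ j * t%:C) *: b)
              *m m x t l }.

Definition has_local_reduced_wave_function (a b : M) (j : nat)
    (D : set (R * R)) (u : R -> R -> M) (E : R -> R -> C -> M) : Prop :=
  exists (O : set (R * R)) (P : set C) (m : R -> R -> C -> M),
    [/\ open O, O (0, 0), O `<=` D
      & reduced_wave_function_on a b j u E O P m].

Definition simple_element (al1 al2 : C) (pi : M) (l : C) : M :=
  1%:M + ((al1 - al2) / (l - al1)) *: (1%:M - pi).

(* The column space of tV1 is E(x,t,al1)^-1 (Im pi), that of tV2 is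
   E(x,t,al2)^-1 (Im (I - pi)). *)
Definition tV1 (E : R -> R -> C -> M) (al1 : C) (pi : M) (x t : R) : M :=
  invmx (E x t al1) *m pi.

Definition tV2 (E : R -> R -> C -> M) (al2 : C) (pi : M) (x t : R) : M :=
  invmx (E x t al2) *m (1%:M - pi).

(* The library's subspaces are row spaces: a column space is the row space of
   the transpose, and a projection of column vectors is the transpose of one of
   row vectors. *)
Definition tpi (E : R -> R -> C -> M) (al1 al2 : C) (pi : M) (x t : R) : M :=
  (proj_mx (tV1 E al1 pi x t)^T (tV2 E al2 pi x t)^T)^T.

Definition dressing_domain (D : set (R * R)) (E : R -> R -> C -> M)
    (al1 al2 : C) (pi : M) (W : set (R * R)) : Prop :=
  [/\ open W, W (0, 0), W `<=` D
    & forall x t, W (x, t) ->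
        ((tV1 E al1 pi x t)^T :&: (tV2 E al2 pi x t)^T)%MS = 0].

Definition dressing (a : M) (u : R -> R -> M) (E : R -> R -> C -> M)
    (al1 al2 : C) (pi : M) (x t : R) : M :=
  u x t + (al1 - al2) *: lie a (tpi E al1 al2 pi x t).

End Hierarchy.

(* Main.v *)
From HB Require Import structures.
Require Import Defs.
From mathcomp Require Import all_boot all_order all_algebra.
From mathcomp Require Import perm complex.
From mathcomp Require Import all_classical all_reals all_analysis.
From mathcomp Require Import ring.
Import Order.TTheory GRing.Theory Num.Theory numFieldNormedType.Exports.

Set Implicit Arguments.
Unset Strict Implicit.
Unset Printing Implicit Defensive.

Local Open Scope ring_scope.
Local Open Scope classical_set_scope.
Local Open Scope complex_scope.
Local Notation Re := complex.Re.
Local Notation Im := complex.Im.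

(** Put [Delta = al2 + (al1 - al2) tpi].  Up to a scalar factor the dressed simple element is the
   Darboux factor [lambda - Delta], and the dressed solution is [u' = u + [a, Delta]].

   The flow.  If [S = E(al1)^-1 pi + E(al2)^-1 (1 - pi)], then [Delta S = S Delta0] with
   [Delta0] constant, and the linear equations of [E] give
   [Delta_x = [Delta, u + a Delta]] and [Delta_t = [Delta, C]], where
   [C = sum_(k <= j) Q_k(u) Delta^(j-k)] ([Delta_derive]).  The heart of the proof is the identity
   [Q_(k+1)(u') = Q_(k+1)(u) - Delta Q_k(u) + Q_k(u') Delta] ([Q_darboux]): the series
   [sum_k Q_k lambda^-k] is conjugated by the Darboux factor.  By the recursion, the flow
   of [u] is [u_t = [Q_(j+1)(u), a]], and the identity adds up to
   [Q_(j+1)(u') = Q_(j+1)(u) + [C, Delta]] ([flow_dressed]).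

   The identity.  The recursion determines the [Q_k] only up to constants in the centralizer of
   [a], which the absence of constant terms removes.  This is used through a vanishing principle
   ([vanishing_principle]): a differential polynomial that has zero total derivative and vanishes
   at the zero jet is zero, because a polynomial function may have any given jet at 0 and the
   zero jet at 1.  A formal gauge transformation [N = 1 + N_1 / lambda + ...], with differential
   polynomials as coefficients, carries [a lambda + u] to a normal form with values in the
   centralizer of [a], and by the vanishing principle it carries [sum_k Q_k lambda^-k] to [b]
   ([gauge_diag]).  If [N] and [N'] belong to [u] and [u'], then [N' (1 - Delta / lambda) N^-1]
   relates two normal forms, so its coefficients lie in the centralizer of [a]
   ([qgauge_cent]) and commute with [b], which gives the identity.

   The reality condition.  Let [phi] be [tau] or [sigma], extended to [gl] by killing the
   scalars, [eps = 1] or [eps = -1] accordingly, and [nu] the matching involution of the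
   [lambda]-plane.  The vanishing principle gives [phi (Q_k) = eps^(k+1) Q_k] ([Q_reality]), so
   conjugation by [E] is compatible with [phi] and [nu] ([E_reality]); for this [E] has to be
   invertible, which holds because its determinant is constant.  The reality condition makes
   [phi] intertwine the conjugations by the simple element [h] at [nu lambda] and at [lambda];
   comparing eigenvalues, [nu] permutes [al1] and [al2], and [phi] permutes the two spaces
   [Hom(V2, V1)] and [Hom(V1, V2)] accordingly ([raising_image]).  Transported by [E], the
   same holds for the two dressed subspaces.  Hence [phi (Delta) - eps Delta] commutes with both dressed spaces of
   homomorphisms and is a scalar ([conj_frame_reality]), so [phi] fixes [[a, Delta]].  The
   compatibility of [phi] with the adjoint action comes from the differential of the group
   involution at the identity ([gl_ext_Ad]). *)

(** Identities between matrices that are linear in the products they contain. *)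
Ltac mx_linear := apply/matrixP => ? ?; rewrite !mxE; ring.

(** * Formal power series over a noncommutative ring *)

Definition fps (B : nzRingType) := nat -> B.

Section FormalSeries.
Variable B : nzRingType.
Implicit Types f g h : fps B.

HB.instance Definition _ := gen_eqMixin (fps B).
HB.instance Definition _ := gen_choiceMixin (fps B).

Definition fadd f g : fps B := fun k => f k + g k.
Definition fopp f : fps B := fun k => - f k.
Definition fmul f g : fps B := fun k => \sum_(i < k.+1) f i * g (k - i)%N.
Definition fps_cst (x : B) : fps B := fun k => if k is 0 then x else 0.

(** Coefficients of products of series are those of products of truncations, so the ring axioms
   come from polynomials. *)
Definition ftrunc (K : nat) f : {poly B} := \poly_(i < K) f i.

Lemma fmul_trunc K f g k : (k < K)%N -> fmul f g k = (ftrunc K f * ftrunc K g)`_k.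
Proof.
move=> kK; rewrite coefM; apply: eq_bigr => i _.
rewrite !coef_poly (leq_ltn_trans (leq_subr _ _) kK).
by rewrite (leq_trans _ kK) // ltnS -ltnS.
Qed.

Lemma fps_coefM_eq K (p q p' q' : {poly B}) k : (k < K)%N ->
  (forall i, (i < K)%N -> p`_i = p'`_i) -> (forall i, (i < K)%N -> q`_i = q'`_i) ->
  (p * q)`_k = (p' * q')`_k.
Proof.
move=> kK hp hq; rewrite !coefM; apply: eq_bigr => i _.
by rewrite hp ?hq //; [exact: leq_ltn_trans (leq_subr _ _) kK | exact: leq_trans (ltn_ord i) kK].
Qed.

Lemma ftruncM K f g i : (i < K)%N ->
  (ftrunc K (fmul f g))`_i = (ftrunc K f * ftrunc K g)`_i.
Proof. by move=> iK; rewrite coef_poly iK (fmul_trunc f g iK). Qed.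

Fact faddA : associative fadd. Proof. by move=> f g h; apply/funext=> k; exact: addrA. Qed.
Fact faddC : commutative fadd. Proof. by move=> f g; apply/funext=> k; exact: addrC. Qed.
Fact fadd0 : left_id (fps_cst 0) fadd.
Proof. by move=> f; apply/funext=> -[|k]; exact: add0r. Qed.
Fact faddN : left_inverse (fps_cst 0) fopp fadd.
Proof. by move=> f; apply/funext=> -[|k]; exact: addNr. Qed.
HB.instance Definition _ := GRing.isZmodule.Build (fps B) faddA faddC fadd0 faddN.

Fact fmulA : associative fmul.
Proof.
move=> f g h; apply/funext=> k; rewrite !(fmul_trunc _ _ (ltnSn k)).
transitivity ((ftrunc k.+1 f * (ftrunc k.+1 g * ftrunc k.+1 h))`_k).
  by apply: fps_coefM_eq (ltnSn k) _ _ => // i /ftruncM ->.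
by rewrite mulrA; apply: fps_coefM_eq (ltnSn k) _ _ => // i /ftruncM ->.
Qed.
Fact fmul1 : left_id (fps_cst 1) fmul.
Proof.
move=> f; apply/funext=> k; rewrite /fmul big_ord_recl /= mul1r subn0 big1 ?addr0 //.
by move=> i _; rewrite mul0r.
Qed.
Fact fmulr1 : right_id (fps_cst 1) fmul.
Proof.
move=> f; apply/funext=> k; rewrite /fmul big_ord_recr /= subnn mulr1 big1 ?add0r //.
move=> i _; by case: (k - i)%N (subn_gt0 i k) => [|m] /=; rewrite ltn_ord ?mulr0.
Qed.
Fact fmulDl : left_distributive fmul fadd.
Proof.
move=> f g h; apply/funext=> k; rewrite /fmul /fadd -big_split.
by apply: eq_bigr => i _; exact: mulrDl.
Qed.
Fact fmulDr : right_distributive fmul fadd.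
Proof.
move=> f g h; apply/funext=> k; rewrite /fmul /fadd -big_split.
by apply: eq_bigr => i _; exact: mulrDr.
Qed.
Fact f1neq0 : fps_cst 1 != 0.
Proof. by apply/eqP => /(congr1 (@^~ 0%N)) /eqP; rewrite oner_eq0. Qed.
HB.instance Definition _ := GRing.Zmodule_isNzRing.Build (fps B)
  fmulA fmul1 fmulr1 fmulDl fmulDr f1neq0.

Lemma fpsE f g : (forall k, f k = g k) -> f = g.
Proof. by move=> fg; apply/funext. Qed.
Lemma fpsD f g k : (f + g) k = f k + g k. Proof. by []. Qed.
Lemma fpsN f k : (- f) k = - f k. Proof. by []. Qed.
Lemma fpsB f g k : (f - g) k = f k - g k. Proof. by []. Qed.
Lemma fpsM f g k : (f * g) k = \sum_(i < k.+1) f i * g (k - i)%N. Proof. by []. Qed.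
Lemma fps1 k : (1 : fps B) k = (k == 0%N)%:R. Proof. by case: k. Qed.
Lemma fps0 k : (0 : fps B) k = 0. Proof. by case: k. Qed.

Lemma fps_cstMl (x : B) f k : (fps_cst x * f) k = x * f k.
Proof.
rewrite fpsM big_ord_recl /= subn0 big1 ?addr0 // => i _; exact: mul0r.
Qed.
Lemma fps_cstMr (x : B) f k : (f * fps_cst x) k = f k * x.
Proof.
rewrite fpsM big_ord_recr /= subnn big1 ?add0r // => i _.
by case: (k - i)%N (subn_gt0 i k) => [|m] /=; rewrite ltn_ord ?mulr0.
Qed.

Definition fps_z : fps B := fun k => (k == 1%N)%:R.
Lemma fps_zMl f k : (fps_z * f) k = if k is k'.+1 then f k' else 0.
Proof.
rewrite fpsM big_ord_recl /= mul0r add0r; case: k => [|k]; first by rewrite big_ord0.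
rewrite big_ord_recl /= mul1r subSS subn0 big1 ?addr0 // => i _; exact: mul0r.
Qed.
Lemma fps_zMr f k : (f * fps_z) k = if k is k'.+1 then f k' else 0.
Proof.
rewrite fpsM big_ord_recr /= subnn mulr0 addr0; case: k => [|k]; first by rewrite big_ord0.
rewrite big_ord_recr /= subSnn mulr1 big1 ?add0r // => i _.
by rewrite /fps_z subSn 1?ltnW // eqSS subn_eq0 leqNgt ltn_ord mulr0.
Qed.
Lemma fps_z_comm f : fps_z * f = f * fps_z.
Proof. by apply: fpsE => k; rewrite fps_zMl fps_zMr. Qed.

Lemma fpsM0 f g : (f * g) 0%N = f 0%N * g 0%N.
Proof. by rewrite fpsM big_ord_recl big_ord0 addr0. Qed.

(** The solution of [f * g = 1] coefficient by coefficient when [f 0 = 1], as the list of the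
   coefficients found so far. *)
Fixpoint finv_seq f k : seq B :=
  if k is k'.+1 then
    let s := finv_seq f k' in
    rcons s (- \sum_(i < k'.+1) f i.+1 * s`_(k' - i))
  else [:: 1].

Lemma size_finv_seq f k : size (finv_seq f k) = k.+1.
Proof. by elim: k => //= k IH; rewrite size_rcons IH. Qed.

Lemma nth_finv_seq f k i : (i <= k)%N -> (finv_seq f k)`_i = (finv_seq f i)`_i.
Proof.
elim: k => [|k IH]; first by rewrite leqn0 => /eqP ->.
rewrite leq_eqVlt => /orP[/eqP -> //|ik].
by rewrite /= nth_rcons size_finv_seq ik IH.
Qed.

Definition finv f : fps B := fun k => (finv_seq f k)`_k.

Lemma finvS f k : finv f k.+1 = - \sum_(i < k.+1) f i.+1 * finv f (k - i)%N.
Proof.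
rewrite /finv /= nth_rcons size_finv_seq ltnn eqxx; congr (- _).
by apply: eq_bigr => i _; rewrite nth_finv_seq // leq_subr.
Qed.

Lemma fmulrV_unipotent f : f 0%N = 1 -> f * finv f = 1.
Proof.
move=> f0; apply: fpsE => -[|k]; first by rewrite fpsM0 f0 mul1r.
rewrite fpsM big_ord_recl /= f0 mul1r subn0 finvS addrC; apply/eqP; rewrite subr_eq0; apply/eqP.
by apply: eq_bigr => i _; rewrite /= subSS.
Qed.

(** A right inverse is itself unipotent, so it has a right inverse, which must be [f]. *)
Lemma fmulVr_unipotent f : f 0%N = 1 -> finv f * f = 1.
Proof.
move=> f0; have /fmulrV_unipotent : finv f 0%N = 1 by [].
have := fmulrV_unipotent f0; set g := finv f; set h := finv g => fg gh.
by rewrite -[f]mulr1 -gh (mulrA f) fg mul1r.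
Qed.

Lemma unipotent_mulI f g h : f 0%N = 1 -> f * g = f * h -> g = h.
Proof.
move=> f0 /(congr1 (fun k => finv f * k)).
by rewrite !mulrA fmulVr_unipotent // !mul1r.
Qed.

End FormalSeries.

(** * Polynomial functions of a real variable *)

Lemma derivnCM (A : nzRingType) k (c : A) (p : {poly A}) :
  derivn k (c%:P * p) = c%:P * derivn k p.
Proof. by apply/polyP => i; rewrite coefCM !coef_derivn coefCM mulrnAr. Qed.

Lemma derivn_mul_flat (A : comNzRingType) (c : A) (q : {poly A}) m k : (k < m)%N ->
  (derivn k (('X - c%:P) ^+ m * q)).[c] = 0.
Proof.
elim: k m q => [|k IH] [|m] q // km.
  by rewrite derivn0 hornerM horner_exp !hornerE subrr expr0n mul0r.
rewrite derivSn derivM deriv_exp derivB derivX derivC subr0 mul1r /=.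
have -> : ('X - c%:P) ^+ m *+ m.+1 * q + ('X - c%:P) ^+ m.+1 * deriv q =
   ('X - c%:P) ^+ m * (q *+ m.+1 + ('X - c%:P) * deriv q).
  by rewrite mulrDr mulrnAl mulrnAr exprSr mulrA.
exact: IH.
Qed.

Section PolynomialFunctions.
Variable R : realType.
Local Notation C := R[i].

Lemma cReD (x y : C) : Re (x + y) = Re x + Re y. Proof. by case: x; case: y. Qed.
Lemma cImD (x y : C) : Im (x + y) = Im x + Im y. Proof. by case: x; case: y. Qed.
Lemma cReM (x y : C) : Re (x * y) = Re x * Re y - Im x * Im y.
Proof. by case: x; case: y. Qed.
Lemma cImM (x y : C) : Im (x * y) = Re x * Im y + Im x * Re y.
Proof. by case: x => a b; case: y => c d /=. Qed.
Lemma cReMn (x : C) m : Re (x *+ m) = Re x *+ m.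
Proof. by elim: m => [|m IH] //; rewrite !mulrS cReD IH. Qed.
Lemma cImMn (x : C) m : Im (x *+ m) = Im x *+ m.
Proof. by elim: m => [|m IH] //; rewrite !mulrS cImD IH. Qed.
Lemma complex_eqP (x y : C) : Re x = Re y -> Im x = Im y -> x = y.
Proof. by case: x; case: y => /= ? ? ? ? -> ->. Qed.

(** The polynomials that give the real and imaginary parts on the real axis. *)
Definition pRe (p : {poly C}) : {poly R} := \poly_(i < size p) Re p`_i.
Definition pIm (p : {poly C}) : {poly R} := \poly_(i < size p) Im p`_i.

Lemma coef_pRe p i : (pRe p)`_i = Re p`_i.
Proof. by rewrite coef_poly; case: ltnP => // /(nth_default 0) ->. Qed.
Lemma coef_pIm p i : (pIm p)`_i = Im p`_i.
Proof. by rewrite coef_poly; case: ltnP => // /(nth_default 0) ->. Qed.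

Lemma Re_horner p (y : R) : Re p.[y%:C] = (pRe p).[y].
Proof.
rewrite horner_poly horner_coef (big_morph (@Re R) cReD (erefl : Re 0 = 0)).
by apply: eq_bigr => i _; rewrite -rmorphXn cReM /= mulr0 subr0.
Qed.
Lemma Im_horner p (y : R) : Im p.[y%:C] = (pIm p).[y].
Proof.
rewrite horner_poly horner_coef (big_morph (@Im R) cImD (erefl : Im 0 = 0)).
by apply: eq_bigr => i _; rewrite -rmorphXn cImM /= mulr0 add0r.
Qed.

Lemma pRe_deriv p : pRe (deriv p) = deriv (pRe p).
Proof.
apply/polyP => i; rewrite coef_deriv !coef_pRe coef_deriv.
exact: cReMn.
Qed.
Lemma pIm_deriv p : pIm (deriv p) = deriv (pIm p).
Proof.
apply/polyP => i; rewrite coef_deriv !coef_pIm coef_deriv.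
exact: cImMn.
Qed.

Lemma derive1n_Re_horner k (p : {poly C}) :
  derive1n k (fun y : R => Re p.[y%:C]) = horner (pRe (derivn k p)).
Proof.
elim: k => [|k IH]; first by apply/funext => y; exact: Re_horner.
by rewrite derive1nS IH -derivE derivnS pRe_deriv.
Qed.
Lemma derive1n_Im_horner k (p : {poly C}) :
  derive1n k (fun y : R => Im p.[y%:C]) = horner (pIm (derivn k p)).
Proof.
elim: k => [|k IH]; first by apply/funext => y; exact: Im_horner.
by rewrite derive1nS IH -derivE derivnS pIm_deriv.
Qed.

(** Turns the analytic derivatives in the jets into formal derivatives of polynomials. *)
Lemma cderiven_horner k (p : {poly C}) x :
  cderiven k (fun y : R => p.[y%:C]) x = (derivn k p).[x%:C].
Proof.
rewrite /cderiven derive1n_Re_horner derive1n_Im_horner.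
by apply: complex_eqP; rewrite /= ?Re_horner ?Im_horner.
Qed.

Lemma msmooth1_horner m n (V : 'M[{poly C}]_(m, n)) :
  msmooth1 (fun y : R => map_mx (fun p => p.[y%:C]) V).
Proof.
move=> i j; split=> k x.
- rewrite (_ : (fun y : R => _) = (fun y : R => Re (V i j).[y%:C])).
    by rewrite derive1n_Re_horner; exact: derivable_horner.
  by apply/funext => y; rewrite mxE.
- rewrite (_ : (fun y : R => _) = (fun y : R => Im (V i j).[y%:C])).
    by rewrite derive1n_Im_horner; exact: derivable_horner.
  by apply/funext => y; rewrite mxE.
Qed.

Lemma poly_real_roots (p : {poly C}) : (forall x : R, p.[x%:C] = 0) -> p = 0.
Proof.
move=> px; apply/eqP/negPn/negP => p0.
have := @max_poly_roots _ p [seq (i%:R : C) | i <- iota 0 (size p)] p0.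
rewrite size_map size_iota ltnn => H.
apply/notF/H.
  apply/allP => _ /mapP[i _ ->]; apply/rootP.
  by rewrite -(px i%:R) rmorph_nat.
by rewrite map_inj_uniq ?iota_uniq // => i j /eqP; rewrite eqr_nat => /eqP.
Qed.

Lemma poly_deriv_eq0 (p : {poly C}) : deriv p = 0 -> p = (p`_0)%:P.
Proof.
move=> p'; apply/polyP => -[|i]; rewrite coefC //=.
have /eqP := congr1 (fun q : {poly C} => q`_i) p'.
by rewrite coef_deriv coef0 mulrn_eq0 => /orP[|/eqP].
Qed.

End PolynomialFunctions.

(** * Differential polynomials and the vanishing principle *)

Section DifferentialPolynomials.
Variables (R : realType) (n : nat).
Local Notation C := R[i].
Local Notation M := 'M[C]_n.+1.
Local Notation dpoly := (dpoly R n).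
Local Notation dmx := 'M[dpoly]_n.+1.
Local Notation jets := ('I_n.+1 -> 'I_n.+1 -> nat -> C).

Fixpoint total_deriv (p : dpoly) : dpoly :=
  match p with
  | DConst _ => DConst n 0
  | DVar i j k => DVar R i j k.+1
  | DAdd p q => DAdd (total_deriv p) (total_deriv q)
  | DMul p q => DAdd (DMul (total_deriv p) q) (DMul p (total_deriv q))
  end.

Fixpoint dord (p : dpoly) : nat :=
  match p with
  | DConst _ => 0
  | DVar _ _ k => k
  | DAdd p q | DMul p q => maxn (dord p) (dord q)
  end.

Lemma deval_dord (J J' : jets) p :
  (forall i j k, (k <= dord p)%N -> J i j k = J' i j k) -> deval J p = deval J' p.
Proof.
elim: p => //= [i j k|p IHp q IHq|p IHp q IHq] H; first exact: H.
all: by rewrite IHp ?IHq // => i j k kp; apply: H; rewrite leq_max kp ?orbT.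
Qed.

(** A bound for the derivatives of [u] that occur in the entries. *)
Definition mxord (P : dmx) : nat := \max_(ij : 'I_n.+1 * 'I_n.+1) dord (P ij.1 ij.2).

Lemma leq_mxord (P : dmx) i j : (dord (P i j) <= mxord P)%N.
Proof. exact: (leq_bigmax (i, j)). Qed.

Definition dmev (J : jets) (P : dmx) : M := map_mx (deval J) P.

Lemma dmev_ord (J J' : jets) P :
  (forall i j k, (k <= mxord P)%N -> J i j k = J' i j k) -> dmev J P = dmev J' P.
Proof.
move=> H; apply/matrixP => i j; rewrite !mxE; apply: deval_dord => i' j' k kp.
by apply: H; exact: leq_trans kp (leq_mxord P i j).
Qed.

Definition jetmx (J : jets) k : M := \matrix_(i, j) J i j k.
Definition jets_in (V : M -> Prop) (J : jets) := forall k, V (jetmx J k).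
Definition jet0 : jets := fun _ _ _ => 0.

(** The value of a differential polynomial on a matrix of polynomials, as a polynomial. *)
Fixpoint pval (V : 'M[{poly C}]_n.+1) (p : dpoly) : {poly C} :=
  match p with
  | DConst c => c%:P
  | DVar i j k => derivn k (V i j)
  | DAdd p q => pval V p + pval V q
  | DMul p q => pval V p * pval V q
  end.

Definition pjet (V : 'M[{poly C}]_n.+1) (x : C) : jets :=
  fun i j k => (derivn k (V i j)).[x].

Lemma deriv_pval V p : deriv (pval V p) = pval V (total_deriv p).
Proof.
elim: p => //= [c|p IHp q IHq|p IHp q IHq]; first exact: derivC.
  by rewrite derivD IHp IHq.
by rewrite derivM IHp IHq.
Qed.

Lemma horner_pval V p x : (pval V p).[x] = deval (pjet V x) p.
Proof. by elim: p => //= [c|p <- q <-|p <- q <-]; rewrite !hornerE. Qed.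

Lemma jet_pval V (x : R) :
  jet (fun y : R => map_mx (fun p => p.[y%:C]) V) x = pjet V x%:C.
Proof.
apply/funext => i; apply/funext => j; apply/funext => k.
rewrite /jet /pjet -cderiven_horner; congr (cderiven k _ x).
by apply/funext => y; rewrite mxE.
Qed.

Definition real_subspace (V : M -> Prop) :=
  V 0 /\ forall (r : R) X Y, V X -> V Y -> V (r%:C *: X + Y).
Definition real_linear (L : M -> M) :=
  forall (r : R) X Y, L (r%:C *: X + Y) = r%:C *: L X + L Y.

Lemma real_subspace_sum V (I : Type) (s : seq I) (r : I -> R) (X : I -> M) :
  real_subspace V -> (forall i, V (X i)) -> V (\sum_(i <- s) (r i)%:C *: X i).
Proof.
move=> [V0 VD] VX; elim: s => [|i s IH]; first by rewrite big_nil.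
by rewrite big_cons; apply: VD.
Qed.

Lemma real_linear0 L : real_linear L -> L 0 = 0.
Proof.
move=> LL; have := LL 1 0 0; rewrite rmorph1 !scale1r add0r => /eqP.
by rewrite -subr_eq subrr eq_sym => /eqP.
Qed.

Lemma real_linear_sum L (I : Type) (s : seq I) (r : I -> R) (X : I -> M) :
  real_linear L ->
  L (\sum_(i <- s) (r i)%:C *: X i) = \sum_(i <- s) (r i)%:C *: L (X i).
Proof.
move=> LL; elim: s => [|i s IH]; first by rewrite !big_nil (real_linear0 LL).
by rewrite !big_cons LL IH.
Qed.

(** A polynomial that agrees with 1 to order [K] at 0 and vanishes to order [K] at 1.  It has
   real coefficients, so multiplying by it does not leave a real subspace. *)
Lemma bezout01 K : exists w : {poly R},
  (exists v, w = 1 + 'X^K * v) /\ exists v, w = ('X - 1%:P) ^+ K * v.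
Proof.
have : coprimep (('X : {poly R}) ^+ K) (('X - 1%:P) ^+ K).
  apply/coprimep_expl/coprimep_expr; rewrite -[X in coprimep X]subr0 -polyC0.
  by rewrite coprimep_XsubC root_XsubC oner_eq0.
case/Bezout_eq1_coprimepP=> -[s t] /= st.
(* a multiple of [(X - 1)^K] that is [1 - s X^K] by the Bezout identity *)
exists (t * ('X - 1%:P) ^+ K); split; last by exists t; rewrite mulrC.
by exists (- s); apply/eqP; rewrite -subr_eq mulrN opprK addrC mulrC st.
Qed.

(** The Taylor polynomial of the jet at 0 times the polynomial of the preceding lemma. *)
Lemma interpolation V (J : jets) K : real_subspace V -> jets_in V J ->
  exists W : 'M[{poly C}]_n.+1,
  [/\ forall x : R, jets_in V (pjet W x%:C),
      forall i j k, (k <= K)%N -> pjet W 0 i j k = J i j k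
    & forall i j k, (k <= K)%N -> pjet W 1 i j k = 0].
Proof.
move=> VV VJ; have [w [[v wv] [v' wv']]] := bezout01 K.+1.
pose q m : {poly R} := ((m`!%:R)^-1)%:P * ('X^m * w).
pose W : 'M[{poly C}]_n.+1 := \matrix_(i, j) \sum_(m < K.+1)
  (J i j m)%:P * map_poly (real_complex R) (q m).
have dW i j k : derivn k (W i j) =
    \sum_(m < K.+1) (J i j m)%:P * map_poly (real_complex R) (derivn k (q m)).
  rewrite mxE (raddf_sum (derivn k)); apply: eq_bigr => m _.
  by rewrite /= derivnCM derivn_map.
exists W; split.
- move=> x k; have -> : jetmx (pjet W x%:C) k =
      \sum_(m < K.+1) ((derivn k (q m)).[x])%:C *: jetmx J m.
    apply/matrixP => i j; rewrite mxE /pjet dW horner_sum summxE.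
    by apply: eq_bigr => m _; rewrite !mxE !hornerE horner_map mulrC.
  exact: real_subspace_sum.
- move=> i j k kK; rewrite /pjet dW horner_sum.
  have qk m : (derivn k (q m)).[0] = (m == k)%:R.
    rewrite /q wv mulrDr mulr1 derivnCM derivnD hornerM hornerD hornerC.
    have := @derivn_mul_flat _ (0 : R) ('X^m * v) K.+1 k kK.
    rewrite polyC0 subr0 (mulrCA 'X^m) => ->; rewrite addr0 derivnXn hornerMn hornerXn.
    have [->|mk] := eqVneq m k.
      by rewrite subnn expr0 ffactnn mulVf // pnatr_eq0 -lt0n fact_gt0.
    have [mk'|mk'] := ltnP m k; first by rewrite ffact_small // mulr0n mulr0.
    by rewrite expr0n subn_eq0 leqNgt ltn_neqAle eq_sym mk mk' mul0rn mulr0.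
  rewrite (bigD1 (Ordinal (n:=K.+1) (m:=k) kK)) //= big1 ?addr0.
    by rewrite !hornerE -(rmorph0 (real_complex R)) horner_map qk eqxx rmorph1 mulr1.
  move=> m mk; rewrite !hornerE -(rmorph0 (real_complex R)) horner_map qk.
  by rewrite -val_eqE /= in mk; rewrite (negbTE mk) rmorph0 mulr0.
- move=> i j k kK; rewrite /pjet dW horner_sum big1 // => m _.
  rewrite !hornerE -(rmorph1 (real_complex R)) horner_map /= /q wv' derivnCM hornerM (mulrCA 'X^m).
  by rewrite derivn_mul_flat // mulr0 rmorph0 mulr0.
Qed.

Section RealLinearFunctionals.
Variables (V : M -> Prop) (L : M -> M).
Hypotheses (VV : real_subspace V) (LL : real_linear L).

(** [L] applied coefficientwise to a matrix of polynomials; being real-linear, [L] commutes with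
   the evaluation at real points. *)
Definition Lpoly (B : 'M[{poly C}]_n.+1) (i j : 'I_n.+1) : {poly C} :=
  \poly_(m < \max_(kl : 'I_n.+1 * 'I_n.+1) size (B kl.1 kl.2))
    L (map_mx (fun p : {poly C} => p`_m) B) i j.

Lemma coef_Lpoly B i j m :
  (Lpoly B i j)`_m = L (map_mx (fun p : {poly C} => p`_m) B) i j.
Proof.
rewrite coef_poly; case: ltnP => // sm.
have -> : map_mx (fun p : {poly C} => p`_m) B = 0.
  apply/matrixP => k l; rewrite !mxE nth_default //.
  by apply: leq_trans sm; exact: (leq_bigmax (k, l)).
by rewrite (real_linear0 LL) mxE.
Qed.

Lemma horner_Lpoly B (x : R) i j :
  (Lpoly B i j).[x%:C] = L (map_mx (fun p => p.[x%:C]) B) i j.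
Proof.
set s := \max_(kl : 'I_n.+1 * 'I_n.+1) size (B kl.1 kl.2).
have -> : map_mx (fun p => p.[x%:C]) B =
    \sum_(m < s) (x ^+ m)%:C *: map_mx (fun p : {poly C} => p`_m) B.
  apply/matrixP => k l; rewrite mxE summxE.
  rewrite (@horner_coef_wide _ s); last exact: (leq_bigmax (k, l)).
  by apply: eq_bigr => m _; rewrite !mxE mulrC rmorphXn.
rewrite real_linear_sum // summxE horner_poly.
by apply: eq_bigr => m _; rewrite mxE mulrC rmorphXn.
Qed.

Lemma deriv_Lpoly B i j : deriv (Lpoly B i j) = Lpoly (map_mx (@deriv _) B) i j.
Proof.
apply/polyP => m; rewrite coef_deriv !coef_Lpoly.
have -> : map_mx (fun p : {poly C} => p`_m) (map_mx (@deriv _) B) =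
    (m.+1%:R : R)%:C *: map_mx (fun p : {poly C} => p`_m.+1) B + 0.
  apply/matrixP => k l; rewrite !mxE coef_deriv addr0 rmorph_nat.
  by rewrite mulr_natl.
rewrite (LL m.+1%:R (map_mx (fun p : {poly C} => p`_m.+1) B) 0) (real_linear0 LL) addr0 mxE.
by rewrite rmorph_nat mulr_natl.
Qed.

Lemma pjet_Lpoly (P : dmx) W (x : R) i j :
  (Lpoly (map_mx (pval W) P) i j).[x%:C] = L (dmev (pjet W x%:C) P) i j.
Proof.
rewrite horner_Lpoly -map_mx_comp; congr (L _ i j).
by apply/matrixP => k l; rewrite !mxE /= horner_pval.
Qed.

Lemma deriv_Lpoly_pval (P : dmx) W i j :
  deriv (Lpoly (map_mx (pval W) P) i j) = Lpoly (map_mx (pval W) (map_mx total_deriv P)) i j.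
Proof.
rewrite deriv_Lpoly; congr (Lpoly _ i j).
by apply/matrixP => k l; rewrite !mxE deriv_pval.
Qed.

(** Along a polynomial function with values in [V] the expression is the zero function. *)
Lemma vanishing_derivative (P : dmx) :
  (forall J, jets_in V J -> L (dmev J P) = 0) ->
  forall J, jets_in V J -> L (dmev J (map_mx total_deriv P)) = 0.
Proof.
move=> H J VJ; have [W [WV W0 _]] := interpolation (mxord (map_mx total_deriv P)) VV VJ.
rewrite -(dmev_ord W0); apply/matrixP => i j.
rewrite -(rmorph0 (real_complex R)) -pjet_Lpoly -deriv_Lpoly_pval.
rewrite (_ : Lpoly _ i j = 0) ?deriv0 ?horner0 ?mxE ?rmorph0 //.
by apply: poly_real_roots => x; rewrite pjet_Lpoly H // mxE.
Qed.

(** The expression is constant along a polynomial function that joins the given jet, at 0, to the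
   zero jet, at 1. *)
Lemma vanishing_principle (P : dmx) :
  (forall J, jets_in V J -> L (dmev J (map_mx total_deriv P)) = 0) ->
  L (dmev jet0 P) = 0 ->
  forall J, jets_in V J -> L (dmev J P) = 0.
Proof.
move=> H P0 J VJ; have [W [WV W0 W1]] := interpolation (mxord P) VV VJ.
rewrite -(dmev_ord W0); apply/matrixP => i j.
rewrite -(rmorph0 (real_complex R)) -pjet_Lpoly.
have /poly_deriv_eq0 cst : deriv (Lpoly (map_mx (pval W) P) i j) = 0.
  apply: poly_real_roots => x.
  by rewrite deriv_Lpoly_pval pjet_Lpoly H // mxE.
have := pjet_Lpoly P W 1 i j; rewrite cst !hornerC => ->.
by rewrite rmorph1 (dmev_ord W1) P0.
Qed.

End RealLinearFunctionals.

End DifferentialPolynomials.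

(** * The centralizer of a diagonal matrix *)

Section DiagonalSplitting.
Variables (R : realType) (n : nat).
Local Notation C := R[i].
Local Notation M := 'M[C]_n.+1.
Variable a : M.
Hypothesis ha : is_diag_mx a.

Lemma lieE (X Y : M) : lie X Y = X * Y - Y * X. Proof. by []. Qed.

(** The projection to the centralizer of [a] along the image of [ad a], and the inverse of [ad a]
   on that image. *)
Definition cent_part (X : M) : M := \matrix_(i, j) (if a i i == a j j then X i j else 0).
Definition ad_inv (X : M) : M :=
  \matrix_(i, j) (if a i i == a j j then 0 else X i j / (a i i - a j j)).

Lemma diag_mulE (X : M) i j : (a * X) i j = a i i * X i j.
Proof.
rewrite mxE (bigD1 i) //= big1 ?addr0 // => k ki.
by move/is_diag_mxP: ha => /(_ i k) ->; rewrite ?mul0r // eq_sym.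
Qed.
Lemma mul_diagE (X : M) i j : (X * a) i j = X i j * a j j.
Proof.
rewrite mxE (bigD1 j) //= big1 ?addr0 // => k kj.
by move/is_diag_mxP: ha => /(_ k j) ->; rewrite ?mulr0.
Qed.
Lemma adE X i j : (a * X - X * a) i j = (a i i - a j j) * X i j.
Proof.
transitivity ((a * X) i j - (X * a) i j); first by rewrite !mxE.
by rewrite diag_mulE mul_diagE mulrBl (mulrC (X i j)).
Qed.

Lemma ad_adK X : a * ad_inv X - ad_inv X * a = X - cent_part X.
Proof.
apply/matrixP => i j; rewrite adE !mxE; have [->|ij] := eqVneq; first by rewrite mulr0 subrr.
by rewrite subr0 mulrC divfK // subr_eq0.
Qed.
Lemma cent_part_ad X : cent_part (a * X - X * a) = 0.
Proof.
apply/matrixP => i j; rewrite mxE adE mxE.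
by have [->|//] := eqVneq; rewrite subrr mul0r.
Qed.
Lemma cent_part_ad_inv X : cent_part (ad_inv X) = 0.
Proof. apply/matrixP => i j; rewrite !mxE. by case: (a i i == a j j). Qed.
Lemma ad_inv0 : ad_inv 0 = 0.
Proof. by apply/matrixP => i j; rewrite !mxE mul0r if_same. Qed.
Lemma cent_part_id X : a * X = X * a -> cent_part X = X.
Proof.
move=> aX; apply/matrixP => i j; rewrite mxE; have [//|ij] := eqVneq.
have := adE X i j; rewrite aX subrr mxE => /esym/eqP.
by rewrite mulf_eq0 subr_eq0 (negbTE ij) => /eqP.
Qed.
Lemma cent_part_comm X : a * cent_part X = cent_part X * a.
Proof.
apply/eqP; rewrite -subr_eq0; apply/eqP/matrixP => i j; rewrite adE !mxE.
by have [->|_] := eqVneq; rewrite ?subrr ?mul0r ?mulr0.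
Qed.
Lemma cent_partD X Y : cent_part (X + Y) = cent_part X + cent_part Y.
Proof. by apply/matrixP => i j; rewrite !mxE; case: ifP => //; rewrite addr0. Qed.
Lemma cent_partZ c X : cent_part (c *: X) = c *: cent_part X.
Proof. by apply/matrixP => i j; rewrite !mxE; case: ifP => //; rewrite mulr0. Qed.
Lemma cent_partN X : cent_part (- X) = - cent_part X.
Proof. by rewrite -scaleN1r cent_partZ scaleN1r. Qed.
Lemma cent_part_adN X : cent_part (X * a - a * X) = 0.
Proof. by rewrite -opprB cent_partN cent_part_ad oppr0. Qed.
Lemma cent_partB X Y : cent_part (X - Y) = cent_part X - cent_part Y.
Proof. by rewrite cent_partD cent_partN. Qed.
Lemma cent_part0 : cent_part 0 = 0. Proof. by apply/matrixP => i j; rewrite !mxE if_same. Qed.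
Lemma cent_part_sum (I : finType) (F : I -> M) : cent_part (\sum_i F i) = \sum_i cent_part (F i).
Proof. exact: (big_morph cent_part cent_partD cent_part0). Qed.
Lemma cent_part1 : cent_part 1 = 1. Proof. by apply: cent_part_id; rewrite mulr1 mul1r. Qed.

Lemma cent_partMl X Y : a * X = X * a -> cent_part (X * Y) = X * cent_part Y.
Proof.
move=> aX; rewrite -[in LHS](subrK (cent_part Y) Y) -ad_adK mulrDr cent_partD.
rewrite [X in _ + X]cent_part_id; last by rewrite mulrA aX -!mulrA cent_part_comm.
set Z := ad_inv Y; have -> : X * (a * Z - Z * a) = a * (X * Z) - (X * Z) * a.
  by rewrite mulrBr !mulrA aX.
by rewrite cent_part_ad add0r.
Qed.
Lemma cent_partMr X Y : a * X = X * a -> cent_part (Y * X) = cent_part Y * X.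
Proof.
move=> aX; rewrite -[in LHS](subrK (cent_part Y) Y) -ad_adK mulrDl cent_partD.
rewrite [X in _ + X]cent_part_id; last by rewrite mulrA cent_part_comm -!mulrA aX.
set Z := ad_inv Y; have -> : (a * Z - Z * a) * X = a * (Z * X) - (Z * X) * a.
  by rewrite mulrBl -!mulrA aX.
by rewrite cent_part_ad add0r.
Qed.

(** Tested on the elementary matrices [E_ji] with [a_i = a_j] and on the differences
   [E_ii - E_jj]; the trace then removes the remaining constant diagonal. *)
Lemma sl_perpP X : in_sl_perp a X <-> cent_part X = 0.
Proof.
split=> [[trX pX]|pX].
- have offd i j : i != j -> a i i = a j j -> X i j = 0.
    move=> ij aij; have := pX (delta_mx j i); rewrite /in_sl mxtrace_mulC.
    rewrite (_ : \tr (delta_mx j i *m X) = X i j); last first.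
      rewrite /mxtrace (bigD1 j) //= big1 ?addr0 => [|k kj].
        rewrite mxE (bigD1 i) //= mxE !eqxx mul1r big1 ?addr0 // => l li.
        by rewrite mxE (negbTE li) andbF mul0r.
      by rewrite mxE big1 // => l _; rewrite mxE (negbTE kj) mul0r.
    apply.
      rewrite /mxtrace big1 // => k _; rewrite mxE.
      by have [->|//] := eqVneq k j; rewrite eq_sym (negbTE ij).
    apply/matrixP => k l; rewrite lieE adE !mxE.
    have [->|_] := eqVneq k j; have [->|_] := eqVneq l i; rewrite /= ?mulr0 //.
    by rewrite aij subrr mul0r.
  have dg i j : X i i = X j j.
    have [->//|ij] := eqVneq i j.
    have := pX (delta_mx i i - delta_mx j j); rewrite /in_sl mulmxBr !linearB /=.
    have trd k : \tr (X *m delta_mx k k) = X k k.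
      rewrite mxtrace_mulC /mxtrace (bigD1 k) //= big1 ?addr0 => [|l lk].
        rewrite mxE (bigD1 k) //= mxE !eqxx mul1r big1 ?addr0 // => m mk.
        by rewrite mxE (negbTE mk) andbF mul0r.
      by rewrite mxE big1 // => m _; rewrite mxE (negbTE lk) mul0r.
    have tr1 k : \tr (delta_mx k k : M) = 1.
      rewrite /mxtrace (bigD1 k) //= mxE !eqxx big1 ?addr0 // => l lk.
      by rewrite mxE (negbTE lk).
    rewrite !trd !tr1 subrr => /(_ erefl) H; apply/eqP; rewrite -subr_eq0; apply/eqP/H.
    apply/matrixP => k l; rewrite lieE adE !mxE.
    have [->|kl] := eqVneq k l; first by rewrite subrr mul0r.
    have off m : (k == m) && (l == m) = false.
      by apply/negP => /andP[/eqP km /eqP lm]; rewrite km lm eqxx in kl.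
    by rewrite !off subr0 mulr0.
  have d0 i : X i i = 0.
    move: trX; rewrite /in_sl /mxtrace (eq_bigr (fun=> X i i)) => [|k _]; last exact: dg.
    rewrite sumr_const card_ord => /eqP; rewrite mulrn_eq0 /= => /eqP //.
  apply/matrixP => i j; rewrite !mxE; case: eqP => // aij.
  by have [->|ij] := eqVneq i j; [exact: d0 | exact: offd].
- split.
    rewrite /in_sl /mxtrace big1 // => i _.
    by have /matrixP/(_ i i) := pX; rewrite !mxE eqxx.
  move=> Y _ /eqP; rewrite lieE subr_eq0 => /eqP aY.
  rewrite /mxtrace big1 // => i _.
  have /matrixP/(_ i i) : cent_part (X * Y) = 0 by rewrite cent_partMr // pX mul0r.
  by rewrite [LHS]mxE eqxx [RHS]mxE.
Qed.

Lemma real_subspace_perp : real_subspace (fun X => cent_part X = 0).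
Proof.
by split=> [|r X Y X0 Y0]; rewrite ?cent_part0 // cent_partD cent_partZ X0 Y0 scaler0 addr0.
Qed.
Lemma real_linear_cent_part : real_linear cent_part.
Proof. by move=> r X Y; rewrite cent_partD cent_partZ. Qed.
Lemma real_linear_id : real_linear (id : M -> M). Proof. by []. Qed.

End DiagonalSplitting.

(** * The formal gauge transformation to normal form *)

Section NormalForm.
Variables (R : realType) (n : nat).
Local Notation C := R[i].
Local Notation M := 'M[C]_n.+1.
Local Notation dpoly := (dpoly R n).
Local Notation dmx := 'M[dpoly]_n.+1.
Local Notation jets := ('I_n.+1 -> 'I_n.+1 -> nat -> C).
Implicit Types (P Q : dmx) (J : jets).

Local Notation dm P := (map_mx (@total_deriv R n) P).

(** Ring operations on matrices of differential polynomials, whose entries are mere terms.  The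
   lemmas [dmev_*] give their values, the lemmas [dm_*] the values of their total derivatives. *)
Definition dconst (X : M) : dmx := map_mx (DConst n) X.
Definition dvar : dmx := \matrix_(i, j) DVar R i j 0.
Definition dadd P Q : dmx := \matrix_(i, j) DAdd (P i j) (Q i j).
Definition dopp P : dmx := \matrix_(i, j) DMul (DConst n (-1)) (P i j).
Definition dmul P Q : dmx :=
  \matrix_(i, j) \big[@DAdd R n/DConst n 0]_k DMul (P i k) (Q k j).
Definition dsum m (F : 'I_m -> dmx) : dmx := \big[dadd/dconst 0]_i F i.

Lemma dmev_const J X : dmev J (dconst X) = X.
Proof. by apply/matrixP => i j; rewrite !mxE. Qed.
Lemma dmev_var J : dmev J dvar = jetmx J 0.
Proof. by apply/matrixP => i j; rewrite !mxE. Qed.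
Lemma dmev_add J P Q : dmev J (dadd P Q) = dmev J P + dmev J Q.
Proof. by apply/matrixP => i j; rewrite !mxE. Qed.
Lemma dmev_opp J P : dmev J (dopp P) = - dmev J P.
Proof. by apply/matrixP => i j; rewrite !mxE /= mulN1r. Qed.
Lemma dmev_mul J P Q : dmev J (dmul P Q) = dmev J P * dmev J Q.
Proof.
apply/matrixP => i j; rewrite !mxE (big_morph (deval J) (id1 := 0) (op1 := +%R)) //.
by apply: eq_bigr => k _; rewrite !mxE.
Qed.
Lemma dmev_sum J m (F : 'I_m -> dmx) : dmev J (dsum F) = \sum_i dmev J (F i).
Proof.
by rewrite /dsum (big_morph (dmev J) (id1 := 0) (op1 := +%R)) ?dmev_const //; exact: dmev_add.
Qed.

Lemma dm_const J X : dmev J (dm (dconst X)) = 0.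
Proof. by apply/matrixP => i j; rewrite !mxE. Qed.
Lemma dm_add J P Q : dmev J (dm (dadd P Q)) = dmev J (dm P) + dmev J (dm Q).
Proof. by apply/matrixP => i j; rewrite !mxE. Qed.
Lemma dm_opp J P : dmev J (dm (dopp P)) = - dmev J (dm P).
Proof. by apply/matrixP => i j; rewrite !mxE /= mul0r add0r mulN1r. Qed.
Lemma dm_mul J P Q :
  dmev J (dm (dmul P Q)) = dmev J (dm P) * dmev J Q + dmev J P * dmev J (dm Q).
Proof.
apply/matrixP => i j; rewrite !mxE.
rewrite (big_morph (fun p => deval J (total_deriv p)) (id1 := 0) (op1 := +%R)) // -big_split.
by apply: eq_bigr => k _; rewrite !mxE.
Qed.
Lemma dm_sum J m (F : 'I_m -> dmx) : dmev J (dm (dsum F)) = \sum_i dmev J (dm (F i)).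
Proof.
rewrite /dsum (big_morph (fun P => dmev J (dm P)) (id1 := 0) (op1 := +%R)) ?dm_const //.
exact: dm_add.
Qed.

Lemma dm_jet0 P : dmev (@jet0 R n) (dm P) = 0.
Proof.
apply/matrixP => i j; rewrite !mxE.
elim: (P i j) => //= [p -> q ->|p -> q ->]; first by rewrite addr0.
by rewrite mul0r mulr0 addr0.
Qed.

(** Formal series in [1 / lambda] of such matrices, evaluated on a jet; [dser] evaluates the
   total derivative. *)
Definition ser J (s : nat -> dmx) : fps M := fun k => dmev J (s k).
Definition dser J (s : nat -> dmx) : fps M := fun k => dmev J (dm (s k)).
Definition smul (s r : nat -> dmx) k := dsum (fun i : 'I_k.+1 => dmul (s i) (r (k - i)%N)).
Definition ssub (s r : nat -> dmx) k := dadd (s k) (dopp (r k)).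
Definition sconst X k : dmx := if k is 0 then dconst X else dconst 0.

Lemma ser_mul J s r : ser J (smul s r) = ser J s * ser J r.
Proof.
by apply: fpsE => k; rewrite fpsM /ser dmev_sum; apply: eq_bigr => i _; rewrite dmev_mul.
Qed.
Lemma ser_sub J s r : ser J (ssub s r) = ser J s - ser J r.
Proof. by apply: fpsE => k; rewrite /ser dmev_add dmev_opp. Qed.
Lemma ser_const J X : ser J (sconst X) = fps_cst X.
Proof. by apply: fpsE => -[|k]; rewrite /ser dmev_const. Qed.
Lemma dser_mul J s r : dser J (smul s r) = dser J s * ser J r + ser J s * dser J r.
Proof.
apply: fpsE => k; rewrite fpsD !fpsM -big_split /dser dm_sum.
by apply: eq_bigr => i _; rewrite dm_mul.
Qed.
Lemma dser_sub J s r : dser J (ssub s r) = dser J s - dser J r.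
Proof. by apply: fpsE => k; rewrite /dser dm_add dm_opp. Qed.
Lemma dser_const J X : dser J (sconst X) = 0.
Proof. by apply: fpsE => -[|k]; rewrite /dser dm_const ?fps0. Qed.

Variable a : M.
Hypothesis ha : is_diag_mx a.
Local Notation cent_part := (cent_part a).
Local Notation perp := (fun X => cent_part X = 0).

Definition dcent_part P : dmx := \matrix_(i, j) (if a i i == a j j then P i j else DConst n 0).
Definition dad_inv P : dmx := \matrix_(i, j)
  (if a i i == a j j then DConst n 0 else DMul (DConst n (a i i - a j j)^-1) (P i j)).

Lemma dmev_cent_part J P : dmev J (dcent_part P) = cent_part (dmev J P).
Proof. by apply/matrixP => i j; rewrite !mxE; case: ifP. Qed.
Lemma dmev_ad_inv J P : dmev J (dad_inv P) = ad_inv a (dmev J P).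
Proof. by apply/matrixP => i j; rewrite !mxE; case: ifP => //= _; rewrite mulrC. Qed.
Lemma dm_ad_inv J P : dmev J (dm (dad_inv P)) = ad_inv a (dmev J (dm P)).
Proof.
by apply/matrixP => i j; rewrite !mxE; case: ifP => //= _; rewrite mul0r add0r mulrC.
Qed.

(** The next coefficient of the gauge transformation, obtained from the gauge equation by inverting
   [ad a]; the sum is the contribution of the normal form, whose coefficients are the centralizer
   parts of [N_i u]. *)
Definition gauge_next (s : seq dmx) k : dmx :=
  let N i := nth (dconst 0) s i in
  dad_inv (dadd (dmul (N k) dvar) (dopp (dadd (dm (N k))
    (dsum (fun i : 'I_k.+1 => dmul (dcent_part (dmul (N i) dvar)) (N (k - i)%N)))))).

Fixpoint gauge_seq k : seq dmx :=
  if k is k'.+1 then rcons (gauge_seq k') (gauge_next (gauge_seq k') k')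
  else [:: dconst 1].

Definition gauge k : dmx := nth (dconst 0) (gauge_seq k) k.

Lemma size_gauge_seq k : size (gauge_seq k) = k.+1.
Proof. by elim: k => //= k IH; rewrite size_rcons IH. Qed.
Lemma nth_gauge_seq k i : (i <= k)%N -> nth (dconst 0) (gauge_seq k) i = gauge i.
Proof.
elim: k => [|k IH]; first by rewrite leqn0 => /eqP ->.
rewrite leq_eqVlt => /orP[/eqP -> //|ik].
by rewrite /= nth_rcons size_gauge_seq ik IH.
Qed.

(** The coefficients of the normal form: the gauged connection is
   [a lambda + sum_k normal_coef k lambda^-k]. *)
Definition normal_coef J : fps M := fun k => cent_part (dmev J (gauge k) * jetmx J 0).

Lemma gauge0 J : dmev J (gauge 0) = 1.
Proof. by rewrite dmev_const. Qed.

Lemma gaugeS J k : dmev J (gauge k.+1) = ad_inv a (dmev J (gauge k) * jetmx J 0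
   - (dmev J (dm (gauge k)) + (normal_coef J * ser J gauge) k)).
Proof.
rewrite /gauge /= nth_rcons size_gauge_seq ltnn eqxx dmev_ad_inv; congr (ad_inv a _).
rewrite dmev_add dmev_opp dmev_add dmev_mul dmev_var dmev_sum fpsM.
congr (_ - (_ + _)); apply: eq_bigr => i _.
rewrite dmev_mul dmev_cent_part dmev_mul dmev_var !nth_gauge_seq ?leq_subr //.
by rewrite -ltnS ltn_ord.
Qed.

Lemma cent_part_gaugeS J k : cent_part (dmev J (gauge k.+1)) = 0.
Proof. by rewrite gaugeS cent_part_ad_inv. Qed.

Lemma cent_part_dm_gauge J k : cent_part (dmev J (dm (gauge k))) = 0.
Proof.
case: k => [|k]; first by rewrite dm_const cent_part0.
by rewrite /gauge /= nth_rcons size_gauge_seq ltnn eqxx dm_ad_inv cent_part_ad_inv.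
Qed.

Lemma normal_coef_comm J k : a * normal_coef J k = normal_coef J k * a.
Proof. exact: cent_part_comm. Qed.

(** Only the term with [N_0 = 1] has a part in the centralizer. *)
Lemma cent_part_normal_coef J k : cent_part ((normal_coef J * ser J gauge) k) = normal_coef J k.
Proof.
rewrite fpsM cent_part_sum (bigD1 ord_max) //= subnn cent_partMl ?normal_coef_comm //.
rewrite /ser gauge0 cent_part1 // mulr1.
rewrite big1 ?addr0 // => i ik; rewrite cent_partMl ?normal_coef_comm //.
have : (0 < k - i)%N.
  by rewrite subn_gt0 ltn_neqAle -ltnS ltn_ord andbT.
by case: (k - i)%N => // m _; rewrite cent_part_gaugeS mulr0.
Qed.

Lemma normal_coef0 J : cent_part (jetmx J 0) = 0 -> normal_coef J 0%N = 0.
Proof. by move=> J0; rewrite /normal_coef gauge0 mul1r. Qed.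

(** The connections [a lambda + U] and the normal form, divided by [lambda]. *)
Definition lax_conn (U : M) : fps M := fps_cst a + fps_z _ * fps_cst U.
Definition normal_conn J : fps M := fps_cst a + fps_z _ * normal_coef J.

(** The gauge equation [N_x = N (a lambda + u) - (a lambda + c) N], divided by [lambda].  Off the
   centralizer it is the recursion of [gauge_next]; on the centralizer it defines [normal_coef]. *)
Lemma gauge_eq J :
  fps_z _ * dser J gauge = ser J gauge * lax_conn (jetmx J 0) - normal_conn J * ser J gauge.
Proof.
apply: fpsE => k; rewrite fps_zMl fpsB mulrDr mulrDl !fpsD mulrA -(fps_z_comm (ser J _)) -!mulrA.
rewrite fps_cstMr fps_cstMl !fps_zMl; case: k => [|k].
  by rewrite /ser gauge0 mul1r mulr1 !addr0 subrr.
rewrite fps_cstMr; set X := dmev J (gauge k) * jetmx J 0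
  - (dmev J (dm (gauge k)) + (normal_coef J * ser J gauge) k).
have /eqP : a * ser J gauge k.+1 - ser J gauge k.+1 * a = X.
  rewrite /ser gaugeS ad_adK // /X !(cent_partB, cent_partD) cent_part_dm_gauge.
  rewrite cent_part_normal_coef add0r.
  by rewrite /normal_coef subrr subr0.
rewrite subr_eq /X /dser => /eqP ->.
move: (_ * _) (_ * _) ((normal_coef J * _) k) (dmev J _) => A B Cv D.
by apply/matrixP => i j; rewrite !mxE; ring.
Qed.
End NormalForm.

(** * Diagonalization of the series of the Q_k *)

(** [N Q - b N] obeys the same linear equation as [N], since [b] commutes with the normal form. *)
Lemma gauge_defect (B : nzRingType) (z N n q q' b c1 c2 : B) :
  (forall f, z * f = f * z) -> z * n = N * c1 - c2 * N -> z * q' = q * c1 - c1 * q ->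
  b * c2 = c2 * b ->
  z * (n * q + N * q' - b * n) = (N * q - b * N) * c1 - c2 * (N * q - b * N).
Proof.
move=> zC zn zq bc.
have -> : z * (n * q + N * q' - b * n) = z * n * q + N * (z * q') - b * (z * n).
  by rewrite mulrBr mulrDr !mulrA (zC N) (zC b).
rewrite zn zq !mulrBl !mulrBr !mulrA bc !opprB.
by rewrite [X in X + _ = _]addrC [X in X + _ = _]addrA subrK addrACA [RHS]addrACA [X in _ + X = _]addrC.
Qed.

Section Diagonalization.
Variables (R : realType) (n : nat).
Local Notation C := R[i].
Local Notation M := 'M[C]_n.+1.
Local Notation dm P := (map_mx (@total_deriv R n) P).
Variables (a b : M) (Q : nat -> 'M[dpoly R n]_n.+1).
Hypotheses (ha : is_diag_mx a) (hb : forall X, a * X = X * a -> b * X = X * b) (hQ : is_Q_family a b Q).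
Local Notation perp := (fun X => cent_part a X = 0).
Local Notation jet0 := (@jet0 R n).

Lemma Q0E J : dmev J (Q 0) = b.
Proof. exact: Q_zero hQ J. Qed.

Lemma Q_jet0 k : dmev jet0 (Q k.+1) = 0.
Proof. exact: Q_no_constant_term hQ k. Qed.

Lemma dmx_eval_pjet P (W : 'M[{poly C}]_n.+1) (x : R) :
  dmx_eval P (fun y : R => map_mx (fun p => p.[y%:C]) W) x = dmev (pjet W x%:C) P.
Proof. by rewrite /dmx_eval jet_pval. Qed.

Lemma mderive_pjet P (W : 'M[{poly C}]_n.+1) (x : R) :
  mderive (dmx_eval P (fun y : R => map_mx (fun p => p.[y%:C]) W)) x =
  dmev (pjet W x%:C) (dm P).
Proof.
apply/matrixP => i j; rewrite !mxE -horner_pval -deriv_pval -[deriv _]/(derivn 1 _).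
rewrite -cderiven_horner; congr (cderiven 1 _ x).
by apply/funext => y; rewrite dmx_eval_pjet mxE horner_pval.
Qed.

(** The recursion, known for functions, holds for every jet because a polynomial function
   realizes the jet to the order that matters. *)
Lemma Q_rec_jet J k : jets_in perp J ->
  dmev J (dm (Q k)) + lie (jetmx J 0) (dmev J (Q k)) = lie (dmev J (Q k.+1)) a.
Proof.
move=> Jp.
pose K := maxn (mxord (dm (Q k))) (maxn (mxord (Q k)) (mxord (Q k.+1))).
have [W [Wp W0 _]] := interpolation K (real_subspace_perp a) Jp.
have := Q_recursion hQ (@msmooth1_horner R n.+1 n.+1 W) _ k 0.
rewrite mderive_pjet !dmx_eval_pjet rmorph0 => rec.
rewrite -(dmev_ord (J := pjet W 0)); last first.
  by move=> i j m mK; apply: W0; apply: leq_trans mK _; rewrite leq_maxl.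
rewrite -(dmev_ord (J := pjet W 0) (P := Q k)); last first.
  by move=> i j m mK; apply: W0; apply: leq_trans mK _; rewrite /K maxnCA leq_maxl.
rewrite -(dmev_ord (J := pjet W 0) (P := Q k.+1)); last first.
  by move=> i j m mK; apply: W0; apply: leq_trans mK _; rewrite /K maxnA leq_maxr.
have WJ x : map_mx (fun p => p.[x]) W = jetmx (pjet W x) 0.
  by apply/matrixP => i j; rewrite !mxE.
have -> : jetmx J 0 = jetmx (pjet W 0) 0 by apply/matrixP => i j; rewrite !mxE W0.
rewrite -WJ; apply: rec => x; apply/sl_perpP => //.
by rewrite WJ; exact: Wp.
Qed.

(** The generating series of the recursion: [Q_x = [Q, a lambda + u]]. *)
Lemma Q_eq J : jets_in perp J ->
  fps_z _ * dser J Q = ser J Q * lax_conn a (jetmx J 0) - lax_conn a (jetmx J 0) * ser J Q.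
Proof.
move=> Jp; apply: fpsE => k; rewrite fps_zMl fpsB mulrDr mulrDl !fpsD.
rewrite mulrA -(fps_z_comm (ser J Q)) -!mulrA.
rewrite fps_cstMr fps_cstMl !fps_zMl; case: k => [|k].
  by rewrite /ser Q0E hb // !addr0 subrr.
rewrite fps_cstMr fps_cstMl; have := Q_rec_jet k Jp; rewrite !lieE => /eqP.
rewrite eq_sym -subr_eq eq_sym /dser /ser => /eqP ->.
set x1 := _ * a; set x2 := a * _; set x3 := jetmx J 0 * _; set x4 := _ * jetmx J 0.
move: x1 x2 x3 x4 => x1 x2 x3 x4.
by apply/matrixP => i j; rewrite !mxE; ring.
Qed.

(** The failure [N Q - b N] of the gauge transformation to carry the series of the [Q_k] to [b]. *)
Definition defect := ssub (smul (gauge a) Q) (smul (@sconst R n b) (gauge a)).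

Lemma normal_conn_b J : fps_cst b * normal_conn a J = normal_conn a J * fps_cst b.
Proof.
rewrite /normal_conn mulrDr mulrDl; congr (_ + _).
  apply: fpsE => k; rewrite fps_cstMl fps_cstMr.
  by case: k => [|k]; rewrite /= ?hb // mulr0 mul0r.
rewrite mulrA -fps_z_comm -!mulrA; congr (_ * _).
by apply: fpsE => k; rewrite fps_cstMl fps_cstMr hb // normal_coef_comm.
Qed.

Lemma defect_eq J : jets_in perp J ->
  fps_z _ * dser J defect = ser J defect * lax_conn a (jetmx J 0) - normal_conn a J * ser J defect.
Proof.
move=> Jp; rewrite !(dser_sub, dser_mul, ser_sub, ser_mul) dser_const ser_const mul0r add0r.
exact: (gauge_defect (@fps_z_comm _) (gauge_eq ha J) (Q_eq Jp) (normal_conn_b J)).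
Qed.

Lemma defect_jet0 k : ser jet0 defect k = 0.
Proof.
have g0 m : dmev jet0 (gauge a m.+1) = 0.
  elim/ltn_ind: m => m IH; rewrite gaugeS // dm_jet0 add0r.
  have J0 : jetmx jet0 0 = 0 by apply/matrixP => i j; rewrite !mxE.
  rewrite J0 mulr0 fpsM big1 ?subrr ?ad_inv0 // => i _.
  by rewrite /normal_coef J0 mulr0 cent_part0 mul0r.
rewrite ser_sub ser_mul ser_mul ser_const fpsB fps_cstMl /ser.
rewrite fpsM big_ord_recl /= gauge0 mul1r subn0 big1 ?addr0 => [|i _].
  by case: k => [|k]; rewrite ?gauge0 ?Q0E ?mulr1 ?subrr // g0 Q_jet0 mulr0 subrr.
by rewrite g0 mul0r.
Qed.

(** The first nonzero coefficient would commute with [a], by the equation one order lower; its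
   total derivative has no part in the centralizer, by the equation of its own order; so the
   vanishing principle applies to its centralizer part. *)
Lemma defect_eq0 k J : jets_in perp J -> ser J defect k = 0.
Proof.
elim/ltn_ind: k J => k IH J Jp.
have IH' m J' : (m < k)%N -> jets_in perp J' -> dser J' defect m = 0.
  move=> mk J'p; apply: (vanishing_derivative (real_subspace_perp a) (@real_linear_id R n)) J'p.
  by move=> J2 J2p; exact: IH.
have coef J' m : jets_in perp J' -> (fps_z _ * dser J' defect) m =
    ser J' defect m * a - a * ser J' defect m
    + (if m is m'.+1 then ser J' defect m' * jetmx J' 0 - (normal_coef a J' * ser J' defect) m'
       else 0).
  move=> J'p; rewrite defect_eq // /lax_conn /normal_conn fpsB mulrDr mulrDl !fpsD.
  rewrite mulrA -(fps_z_comm (ser J' defect)) -!mulrA fps_cstMr fps_cstMl !fps_zMl.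
  case: m => [|m]; first by rewrite !addr0.
  rewrite fps_cstMr.
  set x1 := _ * a; set x2 := a * _; set x3 := _ * jetmx _ _; set x4 := (normal_coef a J' * _) m.
  by move: x1 x2 x3 x4 => x1 x2 x3 x4; mx_linear.
have low J' m : jets_in perp J' -> (m <= k)%N ->
    (normal_coef a J' * ser J' defect) m = 0.
  move=> J'p mk; rewrite fpsM big1 // => i _.
  case: (posnP i) => [->|i0]; first by rewrite normal_coef0 ?mul0r //; exact: J'p 0%N.
  by rewrite IH ?mulr0 //; apply: leq_trans mk; rewrite ltn_subrL i0 (leq_trans i0) // -ltnS.
have cent J' : jets_in perp J' -> a * ser J' defect k = ser J' defect k * a.
  move=> J'p; have := coef J' k J'p; rewrite fps_zMl.
  case: k IH IH' coef low => [|m] IH IH' _ low.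
    by rewrite addr0 => /esym/eqP; rewrite subr_eq0 eq_sym => /eqP.
  rewrite IH' // (IH m) // mul0r low // ?subrr ?addr0 //.
  by move=> /esym/eqP; rewrite subr_eq0 eq_sym => /eqP.
have pcd J' : jets_in perp J' -> cent_part a (dser J' defect k) = 0.
  move=> J'p; have := coef J' k.+1 J'p; rewrite fps_zMl => ->.
  rewrite low // subr0 cent_partD cent_part_adN // add0r cent_partMl ?cent //.
  by rewrite (J'p 0%N) mulr0.
rewrite -[LHS](@cent_part_id _ _ a ha) ?cent //.
apply: (vanishing_principle (real_subspace_perp a) (@real_linear_cent_part R n a)) Jp => //.
by rewrite -/(ser jet0 defect k) defect_jet0 cent_part0.
Qed.

(** The series of the [Q_k] is conjugate to the constant [b] by the formal gauge transformation. *)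
Lemma gauge_diag J : jets_in perp J ->
  ser J (gauge a) * ser J Q = fps_cst b * ser J (gauge a).
Proof.
move=> Jp; apply: fpsE => k; apply/eqP; rewrite -subr_eq0 -fpsB.
by rewrite -(ser_const J) -!ser_mul -ser_sub defect_eq0.
Qed.

End Diagonalization.

(** * Smooth functions on a planar domain *)

Section PlanarSmoothness.
Variable R : realType.
Implicit Types (f g : R -> R -> R) (b : bool) (D : set (R * R)).

(** The partial derivative in the first variable for [true], in the second for [false]. *)
Definition pd b f := pderive [:: b] f.
Definition is_pd b f (x t d : R) : Prop :=
  if b then is_derive x (1 : R) (fun y => f y t) d else is_derive t (1 : R) (fun s => f x s) d.

Lemma is_pd_val b f x t d : is_pd b f x t d -> pd b f x t = d.
Proof. by case: b => /= H; rewrite /pd /= derive1E (@derive_val _ _ _ _ _ _ _ H). Qed.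

Lemma is_pdD b f g x t df dg : is_pd b f x t df -> is_pd b g x t dg ->
  is_pd b (fun x t => f x t + g x t) x t (df + dg).
Proof. by case: b => /= Hf Hg; exact: (is_deriveD Hf Hg). Qed.
Lemma is_pdM b f g x t df dg : is_pd b f x t df -> is_pd b g x t dg ->
  is_pd b (fun x t => f x t * g x t) x t (df * g x t + f x t * dg).
Proof.
by case: b => /= Hf Hg; have := is_deriveM Hf Hg; rewrite addrC (mulrC df).
Qed.
Lemma is_pd_cst b c x t : is_pd b (fun _ _ => c) x t 0.
Proof. by case: b => /=; exact: is_derive_cst. Qed.
Lemma is_pdV b f x t df : f x t != 0 -> is_pd b f x t df ->
  is_pd b (fun x t => (f x t)^-1) x t (- (df * ((f x t)^-1 * (f x t)^-1))).
Proof.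
move=> f0; rewrite -invfM -expr2 (mulrC df) -mulNr.
case: b => /= H.
  by apply: DeriveDef; [exact: derivableV | rewrite deriveV // derive_val].
by apply: DeriveDef; [exact: (derivableV (f := f x)) | rewrite (deriveV (f := f x)) // derive_val].
Qed.

(** Partial derivatives at a point of an open set only see the values on that set. *)
Lemma nbhs_slice b D x t : open D -> D (x, t) ->
  if b then \forall y \near x, D (y, t) else \forall s \near t, D (x, s).
Proof.
move=> oD Dxt; have [[A B] /= [nA nB] AB] : nbhs (x, t) D by exact: open_nbhs_nbhs.
case: b.
  by apply: filterS nA => y Ay; apply: (AB (y, t)); split => //=; exact: nbhs_singleton nB.
by apply: filterS nB => y Ay; apply: (AB (x, y)); split => //=; exact: nbhs_singleton nA.
Qed.

Lemma is_pd_congr D b f g x t d : open D -> (forall x t, D (x, t) -> f x t = g x t) ->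
  D (x, t) -> is_pd b f x t d -> is_pd b g x t d.
Proof.
move=> oD fg Dxt; have := nbhs_slice b oD Dxt; case: b => /= Dn;
  by apply: near_eq_is_derive; apply: filterS Dn => y; exact: fg.
Qed.

Lemma pd_congr D b f g x t : open D -> (forall x t, D (x, t) -> f x t = g x t) ->
  D (x, t) -> pd b f x t = pd b g x t.
Proof.
move=> oD fg Dxt; have := nbhs_slice b oD Dxt; case: b => /= Dn; rewrite /pd /= !derive1E;
  by apply: near_eq_derive; apply: filterS Dn => y; exact: fg.
Qed.

Lemma pderive_congr D f g : open D -> (forall x t, D (x, t) -> f x t = g x t) ->
  forall w x t, D (x, t) -> pderive w f x t = pderive w g x t.
Proof.
move=> oD fg; elim=> [//|b w IH] x t Dxt.
by have := pd_congr b oD IH Dxt; case: b.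
Qed.

Lemma pderive_rcons w b f : pderive (rcons w b) f = pderive w (pd b f).
Proof. by elim: w => [//|b' w IH] /=; rewrite IH. Qed.

Definition regular D f := forall x t, D (x, t) ->
  (forall b, is_pd b f x t (pd b f x t)) /\
  {for (x, t), continuous (fun p : R * R => f p.1 p.2)}.

(** Smoothness to finite order, on which the closure properties of [smooth2] are proved by
   induction: [smooth_uptoS] peels off the innermost derivative. *)
Definition smooth_upto k D f := forall w, (size w <= k)%N -> regular D (pderive w f).

Lemma smooth2P D f : smooth2 D f <-> forall k, smooth_upto k D f.
Proof.
split=> [H k w _ x t Dxt|H w x t Dxt].
  have [d1 d2 c] := H w x t Dxt; split=> // -[].
    exact: (DeriveDef d1 (esym (derive1E _ _))).
  exact: (DeriveDef d2 (esym (derive1E _ _))).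
by have [d c] := H _ w (leqnn _) x t Dxt; split=> //; [case: (d true) | case: (d false)].
Qed.

Lemma smooth_uptoS k D f : smooth_upto k.+1 D f <->
  regular D f /\ forall b, smooth_upto k D (pd b f).
Proof.
split=> [H|[H0 H] w].
  split=> [|b w wk]; first exact: (H [::]).
  by rewrite -pderive_rcons; apply: H; rewrite size_rcons.
by case/lastP: w => // w b; rewrite size_rcons pderive_rcons; exact: H.
Qed.

Lemma smooth_upto_regular k D f : smooth_upto k D f -> regular D f.
Proof. by move=> /(_ [::]); exact. Qed.

Lemma smooth_uptoW k D f : smooth_upto k.+1 D f -> smooth_upto k D f.
Proof. by move=> H w wk; apply: H; exact: leqW. Qed.

Section OpenDomain.
Variable D : set (R * R).
Hypothesis oD : open D.

Lemma regular_congr f g : (forall x t, D (x, t) -> f x t = g x t) ->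
  regular D f -> regular D g.
Proof.
move=> fg H x t Dxt; have [d c] := H x t Dxt; split.
  by move=> b; rewrite -(pd_congr b oD fg Dxt); exact: (is_pd_congr oD fg Dxt).
move: c; rewrite /prop_for /continuous_at /= (fg x t Dxt); apply: cvg_trans; apply: near_eq_cvg.
have : nbhs (x, t) D by exact: open_nbhs_nbhs.
by apply: filterS => -[y s] Dys /=; exact: fg.
Qed.

Lemma smooth_upto_congr k f g : (forall x t, D (x, t) -> f x t = g x t) ->
  smooth_upto k D f -> smooth_upto k D g.
Proof.
by move=> fg H w wk; apply: regular_congr (H w wk); exact: pderive_congr.
Qed.

Lemma regular_is_pd b f x t : regular D f -> D (x, t) -> is_pd b f x t (pd b f x t).
Proof. by move=> H Dxt; case: (H x t Dxt). Qed.

Lemma smooth_upto_cst k c : smooth_upto k D (fun _ _ => c).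
Proof.
move=> w _; have [c' ->] : exists c', pderive w (fun _ _ : R => c) = (fun _ _ => c').
  elim: w => [|b w [c' IH]]; first by exists c.
  exists 0; apply/funext => x; apply/funext => t.
  by case: b => /=; rewrite IH derive1_cst.
move=> x t _; split; last exact: cst_continuous.
by move=> b; have H := is_pd_cst b c' x t; rewrite (is_pd_val H).
Qed.

Lemma smooth_uptoD k f g : smooth_upto k D f -> smooth_upto k D g ->
  smooth_upto k D (fun x t => f x t + g x t).
Proof.
have base f' g' : regular D f' -> regular D g' -> regular D (fun x t => f' x t + g' x t).
  move=> Hf Hg x t Dxt; split=> [b|].
    have H := is_pdD (regular_is_pd b Hf Dxt) (regular_is_pd b Hg Dxt).
    by rewrite (is_pd_val H).
  by have [_ cf] := Hf x t Dxt; have [_ cg] := Hg x t Dxt; exact: cvgD cf cg.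
elim: k f g => [|k IH] f g Hf Hg.
  by move=> [|//] _; exact: base (Hf [::] _) (Hg [::] _).
have [rf sf] := (smooth_uptoS _ _ _).1 Hf; have [rg sg] := (smooth_uptoS _ _ _).1 Hg.
apply/smooth_uptoS; split=> [|b]; first exact: base.
apply: smooth_upto_congr (IH _ _ (sf b) (sg b)) => x t Dxt.
by rewrite (is_pd_val (is_pdD (regular_is_pd b rf Dxt) (regular_is_pd b rg Dxt))).
Qed.

Lemma smooth_uptoM k f g : smooth_upto k D f -> smooth_upto k D g ->
  smooth_upto k D (fun x t => f x t * g x t).
Proof.
have base f' g' : regular D f' -> regular D g' -> regular D (fun x t => f' x t * g' x t).
  move=> Hf Hg x t Dxt; split=> [b|].
    have H := is_pdM (regular_is_pd b Hf Dxt) (regular_is_pd b Hg Dxt).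
    by rewrite (is_pd_val H).
  by have [_ cf] := Hf x t Dxt; have [_ cg] := Hg x t Dxt; exact: cvgM cf cg.
elim: k f g => [|k IH] f g Hf Hg.
  by move=> [|//] _; exact: base (Hf [::] _) (Hg [::] _).
have [rf sf] := (smooth_uptoS _ _ _).1 Hf; have [rg sg] := (smooth_uptoS _ _ _).1 Hg.
apply/smooth_uptoS; split=> [|b]; first exact: base.
have S := smooth_uptoD (IH _ _ (sf b) (smooth_uptoW Hg)) (IH _ _ (smooth_uptoW Hf) (sg b)).
apply: smooth_upto_congr S => x t Dxt.
by rewrite (is_pd_val (is_pdM (regular_is_pd b rf Dxt) (regular_is_pd b rg Dxt))).
Qed.

Lemma smooth_uptoV k f : (forall x t, D (x, t) -> f x t != 0) ->
  smooth_upto k D f -> smooth_upto k D (fun x t => (f x t)^-1).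
Proof.
move=> f0.
have base : regular D f -> regular D (fun x t => (f x t)^-1).
  move=> Hf x t Dxt; split=> [b|].
    have H := is_pdV (f0 x t Dxt) (regular_is_pd b Hf Dxt).
    by rewrite (is_pd_val H).
  by have [_ cf] := Hf x t Dxt; apply: cvgV => //; exact: f0.
elim: k => [|k IH] Hf; first by move=> [|//] _; exact: base (Hf [::] _).
have [rf sf] := (smooth_uptoS _ _ _).1 Hf.
apply/smooth_uptoS; split=> [|b]; first exact: base.
have Sk := IH (smooth_uptoW Hf).
have S := smooth_uptoM (@smooth_upto_cst k (-1)) (smooth_uptoM (sf b) (smooth_uptoM Sk Sk)).
apply: smooth_upto_congr S => x t Dxt.
by rewrite (is_pd_val (is_pdV (f0 x t Dxt) (regular_is_pd b rf Dxt))) mulN1r.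
Qed.

End OpenDomain.

Lemma ball_constant (g : R -> R) (x r y : R) : `|x - y| < r ->
  (forall z, `|x - z| < r -> is_derive z (1 : R) g 0) -> g y = g x.
Proof.
move=> xy Hd.
have seg u v : u <= v -> (forall z, z \in `[u, v]%R -> `|x - z| < r) -> g u = g v.
  move=> uv Hz.
  have [||c _] := @MVT_segment _ g (fun=> 0) u v uv.
  - by move=> z zuv; apply/Hd/Hz;
      move: zuv; rewrite !in_itv /= => /andP[uz zv]; apply/andP; split; exact: ltW.
  - by apply: derivable_within_continuous => z /Hz/Hd [].
  - by rewrite mul0r => /eqP; rewrite subr_eq0 => /eqP.
have [xley|yltx] := leP x y.
  apply/esym/seg => // z; rewrite in_itv /= => /andP[xz zy]; apply: le_lt_trans xy.
  by rewrite !(distrC x) !ger0_norm ?subr_ge0 // lerD2r.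
apply/seg; first exact: ltW.
move=> z; rewrite in_itv /= => /andP[yz zx]; apply: le_lt_trans xy.
by rewrite !ger0_norm ?subr_ge0 ?(ltW yltx) // lerD2l lerN2.
Qed.

(** The function is locally constant by the mean value theorem on horizontal and vertical
   segments, so its level sets are open and closed in [D]. *)
Lemma connected_constant D f : open D -> connected D -> regular D f ->
  (forall b x t, D (x, t) -> pd b f x t = 0) ->
  forall x t x' t', D (x, t) -> D (x', t') -> f x t = f x' t'.
Proof.
move=> oD cD rf df0 x t x' t' Dxt Dxt'.
have loc y s : D (y, s) -> \forall p \near (y, s), D p /\ f p.1 p.2 = f y s.
  move=> Dys; have [[A B] /= [nA nB] AB] : nbhs (y, s) D by exact: open_nbhs_nbhs.
  have [r1 /= r10 r1A] := nA; have [r2 /= r20 r2B] := nB.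
  have sub y' s' : `|y - y'| < r1 -> `|s - s'| < r2 -> D (y', s').
    by move=> ? ?; apply: (AB (y', s')); split; [exact: r1A | exact: r2B].
  exists (ball y r1, ball s r2); first by split; exact: nbhsx_ballx.
  move=> [y' s'] [/= yy' ss']; split; first exact: sub.
  transitivity (f y s').
    apply: (@ball_constant (fun z => f z s') y r1 y') => // z yz.
    by have := regular_is_pd true rf (sub _ _ yz ss'); rewrite df0 //; exact: sub.
  apply: (@ball_constant (f y) s r2 s') => // z sz.
  have Dyz : D (y, z) by apply: sub => //; rewrite subrr normr0.
  by have := regular_is_pd false rf Dyz; rewrite df0.
pose B := [set p | D p /\ f p.1 p.2 = f x t].
pose B' := [set p | D p /\ f p.1 p.2 != f x t].
have oB : open B.
  rewrite openE => -[y s] [/= Dys fys]; rewrite /interior.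
  by apply: filterS (loc y s Dys) => p [Dp fp]; split=> //; rewrite fp.
have oB' : open B'.
  rewrite openE => -[y s] [/= Dys fys]; rewrite /interior.
  by apply: filterS (loc y s Dys) => p [Dp fp]; split=> //; rewrite fp.
have BD : B = D.
  apply: cD.
  - by exists (x, t).
  - by exists B => //; apply/seteqP; split=> p // [].
  - exists (~` B'); first exact: open_closedC.
    apply/seteqP; split=> p; first by move=> [Dp fp]; split=> // -[_]; rewrite fp eqxx.
    move=> [Dp nB']; split=> //; apply/eqP/negPn/negP => fp; exact: nB'.
by have : B (x', t') by [rewrite BD]; case.
Qed.

End PlanarSmoothness.

(** * Complex-valued smooth functions *)

Section ComplexCalculus.
Variable R : realType.
Local Notation C := R[i].
Implicit Types (f g : R -> R -> C) (b : bool).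

(** Complex counterparts of [smooth2], [pd] and [is_pd], on real and imaginary parts. *)
Definition csmooth (D : set (R * R)) f :=
  smooth2 D (fun x t => Re (f x t)) /\ smooth2 D (fun x t => Im (f x t)).
Definition cpd b f x t : C :=
  pd b (fun x t => Re (f x t)) x t +i* pd b (fun x t => Im (f x t)) x t.
Definition is_cpd b f x t (d : C) :=
  is_pd b (fun x t => Re (f x t)) x t (Re d) /\ is_pd b (fun x t => Im (f x t)) x t (Im d).

Lemma is_cpd_val b f x t d : is_cpd b f x t d -> cpd b f x t = d.
Proof. by case=> /is_pd_val e1 /is_pd_val e2; rewrite /cpd e1 e2; case: d {e1 e2}. Qed.

Variable D : set (R * R).
Hypothesis oD : open D.

Lemma smooth2_regular (f : R -> R -> R) : smooth2 D f -> regular D f.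
Proof. by move=> /smooth2P /(_ 0%N); exact: smooth_upto_regular. Qed.
Lemma smooth2_congr (f g : R -> R -> R) : (forall x t, D (x, t) -> f x t = g x t) ->
  smooth2 D f -> smooth2 D g.
Proof.
by move=> fg /smooth2P H; apply/smooth2P => k; exact: (smooth_upto_congr oD fg (H k)).
Qed.
Lemma smooth2_cst (c : R) : smooth2 D (fun _ _ => c).
Proof. by apply/smooth2P => k; exact: smooth_upto_cst. Qed.
Lemma smooth2D (f g : R -> R -> R) : smooth2 D f -> smooth2 D g ->
  smooth2 D (fun x t => f x t + g x t).
Proof. by move=> /smooth2P Hf /smooth2P Hg; apply/smooth2P => k; exact: smooth_uptoD. Qed.
Lemma smooth2M (f g : R -> R -> R) : smooth2 D f -> smooth2 D g ->
  smooth2 D (fun x t => f x t * g x t).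
Proof. by move=> /smooth2P Hf /smooth2P Hg; apply/smooth2P => k; exact: smooth_uptoM. Qed.
Lemma smooth2N (f : R -> R -> R) : smooth2 D f -> smooth2 D (fun x t => - f x t).
Proof.
move=> Hf; apply: smooth2_congr (smooth2M (smooth2_cst (-1)) Hf) => x t _.
by rewrite mulN1r.
Qed.
Lemma smooth2V (f : R -> R -> R) : (forall x t, D (x, t) -> f x t != 0) ->
  smooth2 D f -> smooth2 D (fun x t => (f x t)^-1).
Proof. by move=> f0 /smooth2P Hf; apply/smooth2P => k; exact: smooth_uptoV. Qed.
Lemma smooth2_pd b (f : R -> R -> R) : smooth2 D f -> smooth2 D (pd b f).
Proof.
by move=> /smooth2P Hf; apply/smooth2P => k; have /smooth_uptoS[_] := Hf k.+1; exact.
Qed.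

Lemma csmooth_is_cpd b f x t : csmooth D f -> D (x, t) -> is_cpd b f x t (cpd b f x t).
Proof.
move=> [/smooth2_regular H1 /smooth2_regular H2] Dxt; split; exact: (regular_is_pd b _ Dxt).
Qed.

Lemma is_cpdD b f g x t df dg : is_cpd b f x t df -> is_cpd b g x t dg ->
  is_cpd b (fun x t => f x t + g x t) x t (df + dg).
Proof.
case=> f1 f2 [g1 g2]; split.
- rewrite cReD (_ : (fun x t => _) = fun x t => Re (f x t) + Re (g x t)).
    exact: is_pdD.
  by apply/funext => y; apply/funext => s; exact: cReD.
- rewrite cImD (_ : (fun x t => _) = fun x t => Im (f x t) + Im (g x t)).
    exact: is_pdD.
  by apply/funext => y; apply/funext => s; exact: cImD.
Qed.

Lemma is_pdN b (f : R -> R -> R) x t df : is_pd b f x t df -> is_pd b (fun x t => - f x t) x t (- df).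
Proof. by case: b => /= H; exact: (is_deriveN H). Qed.

Lemma is_cpdM b f g x t df dg : is_cpd b f x t df -> is_cpd b g x t dg ->
  is_cpd b (fun x t => f x t * g x t) x t (df * g x t + f x t * dg).
Proof.
case=> f1 f2 [g1 g2]; split.
- rewrite (_ : (fun x t => _) =
      fun x t => Re (f x t) * Re (g x t) + - (Im (f x t) * Im (g x t))).
    have := is_pdD (is_pdM f1 g1) (is_pdN (is_pdM f2 g2)).
    by rewrite cReD !cReM opprD addrACA.
  by apply/funext => y; apply/funext => s; exact: cReM.
- rewrite (_ : (fun x t => _) =
      fun x t => Re (f x t) * Im (g x t) + Im (f x t) * Re (g x t)).
    have := is_pdD (is_pdM f1 g2) (is_pdM f2 g1).
    by rewrite cImD !cImM addrACA [X in X + _]addrC [X in _ + X]addrC addrACA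
       [X in X + _]addrC [X in _ + X]addrC.
  by apply/funext => y; apply/funext => s; exact: cImM.
Qed.

Lemma is_cpd_cst b c x t : is_cpd b (fun _ _ => c) x t 0.
Proof. by split; exact: is_pd_cst. Qed.

Lemma csmooth_congr f g : (forall x t, D (x, t) -> f x t = g x t) -> csmooth D f -> csmooth D g.
Proof.
by move=> fg [H1 H2]; split; [move: H1 | move: H2]; apply: smooth2_congr => x t /fg ->.
Qed.
Lemma csmooth_cst c : csmooth D (fun _ _ => c).
Proof. by split; exact: smooth2_cst. Qed.
Lemma csmoothD f g : csmooth D f -> csmooth D g -> csmooth D (fun x t => f x t + g x t).
Proof.
case=> f1 f2 [g1 g2]; split.
  by apply: smooth2_congr (smooth2D f1 g1) => x t _; rewrite cReD.
by apply: smooth2_congr (smooth2D f2 g2) => x t _; rewrite cImD.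
Qed.
Lemma csmoothM f g : csmooth D f -> csmooth D g -> csmooth D (fun x t => f x t * g x t).
Proof.
case=> f1 f2 [g1 g2]; split.
  apply: smooth2_congr (smooth2D (smooth2M f1 g1) (smooth2N (smooth2M f2 g2))) => x t _.
  by rewrite cReM.
by apply: smooth2_congr (smooth2D (smooth2M f1 g2) (smooth2M f2 g1)) => x t _; rewrite cImM.
Qed.
Lemma csmoothN f : csmooth D f -> csmooth D (fun x t => - f x t).
Proof.
move=> Hf; apply: csmooth_congr (csmoothM (csmooth_cst (-1)) Hf) => x t _.
by rewrite mulN1r.
Qed.
Lemma csmooth_Re f : csmooth D f -> csmooth D (fun x t => (Re (f x t))%:C).
Proof. by case=> f1 f2; split=> //; exact: smooth2_cst. Qed.
Lemma csmooth_Im f : csmooth D f -> csmooth D (fun x t => (Im (f x t))%:C).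
Proof. by case=> f1 f2; split=> //; exact: smooth2_cst. Qed.
Lemma csmooth_pd b f : csmooth D f -> csmooth D (cpd b f).
Proof. by case=> f1 f2; split; exact: smooth2_pd. Qed.

Lemma csmoothV f : (forall x t, D (x, t) -> f x t != 0) -> csmooth D f ->
  csmooth D (fun x t => (f x t)^-1).
Proof.
move=> f0 [f1 f2].
have n0 x t : D (x, t) -> Re (f x t) * Re (f x t) + Im (f x t) * Im (f x t) != 0.
  move=> /f0; apply: contra; rewrite paddr_eq0 -?expr2 ?sqr_ge0 // !sqrf_eq0.
  by case: (f x t) => u v /= /andP[/eqP -> /eqP ->].
have Hn := smooth2V n0 (smooth2D (smooth2M f1 f1) (smooth2M f2 f2)).
split.
  apply: smooth2_congr (smooth2M f1 Hn) => x t _.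
  by case: (f x t) => u v /=; rewrite -!expr2.
apply: smooth2_congr (smooth2M (smooth2N f2) Hn) => x t _.
by case: (f x t) => u v /=; rewrite -!expr2 mulNr.
Qed.

Lemma csmooth_sum (I : Type) (r : seq I) (P : pred I) (F : I -> R -> R -> C) :
  (forall i, csmooth D (F i)) -> csmooth D (fun x t => \sum_(i <- r | P i) F i x t).
Proof.
move=> HF; elim: r => [|i r IH].
  by apply: csmooth_congr (csmooth_cst 0) => x t _; rewrite big_nil.
case Pi: (P i).
  by apply: csmooth_congr (csmoothD (HF i) IH) => x t _; rewrite big_cons Pi.
by apply: csmooth_congr IH => x t _; rewrite big_cons Pi.
Qed.
Lemma csmooth_prod (I : Type) (r : seq I) (P : pred I) (F : I -> R -> R -> C) :
  (forall i, csmooth D (F i)) -> csmooth D (fun x t => \prod_(i <- r | P i) F i x t).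
Proof.
move=> HF; elim: r => [|i r IH].
  by apply: csmooth_congr (csmooth_cst 1) => x t _; rewrite big_nil.
case Pi: (P i).
  by apply: csmooth_congr (csmoothM (HF i) IH) => x t _; rewrite big_cons Pi.
by apply: csmooth_congr IH => x t _; rewrite big_cons Pi.
Qed.

Lemma cpd_congr b f g x t : (forall x t, D (x, t) -> f x t = g x t) -> D (x, t) ->
  cpd b f x t = cpd b g x t.
Proof.
by move=> fg Dxt; congr (_ +i* _); apply: (pd_congr b oD) Dxt => y s /fg ->.
Qed.

Lemma is_cpd_sum b x t (I : Type) (r : seq I) (F : I -> R -> R -> C) d :
  (forall i, is_cpd b (F i) x t (d i)) ->
  is_cpd b (fun x t => \sum_(i <- r) F i x t) x t (\sum_(i <- r) d i).
Proof.
move=> HF; elim: r => [|i r IH].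
  rewrite big_nil (_ : (fun x t => _) = (fun _ _ => 0)); first exact: is_cpd_cst.
  by apply/funext => y; apply/funext => s; rewrite big_nil.
rewrite big_cons (_ : (fun x t => _) = (fun x t => F i x t + \sum_(i <- r) F i x t)).
  exact: is_cpdD.
by apply/funext => y; apply/funext => s; rewrite big_cons.
Qed.

Lemma is_cpd_prod b x t (I : eqType) (r : seq I) (F : I -> R -> R -> C) d : uniq r ->
  (forall i, is_cpd b (F i) x t (d i)) ->
  is_cpd b (fun x t => \prod_(i <- r) F i x t) x t
    (\sum_(i <- r) d i * \prod_(k <- r | k != i) F k x t).
Proof.
move=> + HF; elim: r => [_|i r IH /= /andP[ir ur]].
  rewrite big_nil (_ : (fun x t => _) = (fun _ _ => 1)); first exact: is_cpd_cst.
  by apply/funext => y; apply/funext => s; rewrite big_nil.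
rewrite (_ : (fun x t => _) = (fun x t => F i x t * \prod_(i <- r) F i x t)); last first.
  by apply/funext => y; apply/funext => s; rewrite big_cons.
have := is_cpdM (HF i) (IH ur); congr (is_cpd _ _ _ _ _).
rewrite big_cons big_cons eqxx /=; congr (_ * _ + _).
  rewrite [RHS]big_seq_cond [LHS]big_seq; apply: eq_bigl => k.
  by case kr: (k \in r) => //=; apply/esym; apply: contraNneq ir => <-.
rewrite mulr_sumr [LHS]big_seq [RHS]big_seq; apply: eq_bigr => k kr.
rewrite big_cons ifT; first by rewrite mulrCA.
by apply: contraNneq ir => ->.
Qed.

Lemma cconnected_constant f : connected D -> csmooth D f ->
  (forall b x t, D (x, t) -> cpd b f x t = 0) ->
  forall x t x' t', D (x, t) -> D (x', t') -> f x t = f x' t'.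
Proof.
move=> cD [/smooth2_regular f1 /smooth2_regular f2] df x t x' t' Dxt Dxt'.
apply: complex_eqP.
  apply: (connected_constant oD cD f1) Dxt Dxt' => b y s /(df b) /eqP.
  by rewrite eq_complex => /andP[/eqP].
apply: (connected_constant oD cD f2) Dxt Dxt' => b y s /(df b) /eqP.
by rewrite eq_complex => /andP[_ /eqP].
Qed.

End ComplexCalculus.

(** * Matrix-valued smooth functions *)

Section MatrixCalculus.
Variables (R : realType) (n : nat).
Local Notation C := R[i].
Local Notation M := 'M[C]_n.+1.
Implicit Types (F G : R -> R -> M) (b : bool).
Variable D : set (R * R).
Hypothesis oD : open D.

Definition mpd b F x t : M := \matrix_(i, j) cpd b (fun x t => F x t i j) x t.
Definition is_mpd b F x t (d : M) := forall i j, is_cpd b (fun x t => F x t i j) x t (d i j).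

Lemma is_mpd_val b F x t d : is_mpd b F x t d -> mpd b F x t = d.
Proof. by move=> H; apply/matrixP => i j; rewrite mxE; exact: is_cpd_val. Qed.
Lemma msmooth_is_mpd b F x t : msmooth2 D F -> D (x, t) -> is_mpd b F x t (mpd b F x t).
Proof. by move=> HF Dxt i j; rewrite mxE; exact: csmooth_is_cpd (HF i j) Dxt. Qed.

Lemma msmooth_congr F G : (forall x t, D (x, t) -> F x t = G x t) ->
  msmooth2 D F -> msmooth2 D G.
Proof. by move=> FG H i j; apply: (csmooth_congr oD) (H i j) => x t /FG ->. Qed.
Lemma mpd_congr b F G x t : (forall x t, D (x, t) -> F x t = G x t) -> D (x, t) ->
  mpd b F x t = mpd b G x t.
Proof.
move=> FG Dxt; apply/matrixP => i j; rewrite !mxE.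
by apply: (cpd_congr oD) Dxt => y s /FG ->.
Qed.

Lemma msmooth_cst X : msmooth2 D (fun _ _ => X : M).
Proof. by move=> i j; exact: csmooth_cst. Qed.
Lemma msmoothD F G : msmooth2 D F -> msmooth2 D G -> msmooth2 D (fun x t => F x t + G x t).
Proof.
by move=> HF HG i j; apply: (csmooth_congr oD) (csmoothD oD (HF i j) (HG i j)) => x t _; rewrite mxE.
Qed.
Lemma msmoothM F G : msmooth2 D F -> msmooth2 D G -> msmooth2 D (fun x t => F x t * G x t).
Proof.
move=> HF HG i j; apply: (csmooth_congr oD) (csmooth_sum oD (index_enum 'I_n.+1) predT
  (fun k => csmoothM oD (HF i k) (HG k j))) => x t _.
by rewrite mxE.
Qed.
Lemma msmoothN F : msmooth2 D F -> msmooth2 D (fun x t => - F x t).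
Proof.
by move=> HF i j; apply: (csmooth_congr oD) (csmoothN oD (HF i j)) => x t _; rewrite mxE.
Qed.
Lemma msmooth_pd b F : msmooth2 D F -> msmooth2 D (mpd b F).
Proof.
by move=> HF i j; apply: (csmooth_congr oD) (csmooth_pd b (HF i j)) => x t _; rewrite mxE.
Qed.
Lemma msmooth_sum (I : Type) (r : seq I) (F : I -> R -> R -> M) :
  (forall i, msmooth2 D (F i)) -> msmooth2 D (fun x t => \sum_(i <- r) F i x t).
Proof.
move=> HF; elim: r => [|i r IH].
  by apply: msmooth_congr (msmooth_cst 0) => x t _; rewrite big_nil.
by apply: msmooth_congr (msmoothD (HF i) IH) => x t _; rewrite big_cons.
Qed.

Lemma is_mpd_cst b X x t : is_mpd b (fun _ _ => X) x t 0.
Proof. by move=> i j; rewrite mxE; exact: is_cpd_cst. Qed.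
Lemma is_mpdD b F G x t dF dG : is_mpd b F x t dF -> is_mpd b G x t dG ->
  is_mpd b (fun x t => F x t + G x t) x t (dF + dG).
Proof.
move=> HF HG i j; rewrite mxE (_ : (fun x t => _) = (fun x t => F x t i j + G x t i j)).
  exact: is_cpdD.
by apply/funext => y; apply/funext => s; rewrite mxE.
Qed.
Lemma is_mpdM b F G x t dF dG : is_mpd b F x t dF -> is_mpd b G x t dG ->
  is_mpd b (fun x t => F x t * G x t) x t (dF * G x t + F x t * dG).
Proof.
move=> HF HG i j; rewrite (_ : (fun x t => _) = (fun x t => \sum_k F x t i k * G x t k j)).
  have := is_cpd_sum (index_enum 'I_n.+1) (fun k => is_cpdM (HF i k) (HG k j)).
  by rewrite big_split !mxE.
by apply/funext => y; apply/funext => s; rewrite mxE.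
Qed.
Lemma is_mpdN b F x t dF : is_mpd b F x t dF -> is_mpd b (fun x t => - F x t) x t (- dF).
Proof.
move=> HF; have := is_mpdM (is_mpd_cst b (-1) x t) HF; rewrite mul0r add0r mulN1r.
congr (is_mpd _ _ _ _ _).
by apply/funext => y; apply/funext => s; rewrite mulN1r.
Qed.
Lemma is_mpd_sum b (I : Type) (r : seq I) (F : I -> R -> R -> M) d x t :
  (forall i, is_mpd b (F i) x t (d i)) ->
  is_mpd b (fun x t => \sum_(i <- r) F i x t) x t (\sum_(i <- r) d i).
Proof.
move=> HF; elim: r => [|i r IH].
  rewrite big_nil (_ : (fun x t => _) = (fun _ _ => 0)); first exact: is_mpd_cst.
  by apply/funext => y; apply/funext => s; rewrite big_nil.
rewrite big_cons (_ : (fun x t => _) = (fun x t => F i x t + \sum_(i <- r) F i x t)).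
  exact: is_mpdD.
by apply/funext => y; apply/funext => s; rewrite big_cons.
Qed.

Lemma csmooth_det m (F : R -> R -> 'M[C]_m) :
  (forall i j, csmooth D (fun x t => F x t i j)) -> csmooth D (fun x t => \det (F x t)).
Proof.
move=> HF; apply: (csmooth_sum oD) => s; apply: (csmoothM oD); first exact: csmooth_cst.
by apply: (csmooth_prod oD) => i; exact: HF.
Qed.

(** Cramer's formula. *)
Lemma msmooth_invmx F : (forall x t, D (x, t) -> F x t \in unitmx) -> msmooth2 D F ->
  msmooth2 D (fun x t => invmx (F x t)).
Proof.
move=> uF HF i j.
have Hd : csmooth D (fun x t => (\det (F x t))^-1).
  apply: (csmoothV oD); last exact: csmooth_det.
  by move=> x t /uF; rewrite unitmxE unitfE.
have Hm : csmooth D (fun x t => \det (row' j (col' i (F x t)))).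
  apply: csmooth_det => k l.
  by apply: (csmooth_congr oD) (HF (lift j k) (lift i l)) => x t _; rewrite !mxE.
have Ha : csmooth D (fun x t => \adj (F x t) i j).
  have := csmoothM oD (csmooth_cst D ((-1) ^+ (j + i))) Hm.
  by apply: (csmooth_congr oD) => x t _; rewrite mxE.
apply: (csmooth_congr oD) (csmoothM oD Hd Ha) => x t Dxt.
by rewrite /invmx uF // [RHS]mxE.
Qed.

(** By differentiating [F^-1 F = 1]. *)
Lemma is_mpd_invmx b F x t : (forall x t, D (x, t) -> F x t \in unitmx) -> msmooth2 D F ->
  D (x, t) ->
  is_mpd b (fun x t => invmx (F x t)) x t (- (invmx (F x t) * mpd b F x t * invmx (F x t))).
Proof.
move=> uF HF Dxt; have HI := msmooth_is_mpd b (msmooth_invmx uF HF) Dxt.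
suff <- : mpd b (fun x t => invmx (F x t)) x t =
   - (invmx (F x t) * mpd b F x t * invmx (F x t)) by [].
have := is_mpd_val (is_mpdM HI (msmooth_is_mpd b HF Dxt)).
have -> : mpd b (fun x t => invmx (F x t) * F x t) x t = 0.
  rewrite (@mpd_congr _ _ (fun _ _ => 1)) //.
    exact: is_mpd_val (is_mpd_cst _ _ _ _).
  by move=> y s Dys; exact: mulVmx (uF _ _ Dys).
move/esym/eqP; rewrite addr_eq0 => /eqP e.
by rewrite -mulNr -e -mulrA [F x t * _](mulmxV (uF _ _ Dxt)) mulr1.
Qed.

Definition set_row m (A B : 'M[C]_m) i : 'M[C]_m :=
  \matrix_(k, l) if k == i then B i l else A k l.

Lemma det_set_row m (A B : 'M[C]_m) i : \det (set_row A B i) = \sum_j B i j * cofactor A i j.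
Proof.
rewrite (expand_det_row _ i); apply: eq_bigr => j _; rewrite mxE eqxx; congr (_ * (_ * \det _)).
by apply/matrixP => k l; rewrite !mxE eq_sym (negbTE (neq_lift i k)).
Qed.

(** Jacobi's formula: differentiating the Leibniz expansion row by row replaces one row of [F] by
   its derivative, and expansion along that row gives the cofactors of [F]. *)
Lemma is_cpd_det b F x t dF : is_mpd b F x t dF ->
  is_cpd b (fun x t => \det (F x t)) x t (\tr (dF * \adj (F x t))).
Proof.
move=> HF.
have -> : \tr (dF * \adj (F x t)) = \sum_(s : 'S_n.+1) (0 * \prod_i F x t i (s i) +
    (-1) ^+ s * \sum_i dF i (s i) * \prod_(k | k != i) F x t k (s k)).
  transitivity (\sum_i \det (set_row (F x t) dF i)).
    rewrite /mxtrace; apply: eq_bigr => i _; rewrite det_set_row mxE.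
    by apply: eq_bigr => j _; rewrite mxE.
  rewrite /determinant exchange_big; apply: eq_bigr => s _.
  rewrite mul0r add0r mulr_sumr; apply: eq_bigr => i _; congr (_ * _).
  rewrite (bigD1 i) //= mxE eqxx; congr (_ * _).
  by apply: eq_bigr => k ki; rewrite mxE (negbTE ki).
apply: is_cpd_sum => s; apply: is_cpdM; first exact: is_cpd_cst.
by apply: is_cpd_prod; [exact: index_enum_uniq | move=> i; exact: HF].
Qed.

(** By Jacobi's formula the derivative of [det F] is [tr B] times [det F]. *)
Lemma det_constant F (B : bool -> R -> R -> M) : connected D -> D (0, 0) -> msmooth2 D F ->
  F 0 0 = 1 -> (forall b x t, D (x, t) -> mpd b F x t = F x t * B b x t) ->
  (forall b x t, D (x, t) -> \tr (B b x t) = 0) ->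
  forall x t, D (x, t) -> \det (F x t) = 1.
Proof.
move=> cD D0 HF F0 dF trB x t Dxt.
rewrite (@cconnected_constant _ D oD (fun x t => \det (F x t)) cD _ _ x t 0 0) //.
- by rewrite F0 det1.
- exact: csmooth_det.
- move=> b y s Dys; rewrite (is_cpd_val (is_cpd_det (msmooth_is_mpd b HF Dys))) dF //.
  have -> : F y s * B b y s * \adj (F y s) = F y s *m (B b y s *m \adj (F y s)).
    by rewrite mulmxA.
  by rewrite mxtrace_mulC -mulmxA mul_adj_mx mul_mx_scalar linearZ /= trB ?mulr0.
Qed.

Lemma mconnected_constant F : connected D -> msmooth2 D F ->
  (forall b x t, D (x, t) -> mpd b F x t = 0) ->
  forall x t x' t', D (x, t) -> D (x', t') -> F x t = F x' t'.
Proof.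
move=> cD HF dF x t x' t' Dxt Dxt'; apply/matrixP => i j.
apply: (cconnected_constant oD cD (HF i j)) Dxt Dxt' => b y s Dys.
by have /matrixP/(_ i j) := dF b y s Dys; rewrite !mxE.
Qed.

Section RealLinear.
Variable L : M -> M.
Hypothesis LL : real_linear L.

(** Coordinates and basis of the complex matrices as a real vector space, in which real-linear maps
   are visibly compatible with differentiation. *)
Definition rcoord (X : M) (k : bool * 'I_n.+1 * 'I_n.+1) : R :=
  if k.1.1 then Re (X k.1.2 k.2) else Im (X k.1.2 k.2).
Definition rbase (k : bool * 'I_n.+1 * 'I_n.+1) : M :=
  (if k.1.1 then 1 else 'i) *: delta_mx k.1.2 k.2.

Lemma rcoordE X : X = \sum_k (rcoord X k)%:C *: rbase k.
Proof.
rewrite {1}[X]matrix_sum_delta pair_big /=.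
transitivity (\sum_(p : 'I_n.+1 * 'I_n.+1) \sum_(c : bool)
    (rcoord X (c, p.1, p.2))%:C *: rbase (c, p.1, p.2)).
  apply: eq_bigr => -[k l] _; rewrite big_bool /= /rcoord /rbase /= scale1r scalerA -scalerDl.
  by congr (_ *: _); rewrite {1}[X k l]complexE (mulrC 'i).
rewrite exchange_big pair_big /=.
rewrite (reindex (fun k : bool * 'I_n.+1 * 'I_n.+1 => (k.1.1, (k.1.2, k.2)))) /=.
  by apply: eq_bigr => -[[c k] l].
by exists (fun p => (p.1, p.2.1, p.2.2)) => [[[c k] l]|[c [k l]]].
Qed.

Lemma real_linearE X : L X = \sum_k (rcoord X k)%:C *: L (rbase k).
Proof. by rewrite {1}[X]rcoordE real_linear_sum. Qed.

Lemma msmooth_real_linear F : msmooth2 D F -> msmooth2 D (fun x t => L (F x t)).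
Proof.
move=> HF; apply: msmooth_congr (msmooth_sum _ (F := fun k x t =>
  ((rcoord (F x t) k)%:C)%:M * L (rbase k)) _).
  by move=> x t _; rewrite [RHS]real_linearE; apply: eq_bigr => k _; exact: mul_scalar_mx.
move=> k; apply: msmoothM; last exact: msmooth_cst.
move=> i j; have H : csmooth D (fun x t => (rcoord (F x t) k)%:C).
  rewrite /rcoord; case: k.1.1; [exact: csmooth_Re | exact: csmooth_Im].
apply: (csmooth_congr oD) (csmoothM oD H (csmooth_cst D ((i == j)%:R))) => x t _.
by rewrite mxE mulr_natr.
Qed.

Lemma is_mpd_real_linear b F x t dF : is_mpd b F x t dF ->
  is_mpd b (fun x t => L (F x t)) x t (L dF).
Proof.
move=> HF; rewrite [L dF]real_linearE.
rewrite (_ : (fun x t => _) = (fun x t => \sum_k (rcoord (F x t) k)%:C *: L (rbase k))); last first.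
  by apply/funext => y; apply/funext => s; exact: real_linearE.
apply: is_mpd_sum => k i j; rewrite mxE.
rewrite (_ : (fun x t => _) = (fun x t => (rcoord (F x t) k)%:C * L (rbase k) i j)); last first.
  by apply/funext => y; apply/funext => s; rewrite mxE.
have H : is_cpd b (fun x t => (rcoord (F x t) k)%:C) x t (rcoord dF k)%:C.
  have [H1 H2] := HF k.1.2 k.2.
  by rewrite /rcoord; case: k.1.1; split=> //=; exact: is_pd_cst.
by have := is_cpdM H (is_cpd_cst b (L (rbase k) i j) x t); rewrite mulr0 addr0.
Qed.

End RealLinear.

Section Jets.
Variable u : R -> R -> M.
Hypothesis su : msmooth2 D u.

(** The jet of [u] in the first variable, at a point of the domain. *)
Definition ujet x t : 'I_n.+1 -> 'I_n.+1 -> nat -> C := jet (fun y => u y t) x.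

Lemma ujet_mpd k x t : jetmx (ujet x t) k = iter k (mpd true) u x t.
Proof.
suff H : forall i j, ujet x t i j k = iter k (mpd true) u x t i j.
  by apply/matrixP => i j; rewrite mxE.
move=> i j; rewrite /ujet /jet /cderiven.
have e c : (if c then derive1n k (fun y => Re (u y t i j)) x
     else derive1n k (fun y => Im (u y t i j)) x) =
  (if c then Re (iter k (mpd true) u x t i j) else Im (iter k (mpd true) u x t i j)).
  elim: k x => [|k IH] x //=; rewrite !mxE /=.
  by case: c IH => IH; rewrite /pd /=; congr (derive1 _ x); apply/funext => y; exact: (IH y).
by apply: complex_eqP; [exact: (e true) | exact: (e false)].
Qed.

Lemma msmooth_iter k : msmooth2 D (iter k (mpd true) u).
Proof. by elim: k => //= k; exact: msmooth_pd. Qed.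

Lemma csmooth_ujet i j k : csmooth D (fun x t => ujet x t i j k).
Proof.
apply: (csmooth_congr oD) (msmooth_iter k i j) => x t _.
by rewrite -ujet_mpd mxE.
Qed.

Lemma is_cpd_deval (p : dpoly R n) x t : D (x, t) ->
  is_cpd true (fun x t => deval (ujet x t) p) x t (deval (ujet x t) (total_deriv p)).
Proof.
move=> Dxt; elim: p => /= [c|i j k|p IHp q IHq|p IHp q IHq].
- exact: is_cpd_cst.
- have -> : (fun x t => ujet x t i j k) = (fun x t => iter k (mpd true) u x t i j).
    by apply/funext => y; apply/funext => s; rewrite -ujet_mpd mxE.
  have := msmooth_is_mpd true (msmooth_iter k) Dxt i j.
  by have /matrixP/(_ i j) := ujet_mpd k.+1 x t; rewrite mxE => ->.
- exact: is_cpdD.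
- exact: is_cpdM.
Qed.

Lemma csmooth_deval (p : dpoly R n) : csmooth D (fun x t => deval (ujet x t) p).
Proof.
elim: p => /= [c|i j k|p IHp q IHq|p IHp q IHq].
- exact: csmooth_cst.
- exact: csmooth_ujet.
- exact: csmoothD.
- exact: csmoothM.
Qed.

Lemma msmooth_dmev (P : 'M[dpoly R n]_n.+1) : msmooth2 D (fun x t => dmev (ujet x t) P).
Proof.
by move=> i j; apply: (csmooth_congr oD) (csmooth_deval (P i j)) => x t _; rewrite mxE.
Qed.
Lemma is_mpd_dmev (P : 'M[dpoly R n]_n.+1) x t : D (x, t) ->
  is_mpd true (fun x t => dmev (ujet x t) P) x t (dmev (ujet x t) (map_mx (@total_deriv R n) P)).
Proof.
move=> Dxt i j; rewrite !mxE.
rewrite (_ : (fun x t => _) = (fun x t => deval (ujet x t) (P i j))).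
  exact: is_cpd_deval.
by apply/funext => y; apply/funext => s; rewrite mxE.
Qed.

(** Differentiation preserves real-linear relations. *)
Lemma ujet_in (L : M -> M) : real_linear L -> (forall x t, D (x, t) -> L (u x t) = 0) ->
  forall x t, D (x, t) -> jets_in (fun X => L X = 0) (ujet x t).
Proof.
move=> LL Lu x t Dxt k; rewrite ujet_mpd; elim: k x t Dxt => [|k IH] x t Dxt; first exact: Lu.
have := is_mpd_val (is_mpd_real_linear LL (msmooth_is_mpd true (msmooth_iter k) Dxt)).
rewrite /= => <-; rewrite (@mpd_congr true _ (fun _ _ => 0)) //.
exact: is_mpd_val (is_mpd_cst _ _ _ _).
Qed.

End Jets.

End MatrixCalculus.

(** * Darboux transformation of the Q_k and of the flow *)

(** If [N], [N'] and [d] are gauge transformations, so is [H = N' d N^-1]. *)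
Lemma gauge_quotient (B : nzRingType) (z H H1 N Ninv N' n n' d d' c1 c2 nu nu' : B) :
  (forall f, z * f = f * z) -> N * Ninv = 1 -> H * N = N' * d ->
  H1 * N + H * n = n' * d + N' * d' ->
  z * n = N * c1 - nu * N -> z * n' = N' * c2 - nu' * N' -> z * d' = d * c1 - c2 * d ->
  z * H1 = H * nu - nu' * H.
Proof.
move=> zC NV HN dHN zn zn' zd'.
have e : z * H1 * N = (H * nu - nu' * H) * N.
  have -> : z * H1 * N = z * n' * d + N' * (z * d') - H * (z * n).
    apply/eqP; rewrite eq_sym subr_eq; apply/eqP; have /(congr1 (fun f => z * f)) := dHN.
    by rewrite !mulrDr !mulrA (zC H) (zC N') => ->.
  rewrite zn zn' zd' !mulrBl !mulrBr !mulrA -HN -!(mulrA nu') -HN.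
  rewrite opprB !addrA addrAC; set A := _ * c2 * d; set B' := _ * c1.
  by rewrite addrC !addrA addrAC addrK addrAC addrK.
by rewrite -[z * H1]mulr1 -NV mulrA e -mulrA NV mulr1.
Qed.

Section Darboux.
Variables (R : realType) (n : nat).
Local Notation C := R[i].
Local Notation M := 'M[C]_n.+1.
Local Notation dm P := (map_mx (@total_deriv R n) P).
Variables (a b : M) (Q : nat -> 'M[dpoly R n]_n.+1).
Hypotheses (ha : is_diag_mx a) (hb : forall X, a * X = X * a -> b * X = X * b)
  (hQ : is_Q_family a b Q).
Variables (W : set (R * R)) (u Delta : R -> R -> M).
Hypotheses (oW : open W) (su : msmooth2 W u) (sD : msmooth2 W Delta)
  (pu : forall x t, W (x, t) -> cent_part a (u x t) = 0).

Definition dressed x t := u x t + lie a (Delta x t).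
Local Notation u' := dressed.

Lemma msmooth_dressed : msmooth2 W u'.
Proof.
apply: (msmoothD oW su); apply: (msmoothD oW); last apply: (msmoothN oW);
  by apply: (msmoothM oW) => //; exact: msmooth_cst.
Qed.

Lemma cent_part_dressed x t : W (x, t) -> cent_part a (u' x t) = 0.
Proof. by move=> Wxt; rewrite cent_partD pu // add0r cent_part_ad. Qed.

Lemma perp_ujet v : msmooth2 W v -> (forall x t, W (x, t) -> cent_part a (v x t) = 0) ->
  forall x t, W (x, t) -> jets_in (fun X => cent_part a X = 0) (ujet v x t).
Proof. by move=> sv pv; exact: (ujet_in oW sv (@real_linear_cent_part R n a) pv). Qed.

Lemma jetmx_ujet (v : R -> R -> M) x t : jetmx (ujet v x t) 0 = v x t.
Proof. by rewrite ujet_mpd. Qed.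

(** Coefficientwise smoothness and x-derivative of a series that depends on the point. *)
Definition ssmooth (F : R -> R -> fps M) := forall k, msmooth2 W (fun x t => F x t k).
Definition is_sder (F : R -> R -> fps M) x t (d : fps M) :=
  forall k, is_mpd true (fun x t => F x t k) x t (d k).

Lemma ssmoothM F G : ssmooth F -> ssmooth G -> ssmooth (fun x t => F x t * G x t).
Proof.
move=> HF HG k; apply: (msmooth_congr oW) (msmooth_sum oW (index_enum 'I_k.+1)
  (fun i : 'I_k.+1 => msmoothM oW (HF i) (HG (k - i)%N))) => x t _.
by rewrite fpsM.
Qed.
Lemma is_sderM F G x t d e : is_sder F x t d -> is_sder G x t e ->
  is_sder (fun x t => F x t * G x t) x t (d * G x t + F x t * e).
Proof.
move=> HF HG k; rewrite fpsD !fpsM -big_split.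
rewrite (_ : (fun x t => _) = (fun x t => \sum_(i < k.+1) F x t i * G x t (k - i)%N)).
  by apply: is_mpd_sum => i; exact: is_mpdM (HF i) (HG (k - i)%N).
by apply/funext => y; apply/funext => s; rewrite fpsM.
Qed.
Lemma is_sder_uniq F x t d e : is_sder F x t d -> is_sder F x t e -> d = e.
Proof. by move=> HF HG; apply: fpsE => k; rewrite -(is_mpd_val (HF k)) (is_mpd_val (HG k)). Qed.

Lemma ssmooth_finv F : ssmooth F -> ssmooth (fun x t => finv (F x t)).
Proof.
move=> HF; elim/ltn_ind => -[|k] IH; first exact: msmooth_cst.
have := msmoothN oW (msmooth_sum oW (index_enum 'I_k.+1) (fun i : 'I_k.+1 =>
  msmoothM oW (HF i.+1) (IH (k - i)%N _))).
move=> H; apply: (msmooth_congr oW) (H _) => [x t _|i]; first by rewrite finvS.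
by rewrite ltnS leq_subr.
Qed.

Lemma ssmooth_ser v s : msmooth2 W v -> ssmooth (fun x t => ser (ujet v x t) s).
Proof. by move=> sv k; exact: (msmooth_dmev oW sv). Qed.
Lemma is_sder_ser v s x t : msmooth2 W v -> W (x, t) ->
  is_sder (fun x t => ser (ujet v x t) s) x t (dser (ujet v x t) s).
Proof. by move=> sv Wxt k; exact: (is_mpd_dmev oW sv). Qed.

(** The Darboux factor [lambda - Delta], divided by [lambda]. *)
Definition darboux x t : fps M := 1 - fps_z _ * fps_cst (Delta x t).

Lemma darboux_mull x t f k : (darboux x t * f) k =
  f k - (if k is k'.+1 then Delta x t * f k' else 0).
Proof.
rewrite /darboux mulrBl mul1r fpsB -mulrA fps_zMl.
by case: k => // k; rewrite fps_cstMl.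
Qed.
Lemma darboux_mulr x t f k : (f * darboux x t) k =
  f k - (if k is k'.+1 then f k' * Delta x t else 0).
Proof.
rewrite /darboux mulrBr mulr1 fpsB mulrA -fps_z_comm -mulrA fps_zMl.
by case: k => // k; rewrite fps_cstMr.
Qed.

Lemma darbouxE x t k : darboux x t k = (k == 0%N)%:R - (k == 1%N)%:R * Delta x t.
Proof.
rewrite /darboux fpsB fps1 fps_zMl; case: k => [|[|k]] /=;
by rewrite ?mul0r ?mul1r.
Qed.
Lemma ssmooth_darboux : ssmooth darboux.
Proof.
move=> k; apply: (msmooth_congr oW) (msmoothD oW (msmooth_cst W ((k == 0%N)%:R))
  (msmoothN oW (msmoothM oW (msmooth_cst W ((k == 1%N)%:R)) sD))) => x t _.
by rewrite darbouxE.
Qed.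

Hypothesis Delta_x : forall x t, W (x, t) ->
  mpd true Delta x t = - (lie (u x t) (Delta x t) + lie a (Delta x t) * Delta x t).

Lemma is_sder_darboux x t : W (x, t) ->
  is_sder darboux x t (- (fps_z _ * fps_cst (mpd true Delta x t))).
Proof.
move=> Wxt k; rewrite fpsN.
have -> : (fps_z _ * fps_cst (mpd true Delta x t)) k = (k == 1%N)%:R * mpd true Delta x t.
  by rewrite fps_zMl; case: k => [|[|k]]; rewrite ?mul0r ?mul1r.
have H := is_mpdD (is_mpd_cst true ((k == 0%N)%:R : M) x t)
  (is_mpdN (is_mpdM (is_mpd_cst true ((k == 1%N)%:R : M) x t)
    (msmooth_is_mpd true sD Wxt))).
rewrite mul0r !add0r in H; move: H; congr (is_mpd _ _ _ _ _).
by apply/funext => y; apply/funext => s; rewrite darbouxE.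
Qed.

(** The Darboux factor transforms [a lambda + u] into [a lambda + u'].  The coefficient of
   [lambda^0] is the definition of [u'], that of [lambda^-1] is the equation of [Delta]. *)
Lemma darboux_gauge x t : W (x, t) ->
  fps_z _ * - (fps_z _ * fps_cst (mpd true Delta x t)) =
  darboux x t * lax_conn a (u x t) - lax_conn a (u' x t) * darboux x t.
Proof.
move=> Wxt; apply: fpsE => k; rewrite fpsB darboux_mull darboux_mulr mulrN fpsN !fps_zMl.
have cE U m : lax_conn a U m = if m is m'.+1 then (if m' is 0 then U else 0) else a.
  by rewrite /lax_conn fpsD fps_zMl; case: m => [|[|m]]; rewrite /= ?addr0 ?add0r.
case: k => [|[|[|k]]]; rewrite ?fps_zMl !cE.
- by rewrite !subr0 subrr oppr0.
- rewrite /dressed lieE oppr0.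
  set x1 := a * _; set x2 := _ * a; move: x1 x2 (u x t) => x1 x2 x3.
  by mx_linear.
- rewrite /= Delta_x // /dressed !lieE !(mulrDl, mulNr).
  set x1 := u x t * _; set x2 := _ * u x t; set x3 := a * _ * _; set x4 := _ * a * _.
  by move: x1 x2 x3 x4 => x1 x2 x3 x4; mx_linear.
- by rewrite /= mulr0 mul0r !subr0 oppr0.
Qed.

(** The gauge transformations to normal form of [u] and [u'], and the transformation that
   they and the Darboux factor induce between the two normal forms. *)
Definition ngauge x t := ser (ujet u x t) (gauge a).
Definition ngauge' x t := ser (ujet u' x t) (gauge a).
Definition qgauge x t := ngauge' x t * darboux x t * finv (ngauge x t).

Lemma ser_gauge0 J : ser J (gauge a) 0%N = 1.
Proof. exact: gauge0. Qed.

Lemma qgauge_mul x t : qgauge x t * ngauge x t = ngauge' x t * darboux x t.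
Proof.
by rewrite /qgauge -mulrA fmulVr_unipotent ?mulr1 //; exact: ser_gauge0.
Qed.

Lemma ssmooth_qgauge : ssmooth qgauge.
Proof.
apply: ssmoothM.
  by apply: ssmoothM; [exact: (ssmooth_ser _ msmooth_dressed) | exact: ssmooth_darboux].
by apply: ssmooth_finv; exact: (ssmooth_ser _ su).
Qed.

Lemma qgauge_eq x t : W (x, t) ->
  fps_z _ * (fun k => mpd true (fun x t => qgauge x t k) x t : M) =
  qgauge x t * normal_conn a (ujet u x t) - normal_conn a (ujet u' x t) * qgauge x t.
Proof.
move=> Wxt; set H1 : fps M := fun k => _.
have dH : is_sder qgauge x t H1 by move=> k; exact: msmooth_is_mpd (ssmooth_qgauge k) Wxt.
have dN := is_sder_ser (gauge a) su Wxt.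
have dN' := is_sder_ser (gauge a) msmooth_dressed Wxt.
have HN : (fun x t => qgauge x t * ngauge x t) = (fun x t => ngauge' x t * darboux x t).
  by apply/funext => y; apply/funext => s; exact: qgauge_mul.
have e1 := is_sderM dH dN; rewrite HN in e1.
have {e1} := is_sder_uniq e1 (is_sderM dN' (is_sder_darboux Wxt)).
move=> dHN; have gN := gauge_eq ha (ujet u x t); have gN' := gauge_eq ha (ujet u' x t).
rewrite !jetmx_ujet in gN gN'.
apply: (gauge_quotient (@fps_z_comm _) (fmulrV_unipotent (ser_gauge0 _)) (qgauge_mul x t) dHN gN gN').
exact: darboux_gauge.
Qed.

Lemma qgauge0 x t : qgauge x t 0%N = 1.
Proof.
rewrite /qgauge !fpsM0 darbouxE mul0r subr0 mulr1.
by rewrite [ngauge' x t 0%N]ser_gauge0 mul1r.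
Qed.

(** Induction on the coefficient: the equation of [qgauge] expresses the bracket of the
   coefficient [k + 1] with [a] through earlier coefficients, their derivatives and the normal
   forms, which all lie in the centralizer of [a], while a bracket with [a] has no part there. *)
Lemma qgauge_cent k x t : W (x, t) -> a * qgauge x t k = qgauge x t k * a.
Proof.
elim/ltn_ind: k x t => -[|k] IH x t Wxt; first by rewrite qgauge0 mulr1 mul1r.
have low (J J' : 'I_n.+1 -> 'I_n.+1 -> nat -> C) :
    cent_part a ((qgauge x t * normal_coef a J) k - (normal_coef a J' * qgauge x t) k)
    = (qgauge x t * normal_coef a J) k - (normal_coef a J' * qgauge x t) k.
  apply: cent_part_id => //; rewrite !fpsM mulrBr mulrBl; congr (_ - _).
    rewrite mulr_sumr mulr_suml; apply: eq_bigr => i _.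
    by rewrite mulrA IH // -!mulrA (normal_coef_comm ha).
  rewrite mulr_sumr mulr_suml; apply: eq_bigr => i _.
  by rewrite mulrA (normal_coef_comm ha) -!mulrA IH // ltnS leq_subr.
have dcent : cent_part a (mpd true (fun x t => qgauge x t k) x t) =
    mpd true (fun x t => qgauge x t k) x t.
  rewrite -(is_mpd_val (is_mpd_real_linear (@real_linear_cent_part R n a)
    (msmooth_is_mpd true (ssmooth_qgauge k) Wxt))).
  by apply: (mpd_congr oW) Wxt => y s Wys; rewrite cent_part_id // IH.
have /(congr1 (fun f : fps M => f k.+1)) := qgauge_eq Wxt.
rewrite fps_zMl fpsB /normal_conn mulrDr mulrDl !fpsD.
rewrite fps_cstMr fps_cstMl mulrA -fps_z_comm -[fps_z _ * qgauge x t * _]mulrA.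
rewrite -[fps_z _ * _ * qgauge x t]mulrA !fps_zMl.
set X := mpd _ _ _ _ in dcent *; set h := qgauge x t k.+1; move=> e.
have {}e : h * a - a * h =
    X - ((qgauge x t * normal_coef a (ujet u x t)) k - (normal_coef a (ujet u' x t) * qgauge x t) k).
  rewrite e; set x1 := h * a; set x2 := a * h; set x3 := (qgauge x t * _) k;
    set x4 := (_ * qgauge x t) k.
  by move: x1 x2 x3 x4 => x1 x2 x3 x4; mx_linear.
apply/esym/eqP; rewrite -subr_eq0; apply/eqP.
by have := cent_part_adN ha h; rewrite e cent_partB dcent low.
Qed.

(** With [N Q = b N] and [N' Q' = b N'], the induced transformation of normal forms commutes with
   [b], so [Q' (1 - Delta / lambda) = (1 - Delta / lambda) Q]; this is its coefficient [k+1]. *)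
Lemma Q_darboux k x t : W (x, t) ->
  dmev (ujet u' x t) (Q k.+1) = dmev (ujet u x t) (Q k.+1)
    - Delta x t * dmev (ujet u x t) (Q k) + dmev (ujet u' x t) (Q k) * Delta x t.
Proof.
move=> Wxt.
have gd := gauge_diag ha hb hQ (perp_ujet su pu Wxt).
have gd' := gauge_diag ha hb hQ (perp_ujet msmooth_dressed cent_part_dressed Wxt).
set q := ser _ Q in gd; set q' := ser _ Q in gd'.
have bH : fps_cst b * qgauge x t = qgauge x t * fps_cst b.
  by apply: fpsE => m; rewrite fps_cstMl fps_cstMr hb // qgauge_cent.
have e : ngauge' x t * (q' * darboux x t) = ngauge' x t * (darboux x t * q).
  transitivity (fps_cst b * (ngauge' x t * darboux x t)).
    by rewrite mulrA [ngauge' x t * q']gd' -mulrA.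
  by rewrite -qgauge_mul mulrA bH -mulrA -[fps_cst b * ngauge x t]gd mulrA qgauge_mul -mulrA.
have {}e : q' * darboux x t = darboux x t * q.
  by apply: unipotent_mulI e; exact: ser_gauge0.
have := congr1 (fun f : fps M => f k.+1) e.
rewrite darboux_mull darboux_mulr /q /q' /ser => /eqP.
by rewrite subr_eq => /eqP.
Qed.

(** The coefficients of [(sum_k Q_k lambda^-k) (1 - Delta / lambda)^-1]. *)
Definition t_coef k x t : M := \sum_(m < k.+1) dmev (ujet u x t) (Q m) * Delta x t ^+ (k - m).

Lemma t_coefS k x t :
  t_coef k.+1 x t = t_coef k x t * Delta x t + dmev (ujet u x t) (Q k.+1).
Proof.
rewrite /t_coef big_ord_recr /= subnn mulr1; congr (_ + _).
rewrite mulr_suml; apply: eq_bigr => i _.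
by rewrite -mulrA -exprSr subSn // -ltnS.
Qed.

Lemma Q_t_coef k x t : W (x, t) ->
  dmev (ujet u' x t) (Q k.+1) = t_coef k.+1 x t - Delta x t * t_coef k x t.
Proof.
move=> Wxt; elim: k => [|k IH]; rewrite Q_darboux // t_coefS.
  rewrite /t_coef big_ord_recl big_ord0 /= mulr1 addr0 !(Q0E hQ).
  set x1 := _ * b; set x2 := b * _; move: x1 x2 (dmev _ _) => x1 x2 x3.
  by mx_linear.
have -> : Delta x t * t_coef k.+1 x t =
    Delta x t * t_coef k x t * Delta x t + Delta x t * dmev (ujet u x t) (Q k.+1).
  by rewrite t_coefS mulrDr mulrA.
rewrite IH mulrBl; set x1 := t_coef _ _ _ * _; set x2 := _ * _ * _.
set x3 := _ * dmev _ _; move: x1 x2 x3 (dmev _ _) => x1 x2 x3 x4.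
by mx_linear.
Qed.

(** By the recursion, the flow of any solution is [u_t = [Q_(j+1)(u), a]]. *)
Lemma flow_dressed j : flow_solution Q j W u ->
  (forall x t, W (x, t) ->
    mpd false Delta x t = Delta x t * t_coef j x t - t_coef j x t * Delta x t) ->
  flow_solution Q j W u'.
Proof.
move=> [_ fl] Dt; split=> [|x t Wxt]; first exact: msmooth_dressed.
have fl' v : msmooth2 W v -> (forall x t, W (x, t) -> cent_part a (v x t) = 0) ->
    mderive (fun y => Qval Q j v y t) x + lie (v x t) (Qval Q j v x t) =
    lie (dmev (ujet v x t) (Q j.+1)) a.
  move=> sv pv; rewrite -(Q_rec_jet ha hQ j (perp_ujet sv pv Wxt)) jetmx_ujet.
  congr (_ + _); exact: is_mpd_val (is_mpd_dmev oW sv _ Wxt).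
rewrite (fl' _ msmooth_dressed cent_part_dressed) Q_t_coef // t_coefS.
have ut : mpd false u x t = lie (dmev (ujet u x t) (Q j.+1)) a.
  by rewrite -(fl' _ su pu); exact: fl.
have Dd := msmooth_is_mpd false sD Wxt.
have ad := is_mpd_cst false a x t.
have -> : mderive (fun s => u' x s) t = mpd false u x t +
    (0 * Delta x t + a * mpd false Delta x t - (mpd false Delta x t * a + Delta x t * 0)).
  exact: is_mpd_val (is_mpdD (msmooth_is_mpd false su Wxt)
    (is_mpdD (is_mpdM ad Dd) (is_mpdN (is_mpdM Dd ad)))).
rewrite mul0r mulr0 add0r addr0 ut Dt // !lieE.
rewrite !(mulrBl, mulrBr, mulrDl, mulrDr) !mulrA.
set q := dmev _ _; set c := t_coef _ _ _; set d := Delta x t.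
move: (q * a) (a * q) (a * d * c) (a * c * d) (d * c * a) (c * d * a) => x1 x2 x3 x4 x5 x6.
by mx_linear.
Qed.

End Darboux.

(** * Involutions and the reality of the Q_k *)

Section TracelessExtension.
Variables (R : realType) (n : nat).
Local Notation C := R[i].
Local Notation M := 'M[C]_n.+1.
Variables (s : {rmorphism C -> C}) (phi : M -> M).
Hypotheses (sR : forall r : R, s r%:C = r%:C) (hphi : lie_involution s phi).

(** An involution of [sl] is extended to all matrices by killing the scalars, so that brackets are
   still preserved and no trace conditions have to be carried along. *)
Definition sl_part (X : M) : M := X - (\tr X / n.+1%:R) *: 1.
Definition gl_ext (X : M) : M := phi (sl_part X).

Lemma sl_part_sl X : in_sl (sl_part X).
Proof.
rewrite /in_sl /sl_part linearB linearZ /= mxtrace1.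
by rewrite divfK ?subrr // pnatr_eq0.
Qed.
Lemma sl_part_id X : in_sl X -> sl_part X = X.
Proof. by rewrite /in_sl /sl_part => ->; rewrite mul0r scale0r subr0. Qed.
Lemma sl_part_lin c X Y : sl_part (c *: X + Y) = c *: sl_part X + sl_part Y.
Proof.
rewrite /sl_part linearP /=; move: (\tr X) (\tr Y) (n.+1%:R : C) (1 : M) => x y N I.
by mx_linear.
Qed.
Lemma lie_sl (X Y : M) : in_sl (lie X Y).
Proof. by rewrite /in_sl /lie linearB /= mxtrace_mulC subrr. Qed.
Lemma lie_sl_part X Y : lie (sl_part X) (sl_part Y) = lie X Y.
Proof.
rewrite /sl_part !lieE !(mulrBl, mulrBr) -!(scalerAl, scalerAr) !mulr1 !mul1r.
by move: (X * Y) (Y * X) (1 : M) => x y z; mx_linear.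
Qed.

Lemma gl_ext_id X : in_sl X -> gl_ext X = phi X.
Proof. by move=> sX; rewrite /gl_ext sl_part_id. Qed.
Lemma gl_ext_sl X : in_sl (gl_ext X).
Proof. exact: lie_inv_sl hphi _ (sl_part_sl X). Qed.
Lemma gl_extP c X Y : gl_ext (c *: X + Y) = s c *: gl_ext X + gl_ext Y.
Proof.
by rewrite /gl_ext sl_part_lin (lie_inv_semilinear hphi) //; exact: sl_part_sl.
Qed.
Lemma gl_ext0 : gl_ext 0 = 0.
Proof.
have := gl_extP 1 0 0; rewrite rmorph1 !scale1r add0r => /eqP.
by rewrite -subr_eq subrr eq_sym => /eqP.
Qed.
Lemma gl_extZ c X : gl_ext (c *: X) = s c *: gl_ext X.
Proof. by rewrite -[c *: X]addr0 gl_extP gl_ext0 addr0. Qed.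
Lemma gl_extD X Y : gl_ext (X + Y) = gl_ext X + gl_ext Y.
Proof. by have := gl_extP 1 X Y; rewrite rmorph1 !scale1r. Qed.
Lemma gl_ext_sum (I : Type) (r : seq I) (F : I -> M) :
  gl_ext (\sum_(i <- r) F i) = \sum_(i <- r) gl_ext (F i).
Proof. exact: (big_morph gl_ext gl_extD gl_ext0). Qed.
Lemma gl_ext_lie X Y : gl_ext (lie X Y) = lie (gl_ext X) (gl_ext Y).
Proof.
rewrite (gl_ext_id (lie_sl X Y)) -lie_sl_part (lie_inv_bracket hphi) //; exact: sl_part_sl.
Qed.
Lemma gl_extK X : gl_ext (gl_ext X) = sl_part X.
Proof. by rewrite (gl_ext_id (gl_ext_sl X)) /gl_ext (lie_invK hphi) //; exact: sl_part_sl. Qed.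
Lemma real_linear_gl_ext : real_linear gl_ext.
Proof. by move=> r X Y; rewrite gl_extP sR. Qed.

Section QReality.
Variables (a b : M) (Q : nat -> 'M[dpoly R n]_n.+1).
Hypotheses (ha : is_diag_mx a) (hQ : is_Q_family a b Q).
Variable eps : C.
Hypotheses (eps2 : eps * eps = 1) (ea : gl_ext a = eps *: a) (eb : gl_ext b = eps *: b).

Definition compact_perp X := cent_part a X = 0 /\ gl_ext X = X.

Lemma real_subspace_compact_perp : real_subspace compact_perp.
Proof.
split=> [|r X Y [X0 pX] [Y0 pY]]; first by rewrite /compact_perp cent_part0 gl_ext0.
by split; rewrite ?cent_partD ?cent_partZ ?X0 ?Y0 ?scaler0 ?addr0 // gl_extP sR pX pY.
Qed.

(** The failure of the reality of [Q_k]. *)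
Let L k X := gl_ext X - eps ^+ k.+1 *: X.

Lemma real_linear_defect k : real_linear (L k).
Proof.
move=> r X Y; rewrite /L gl_extP sR; move: (gl_ext X) (gl_ext Y) (eps ^+ _) => x y e.
by mx_linear.
Qed.

Lemma defect_lie k U X : gl_ext U = U -> L k (lie U X) = lie U (L k X).
Proof.
move=> pU; rewrite /L gl_ext_lie pU !lieE !(mulrBl, mulrBr) -!(scalerAl, scalerAr).
move: (U * _) (_ * U) (U * X) (X * U) (eps ^+ _) => x1 x2 x3 x4 e.
by mx_linear.
Qed.

Lemma defect_lie_a k X : L k (lie X a) = eps *: lie (L k.+1 X) a.
Proof.
rewrite /L gl_ext_lie ea !lieE !(mulrBl, mulrBr) -!(scalerAl, scalerAr).
have -> : eps ^+ k.+1 = eps * eps ^+ k.+2.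
  by rewrite [eps ^+ k.+2]exprS mulrA eps2 mul1r.
set x1 := gl_ext X * a; set x2 := a * gl_ext X; set x3 := X * a; set x4 := a * X.
move: x1 x2 x3 x4 (eps ^+ _) => x1 x2 x3 x4 e.
by mx_linear.
Qed.

Lemma perp_of_compact J : jets_in compact_perp J -> jets_in (fun X => cent_part a X = 0) J.
Proof. by move=> H k; case: (H k). Qed.

(** Induction on [k] along the recursion, whose two sides are compatible with [phi].  The failure
   at [k + 1] commutes with [a] by the recursion at [k]; the recursion at [k + 1] shows that its total
   derivative has no part in the centralizer, and the vanishing principle finishes. *)
Lemma Q_reality k J : jets_in compact_perp J ->
  gl_ext (dmev J (Q k)) = eps ^+ k.+1 *: dmev J (Q k).
Proof.
suff H : forall J, jets_in compact_perp J -> L k (dmev J (Q k)) = 0.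
  by move=> /H /eqP; rewrite subr_eq0 => /eqP.
elim: k => [|k IH] {}J Jc.
  by rewrite /L (Q0E hQ) eb expr1 subrr.
have cent J' : jets_in compact_perp J' ->
    a * L k.+1 (dmev J' (Q k.+1)) = L k.+1 (dmev J' (Q k.+1)) * a.
  move=> J'c; have dL := vanishing_derivative real_subspace_compact_perp
    (real_linear_defect k) IH J'c.
  have /(congr1 (L k)) := Q_rec_jet ha hQ k (perp_of_compact J'c).
  have -> X Y : L k (X + Y) = L k X + L k Y.
    by have := real_linear_defect k 1 X Y; rewrite rmorph1 !scale1r.
  rewrite dL add0r defect_lie; last by case: (J'c 0%N).
  rewrite IH // defect_lie_a => /(congr1 (fun X => eps *: X)).
  rewrite scalerA eps2 scale1r !lieE mulr0 mul0r subrr scaler0 => /esym/eqP.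
  by rewrite subr_eq0 eq_sym => /eqP.
rewrite -(cent_part_id ha (cent J Jc)).
pose L' X := cent_part a (L k.+1 X).
have LL' : real_linear L'.
  by move=> r X Y; rewrite /L' real_linear_defect cent_partD cent_partZ.
apply: (vanishing_principle real_subspace_compact_perp LL') Jc; last first.
  by rewrite (Q_jet0 hQ) (real_linear0 LL').
move=> J' J'c; have /(congr1 L') := Q_rec_jet ha hQ k.+1 (perp_of_compact J'c).
have -> X Y : L' (X + Y) = L' X + L' Y.
  by have := LL' 1 X Y; rewrite rmorph1 !scale1r.
have [pU fU] := J'c 0%N.
have -> : L' (lie (jetmx J' 0) (dmev J' (Q k.+1))) = 0.
  rewrite /L' defect_lie // lieE cent_partB (cent_partMr ha _ (cent J' J'c)).
  rewrite (cent_partMl ha _ (cent J' J'c)).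
  by rewrite pU mul0r mulr0 subrr.
have -> : L' (lie (dmev J' (Q k.+2)) a) = 0.
  by rewrite /L' defect_lie_a lieE cent_partZ cent_part_adN // scaler0.
by rewrite addr0.
Qed.

(** The values of the extended involution are traceless. *)
Lemma tr_Q_jet k J : jets_in compact_perp J -> \tr (dmev J (Q k)) = 0.
Proof.
move=> Jc; have := gl_ext_sl (dmev J (Q k)); rewrite /in_sl Q_reality // linearZ /=.
move=> /eqP; rewrite mulf_eq0 expf_eq0 => /orP[/andP[_ /eqP e0]|/eqP //].
by move: eps2; rewrite e0 mul0r => /esym/eqP; rewrite oner_eq0.
Qed.

End QReality.

End TracelessExtension.

(** * The trivialization and the dressed projection *)

Section Trivialization.
Variables (R : realType) (n : nat).
Local Notation C := R[i].
Local Notation M := 'M[C]_n.+1.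
Variables (D : set (R * R)) (E : R -> R -> C -> M) (A : bool -> C -> R -> R -> M).
Hypotheses (oD : open D) (cD : connected D) (D0 : D (0, 0)).
Hypotheses (E0 : forall l, E 0 0 l = 1)
  (sE : forall l, msmooth2 D (fun x t => E x t l))
  (dE : forall l b x t, D (x, t) -> mpd b (fun x t => E x t l) x t = E x t l * A b l x t)
  (trA : forall l b x t, D (x, t) -> \tr (A b l x t) = 0).

(** The coefficients of the equations of [E] are traceless, so [det E = 1]. *)
Lemma E_unit l x t : D (x, t) -> E x t l \in unitmx.
Proof.
move=> Dxt; rewrite unitmxE; have -> : \det (E x t l) = 1.
  exact: (det_constant oD cD D0 (sE l) (E0 l) (dE l) (trA l) Dxt).
exact: unitr1.
Qed.

Definition Einv l x t : M := invmx (E x t l).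

Lemma EinvE l x t : D (x, t) -> Einv l x t * E x t l = 1.
Proof. by move=> Dxt; exact: mulVmx (E_unit l Dxt). Qed.
Lemma EEinv l x t : D (x, t) -> E x t l * Einv l x t = 1.
Proof. by move=> Dxt; exact: mulmxV (E_unit l Dxt). Qed.
Lemma msmooth_Einv l : msmooth2 D (Einv l).
Proof. by apply: (msmooth_invmx oD _ (sE l)) => x t; exact: E_unit. Qed.
Lemma is_mpd_E l b x t : D (x, t) -> is_mpd b (fun x t => E x t l) x t (E x t l * A b l x t).
Proof. by move=> Dxt; rewrite -dE //; exact: msmooth_is_mpd (sE l) Dxt. Qed.
Lemma is_mpd_Einv l b x t : D (x, t) ->
  is_mpd b (Einv l) x t (- (A b l x t * Einv l x t)).
Proof.
move=> Dxt; have := is_mpd_invmx oD b (fun x t => @E_unit l x t) (sE l) Dxt.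
have -> : invmx (E x t l) * mpd b (fun x t => E x t l) x t = A b l x t.
  by rewrite dE //; exact: mulKmx (E_unit l Dxt) _.
by [].
Qed.

Section Reality.
Variables (L : M -> M) (l l' : C).
Hypotheses (LL : real_linear L) (Llie : forall X Y, L (lie X Y) = lie (L X) (L Y)).
Hypothesis LA : forall b x t, D (x, t) -> L (A b l' x t) = A b l x t.

(** [L] intertwines the equations at [l'] and [l], so the left side, conjugated by [E(l)], has zero
   derivative. *)
Lemma E_reality Z x t : D (x, t) ->
  L (Einv l' x t * Z * E x t l') = Einv l x t * L Z * E x t l.
Proof.
move=> Dxt.
pose Y x t := Einv l' x t * Z * E x t l'.
pose K x t := E x t l * (L (Y x t) * Einv l x t).
have sY : msmooth2 D Y.
  apply: (msmoothM oD); last exact: sE.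
  by apply: (msmoothM oD); [exact: msmooth_Einv | exact: msmooth_cst].
have dY b y s : D (y, s) -> is_mpd b Y y s (lie (Y y s) (A b l' y s)).
  move=> Dys; have := is_mpdM (is_mpdM (is_mpd_Einv l' b Dys) (is_mpd_cst b Z y s))
    (is_mpd_E l' b Dys).
  by rewrite mulr0 addr0 !mulNr addrC mulrA lieE /Y !mulrA.
have sK : msmooth2 D K.
  apply: (msmoothM oD); first exact: sE.
  apply: (msmoothM oD); last exact: msmooth_Einv.
  exact: (msmooth_real_linear oD LL).
have dK b y s : D (y, s) -> mpd b K y s = 0.
  move=> Dys; have H := is_mpd_real_linear LL (dY b y s Dys).
  rewrite Llie LA // in H.
  rewrite (is_mpd_val (is_mpdM (is_mpd_E l b Dys) (is_mpdM H (is_mpd_Einv l b Dys)))).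
  rewrite lieE !(mulrBl, mulrDr, mulrN, mulrBr) !mulrA.
  set x1 := _ * _ * Einv l y s; set x2 := _ * _ * Einv l y s.
  by move: x1 x2 => x1 x2; mx_linear.
have K0 : K 0 0 = L Z.
  by rewrite /K /Y /Einv !E0 invmx1 !mul1r !mulr1.
have := mconnected_constant oD cD sK dK Dxt D0; rewrite K0 => <-.
by rewrite /K !mulrA EinvE // mul1r -[RHS]mulrA EinvE // mulr1.
Qed.

End Reality.

Section Dressing.
Variables (al1 al2 : C) (pi : M).
Hypothesis pi2 : pi *m pi = pi.
Variable W : set (R * R).
Hypotheses (oW : open W) (WD : W `<=` D)
  (capW : forall x t, W (x, t) -> ((tV1 E al1 pi x t)^T :&: (tV2 E al2 pi x t)^T)%MS = 0).

Local Notation F1 := (Einv al1).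
Local Notation F2 := (Einv al2).
(** Its columns over [Im pi] and [Im (1 - pi)] span the two transported subspaces, so it carries
   [pi] to the dressed projection. *)
Definition frame x t : M := F1 x t * pi + F2 x t * (1 - pi).
Definition Delta0 : M := al2 *: 1 + (al1 - al2) *: pi.
Definition Delta x t : M := al2 *: 1 + (al1 - al2) *: tpi E al1 al2 pi x t.

Lemma piV : pi * (1 - pi) = 0. Proof. by rewrite mulrBr mulr1 [pi * pi]pi2 subrr. Qed.
Lemma Vpi : (1 - pi) * pi = 0. Proof. by rewrite mulrBl mul1r [pi * pi]pi2 subrr. Qed.

Lemma frame_pi x t : frame x t * pi = F1 x t * pi.
Proof. by rewrite /frame mulrDl -!mulrA Vpi mulr0 addr0 [pi * pi]pi2. Qed.
Lemma frame_piC x t : frame x t * (1 - pi) = F2 x t * (1 - pi).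
Proof.
rewrite /frame mulrDl -!mulrA piV mulr0 add0r; congr (_ * _).
by rewrite mulrBr mulr1 Vpi subr0.
Qed.

Lemma frame_tr x t : (frame x t)^T = (tV1 E al1 pi x t)^T + (tV2 E al2 pi x t)^T.
Proof. exact: linearD. Qed.

Lemma tpi_frame x t : W (x, t) -> tpi E al1 al2 pi x t * frame x t = frame x t * pi.
Proof.
move=> Wxt; rewrite frame_pi; apply: trmx_inj.
rewrite /tpi [(_ * frame x t)^T]trmx_mul trmxK frame_tr mulmxDl.
rewrite proj_mx_id ?capW ?submx_refl // proj_mx_0 ?capW ?submx_refl // addr0.
by [].
Qed.

(** A row vector that kills the frame pairs to zero with both parts, as the two subspaces are
   independent, and these parts span. *)
Lemma frame_unit x t : W (x, t) -> frame x t \in unitmx.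
Proof.
move=> Wxt; rewrite -unitmx_tr -row_free_unit; apply: inj_row_free => v.
rewrite frame_tr mulmxDr => /eqP; rewrite addr_eq0 => /eqP e.
have e1 : v *m (tV1 E al1 pi x t)^T = 0.
  apply/eqP; rewrite -submx0 -(capW Wxt) sub_capmx submxMl e.
  by rewrite -mulNmx submxMl.
have e2 : v *m (tV2 E al2 pi x t)^T = 0.
  by move/eqP: e; rewrite e1 eq_sym oppr_eq0 => /eqP.
have Dxt := WD Wxt.
have kill l X : v *m (invmx (E x t l) *m X)^T = 0 -> v *m X^T = 0.
  rewrite trmx_mul mulmxA => /(congr1 (fun w => w *m (E x t l)^T)).
  by rewrite mul0mx -!mulmxA -trmx_mul [E x t l *m _]EEinv // trmx1 mulmx1.
have := kill _ _ e2; rewrite linearB /= mulmxBr (kill _ _ e1) subr0 trmx1 mulmx1.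
by [].
Qed.

Lemma Delta_frame x t : W (x, t) -> Delta x t * frame x t = frame x t * Delta0.
Proof.
move=> /tpi_frame; rewrite /Delta /Delta0; move: (frame x t) (tpi _ _ _ _ _ _) => S p pS.
by rewrite mulrDl mulrDr -!(scalerAl, scalerAr) mul1r mulr1 pS.
Qed.

Lemma frame_Delta0X m x t : frame x t * Delta0 ^+ m =
  al1 ^+ m *: (F1 x t * pi) + al2 ^+ m *: (F2 x t * (1 - pi)).
Proof.
elim: m => [|m IH]; first by rewrite !expr0 mulr1 !scale1r.
have p1 : pi * Delta0 = al1 *: pi.
  rewrite /Delta0 mulrDr -!scalerAr mulr1 [pi * pi]pi2 -scalerDl.
  by rewrite addrC subrK.
have p2 : (1 - pi) * Delta0 = al2 *: (1 - pi).
  by rewrite /Delta0 mulrDr -!scalerAr mulr1 Vpi scaler0 addr0.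
rewrite exprSr mulrA IH mulrDl -!scalerAl -!mulrA p1 p2 -!scalerAr !scalerA.
by rewrite -!exprSr.
Qed.

Lemma DeltaX_frame m x t : W (x, t) -> Delta x t ^+ m * frame x t = frame x t * Delta0 ^+ m.
Proof.
move=> Wxt; elim: m => [|m IH]; first by rewrite !expr0 mulr1 mul1r.
by rewrite exprSr -mulrA Delta_frame // mulrA IH -mulrA -exprSr.
Qed.

Lemma frameV x t : W (x, t) -> frame x t * invmx (frame x t) = 1.
Proof. by move=> Wxt; exact: mulmxV (frame_unit Wxt). Qed.

Lemma DeltaE x t : W (x, t) -> Delta x t = frame x t * Delta0 * invmx (frame x t).
Proof. by move=> Wxt; rewrite -Delta_frame // -mulrA frameV // mulr1. Qed.

Lemma smoothW (F : R -> R -> M) : msmooth2 D F -> msmooth2 W F.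
Proof.
by move=> H i j; have [H1 H2] := H i j; split=> w x t Wxt; [apply: H1 | apply: H2]; exact: WD.
Qed.

Lemma msmooth_frame : msmooth2 W frame.
Proof.
by apply: (msmoothD oW); apply: (msmoothM oW);
  [exact/smoothW/msmooth_Einv | exact: msmooth_cst
  | exact/smoothW/msmooth_Einv | exact: msmooth_cst].
Qed.

Lemma msmooth_Delta : msmooth2 W Delta.
Proof.
apply: (msmooth_congr oW (F := fun x t => frame x t * Delta0 * invmx (frame x t))).
  by move=> x t Wxt; rewrite -DeltaE.
apply: (msmoothM oW); first by apply: (msmoothM oW); [exact: msmooth_frame | exact: msmooth_cst].
by apply: (msmooth_invmx oW) => [x t|]; [exact: frame_unit | exact: msmooth_frame].
Qed.

(** By differentiating [Delta S = S Delta0], when the frame satisfies [S_x = - B S]. *)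
Lemma Delta_derive b (B : R -> R -> M) x t : W (x, t) ->
  A b al1 x t * (F1 x t * pi) + A b al2 x t * (F2 x t * (1 - pi)) = B x t * frame x t ->
  mpd b Delta x t = Delta x t * B x t - B x t * Delta x t.
Proof.
move=> Wxt eB; have Dxt := WD Wxt.
have dS : is_mpd b frame x t (- (B x t * frame x t)).
  have := is_mpdD (is_mpdM (is_mpd_Einv al1 b Dxt) (is_mpd_cst b pi x t))
    (is_mpdM (is_mpd_Einv al2 b Dxt) (is_mpd_cst b (1 - pi) x t)).
  by rewrite !mulr0 !addr0 !mulNr -opprD -!mulrA eB.
have := is_mpd_val (is_mpdM (msmooth_is_mpd b msmooth_Delta Wxt) dS).
rewrite (@mpd_congr R n W oW b _ (fun x t => frame x t * Delta0)) //; last first.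
  by move=> y s; exact: Delta_frame.
rewrite (is_mpd_val (is_mpdM dS (is_mpd_cst b Delta0 x t))) mulr0 addr0.
rewrite mulrN mulNr => /esym/eqP; rewrite subr_eq => /eqP.
rewrite -mulrA -Delta_frame // !mulrA addrC -mulrBl.
move=> /(congr1 (fun X => X * invmx (frame x t))).
by rewrite -!mulrA frameV // !mulr1.
Qed.

Lemma dressingE a (u : R -> R -> M) x t :
  dressing a u E al1 al2 pi x t = dressed a u Delta x t.
Proof.
rewrite /dressing /dressed /Delta !lieE mulrDr mulrDl -!(scalerAl, scalerAr) mulr1 mul1r.
by rewrite opprD addrACA subrr add0r scalerBr.
Qed.

End Dressing.
End Trivialization.

(** * Adjoint action of the group involution *)

Section MatrixLemmas.
Variables (R : realType) (n : nat).
Local Notation C := R[i].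
Local Notation M := 'M[C]_n.+1.

(** Elementary matrices between two factors separate the entries of the factors. *)
Lemma delta_sandwich (A B : M) j k i l : (A * delta_mx j k * B) i l = A i j * B k l.
Proof.
rewrite mxE (bigD1 k) //= [X in _ + X]big1 ?addr0 => [|m mk].
  rewrite mxE (bigD1 j) //= mxE !eqxx mulr1 [X in _ + X]big1 ?addr0 // => m mj.
  by rewrite mxE (negbTE mj) mulr0.
rewrite mxE big1 ?mul0r // => o _.
by rewrite mxE (negbTE mk) andbF mulr0.
Qed.

Lemma neq0_entry (A : M) : A <> 0 -> exists i j, A i j != 0.
Proof.
move=> A0; apply: contrapT => H; apply: A0; apply/matrixP => i j; rewrite mxE.
by apply: contrapT => Aij; apply: H; exists i, j; apply/eqP.
Qed.

Lemma sandwich_eq0 (A B : M) : B <> 0 -> (forall X, A * X * B = 0) -> A = 0.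
Proof.
move=> /neq0_entry[k [l Bkl]] H; apply/matrixP => i j; rewrite mxE.
have /matrixP/(_ i l) := H (delta_mx j k); rewrite delta_sandwich mxE => /eqP.
by rewrite mulf_eq0 (negbTE Bkl) orbF => /eqP.
Qed.

(** [Hom(V2, V1)] and [Hom(V1, V2)] generate the algebra of all matrices, of which the centre is
   scalar.  In blocks: [Z] is block diagonal, and its blocks [A], [B] satisfy [A X = X B] for
   all [X]. *)
Lemma scalar_of_commuting (e Z : M) : e * e = e -> e <> 0 -> 1 - e <> 0 ->
  (forall X, Z * (e * X * (1 - e)) = e * X * (1 - e) * Z) ->
  (forall X, Z * ((1 - e) * X * e) = (1 - e) * X * e * Z) ->
  exists c, Z = c *: 1.
Proof.
set f := 1 - e => ee e0 f0 H1 H2.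
have ef : e * f = 0 by rewrite mulrBr mulr1 ee subrr.
have fe : f * e = 0 by rewrite mulrBl mul1r ee subrr.
have ff : f * f = f by rewrite {2}/f mulrBr mulr1 fe subr0.
have fZe : f * Z * e = 0.
  apply: (sandwich_eq0 f0) => X.
  by rewrite -!mulrA (mulrA e) H1 !mulrA fe !mul0r.
have eZf : e * Z * f = 0.
  apply: (sandwich_eq0 e0) => X.
  by rewrite -!mulrA (mulrA f) H2 !mulrA ef !mul0r.
have one : e + f = 1 by rewrite /f addrC subrK.
have Ze : Z * e = e * Z * e by rewrite -[LHS]mul1r -one mulrDl !mulrA fZe addr0.
have Zf : Z * f = f * Z * f by rewrite -[LHS]mul1r -one mulrDl !mulrA eZf add0r.
have fZ : f * Z = f * Z * f by rewrite -[LHS]mulr1 -one mulrDr fZe add0r.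
have [k [l fkl]] := neq0_entry f0; have [i [j eij]] := neq0_entry e0.
have W i' j' k' l' : (Z * e) i' j' * f k' l' = e i' j' * (f * Z) k' l'.
  rewrite -!delta_sandwich; congr (fun_of_matrix _ i' l').
  by have := H1 (delta_mx j' k'); rewrite !mulrA.
pose c := (f * Z) k l / f k l.
have Zec : Z * e = c *: e.
  apply/matrixP => i' j'; rewrite [RHS]mxE.
  by apply: (mulIf fkl); rewrite W /c mulrAC divfK // mulrC.
have fZc : f * Z = c *: f.
  apply/matrixP => k' l'; rewrite [RHS]mxE.
  by apply: (mulfI eij); rewrite -W Zec mxE mulrCA mulrA.
exists c; rewrite -one scalerDr -Zec -fZc fZ -Zf.
by rewrite -mulrDr one mulr1.
Qed.

(** The polynomial [det (1 + z X)] is 1 at 0, so it has fewer roots than its size, and the numbers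
   [d / (i + 1)] with [i] below the size cannot all be roots. *)
Lemma small_unit (X : M) (d : R) : 0 < d ->
  exists2 r : R, 0 < r <= d & 1 + r%:C *: X \in unitmx.
Proof.
move=> d0; pose P : 'M[{poly C}]_n.+1 := 1%:M + 'X *: map_mx polyC X.
have Pz z : (\det P).[z] = \det (1 + z *: X).
  rewrite -[LHS]/(horner_eval z (\det P)) -det_map_mx; congr (\det _).
  apply/matrixP => i j; rewrite mxE -[LHS]/((P i j).[z]) !mxE.
  rewrite hornerD hornerM hornerX hornerC.
  by congr (_ + _); case: (i == j); rewrite ?mulr1n ?mulr0n ?horner0 // hornerE.
have P0 : \det P != 0.
  apply/eqP => detP; have := Pz 0; rewrite detP horner0 scale0r addr0 [\det _]det1.
  by move=> /esym/eqP; rewrite oner_eq0.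
pose rs := [seq (d / i.+1%:R)%:C | i <- iota 0 (size (\det P))].
have : ~~ all (root (\det P)) rs.
  have urs : uniq rs.
    rewrite map_inj_uniq ?iota_uniq // => i j /complexI /(mulfI (lt0r_neq0 d0)) /invr_inj /eqP.
    by rewrite eqr_nat eqSS => /eqP.
  apply/negP => /(max_poly_roots P0) /(_ urs).
  by rewrite size_map size_iota ltnn.
case/allPn => _ /mapP[i _ ->] /rootP/eqP; rewrite Pz => Pi.
exists (d / i.+1%:R).
  by rewrite divr_gt0 ?ltr0n //= ler_pdivrMr ?ltr0n // ler_peMr ?ler1n // ltW.
by rewrite unitmxE unitfE.
Qed.

Lemma entry_le_sum (f : 'I_n.+1 -> 'I_n.+1 -> R) i j : (forall i j, 0 <= f i j) ->
  f i j <= 1 + \sum_i \sum_j f i j.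
Proof.
move=> f0; rewrite (bigD1 i) //= (bigD1 j) //= -addrA (addrCA 1) lerDl.
by do !apply: addr_ge0 => //; apply: sumr_ge0 => k _ //; exact: sumr_ge0.
Qed.

End MatrixLemmas.

Section Adjoint.
Variables (R : realType) (n : nat).
Local Notation C := R[i].
Local Notation M := 'M[C]_n.+1.
Variables (s : {rmorphism C -> C}) (phi Phi : M -> M).
Hypotheses (sR : forall r : R, s r%:C = r%:C) (hphi : lie_involution s phi)
  (hPhi : induced_involution s phi Phi).

Lemma Phi1 : Phi 1 = 1.
Proof.
have u1 := unitmx1 C n.+1; have uP := ind_inv_unit hPhi u1.
have := ind_inv_mul hPhi u1 u1; rewrite mulmx1 => /(congr1 (mulmx (invmx (Phi 1%:M)))).
by rewrite mulVmx // mulKmx.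
Qed.

Lemma PhiV g : g \in unitmx -> Phi (invmx g) = invmx (Phi g).
Proof.
move=> ug; have uPg := ind_inv_unit hPhi ug.
have uV : invmx g \in unitmx by rewrite unitmx_inv.
have := ind_inv_mul hPhi ug uV; rewrite mulmxV // -/(1 : M) Phi1.
by move=> /(congr1 (mulmx (invmx (Phi g)))); rewrite mulmx1 mulKmx.
Qed.

Lemma small_zero (x c : C) : 0 <= c -> (forall eps : R, 0 < eps -> `|x| <= eps%:C * c) -> x = 0.
Proof.
move=> c0 H; apply/eqP; rewrite -normr_eq0; apply/negPn/negP => x0.
have rc : (Re c)%:C = c by rewrite RRe_real // ger0_real.
have rx : (Re `|x|)%:C = `|x| by rewrite RRe_real // ger0_real.
have c1 : 0 <= Re c by rewrite -ler0c rc.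
have x1 : 0 < Re `|x| by rewrite -ltcR rx lt_neqAle eq_sym x0 normr_ge0.
have := H (Re `|x| / (Re c + 1)) (divr_gt0 x1 (ltr_wpDl c1 ltr01)).
rewrite -{1}rx -{2}rc -rmorphM lecR mulrAC ler_pdivlMr ?ltr_wpDl //.
by rewrite mulrDr mulr1 gerDl leNgt x1.
Qed.

(** Compare [Phi (1 + r g X g^-1) = Phi g Phi (1 + r X) (Phi g)^-1] to first order in [r]. *)
Lemma gl_ext_Ad g X : g \in unitmx ->
  gl_ext phi (g * X * invmx g) = Phi g * gl_ext phi X * invmx (Phi g).
Proof.
move=> ug; have [d [dlin dsl diff]] := ind_inv_diff hPhi.
have dr (r : R) Z : d (r%:C *: Z) = r%:C *: d Z.
  have d0 : d 0 = 0.
    have := dlin 1 0 0; rewrite rmorph1 !scale1r add0r => /eqP.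
    by rewrite -subr_eq subrr eq_sym => /eqP.
  by have := dlin r%:C Z 0; rewrite !addr0 d0 addr0 sR.
have dAd Z : d (g * Z * invmx g) = Phi g * d Z * invmx (Phi g).
  apply/eqP; rewrite -subr_eq0; apply/eqP.
  set P := Phi g; set P' := invmx P; set Y := g * Z * invmx g; set T := _ - _.
  pose nr (z : C) : R := Re `|z|.
  have nE (z : C) : `|z| = (nr z)%:C by rewrite RRe_real // ger0_real.
  have n0 z : 0 <= nr z by rewrite -ler0c -nE.
  pose B : R := 1 + \sum_i \sum_j (nr (Z i j) + nr (Y i j)).
  have Bn0 i j : 0 <= nr (Z i j) + nr (Y i j) by rewrite addr_ge0.
  have Bbound i j : nr (Z i j) + nr (Y i j) <= B.
    exact: (entry_le_sum (f := fun i j => nr (Z i j) + nr (Y i j))).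
  have B0 : 0 < B.
    by rewrite ltr_wpDr ?ltr01 //; apply: sumr_ge0 => k _; apply: sumr_ge0 => l _.
  have ZB i j : `|Z i j| <= B%:C.
    by rewrite nE lecR; apply: le_trans (Bbound i j); rewrite lerDl.
  have YB i j : `|Y i j| <= B%:C.
    by rewrite nE lecR; apply: le_trans (Bbound i j); rewrite lerDr.
  apply/matrixP => i j; rewrite [RHS]mxE.
  pose K : C := \sum_k \sum_l `|P i k| * `|P' l j|.
  have K0 : 0 <= K by apply: sumr_ge0 => k _; apply: sumr_ge0 => l _; exact: mulr_ge0.
  apply: (@small_zero _ (B%:C * (K + 1))).
    by apply: mulr_ge0; [rewrite ler0c ltW | apply: addr_ge0].
  move=> eps eps0; have [del del0 Hdel] := diff eps eps0.
  have [r /andP[r0 rdel] ur] := small_unit Z (divr_gt0 del0 B0).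
  have rB : 0 <= r * B <= del by rewrite -ler_pdivlMr // rdel andbT mulr_ge0 ?(ltW r0) ?(ltW B0).
  have small (U : M) k l : `|U k l| <= B%:C -> `|(r%:C *: U : M) k l| <= (r * B)%:C.
    move=> UB; rewrite mxE normrM rmorphM; apply: ler_pM => //.
    by rewrite ger0_norm // ler0c ltW.
  have e1 k l := Hdel (r * B) (r%:C *: Z) rB (fun k l => small Z k l (ZB k l)) k l.
  have e2 := Hdel (r * B) (r%:C *: Y) rB (fun k l => small Y k l (YB k l)) i j.
  have uV : invmx g \in unitmx by rewrite unitmx_inv.
  have ePhi : Phi (1 + r%:C *: Y) = P * Phi (1 + r%:C *: Z) * P'.
    have -> : 1 + r%:C *: Y = g *m (1 + r%:C *: Z) *m invmx g.
      by rewrite mulmxDr mulmxDl [g *m 1]mulmx1 mulmxV // -scalemxAr -scalemxAl.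
    rewrite (ind_inv_mul hPhi) ?unitmx_mul ?ug // (ind_inv_mul hPhi) // PhiV //.
  move: e1 e2; rewrite ePhi !dr.
  set f1 := _ - _ - _; set f2 := _ - _ - _ => e1 e2.
  have uP := ind_inv_unit hPhi ug; rewrite -/P in uP.
  have rT : r%:C *: T = P * f1 * P' - f2.
    rewrite /f1 /f2 /T !(mulrBr, mulrBl) mulr1 [P * P']mulmxV // -scalerAr -scalerAl.
    move: (P * _ * P') (P * d Z * P') (d Y) => x1 x2 x3.
    by mx_linear.
  have b1 : `|(P * f1 * P') i j| <= (eps * (r * B))%:C * K.
    rewrite mxE; apply: le_trans (ler_norm_sum _ _ _) _.
    rewrite /K exchange_big mulr_sumr; apply: ler_sum => l _.
    rewrite mxE normrM; apply: le_trans (ler_wpM2r _ (ler_norm_sum _ _ _)) _ => //.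
    rewrite mulr_suml mulr_sumr; apply: ler_sum => k _.
    by rewrite normrM mulrAC mulrC ler_wpM2r // mulr_ge0.
  have r0' : (0 : C) < r%:C by rewrite ltcR.
  rewrite -(ler_pM2l r0') -{1}(gtr0_norm r0') -normrM.
  have -> : r%:C * T i j = (P * f1 * P') i j - f2 i j.
    by have /matrixP/(_ i j) := rT; rewrite !mxE.
  apply: le_trans (ler_normB _ _) _; apply: le_trans (lerD b1 e2) _.
  by rewrite le_eqVlt; apply/orP; left; apply/eqP; rewrite !rmorphM; ring.
have slAd Z : in_sl Z -> in_sl (g * Z * invmx g).
  by move=> sZ; rewrite /in_sl mxtrace_mulC mulmxA mulVmx // mul1mx.
have -> : gl_ext phi (g * X * invmx g) = phi (g * sl_part X * invmx g).
  congr phi; rewrite /sl_part mxtrace_mulC [_ *m _]mulrA [_ * g]mulVmx // mul1r.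
  by rewrite mulrBr mulrBl -scalerAr -scalerAl mulr1 [g * invmx g]mulmxV.
by rewrite -dsl ?dAd ?dsl //; [exact: sl_part_sl | exact/slAd/sl_part_sl].
Qed.

End Adjoint.

(** * Reality of the simple element and of its dressing *)

(** Two values of [l] separate the coefficients of a relation that is affine in [l]. *)
Lemma two_points (F : fieldType) (l a b x p q : F) : p - q != 0 ->
  (l - p) * (l * x - a) = (l - q) * (l * x - b) ->
  (l + 1 - p) * ((l + 1) * x - a) = (l + 1 - q) * ((l + 1) * x - b) ->
  b = p * x /\ a = q * x.
Proof.
move=> pq /eqP; rewrite -subr_eq0 => /eqP k1 /eqP; rewrite -subr_eq0 => /eqP k2.
have ea : a = b - (p - q) * x.
  apply/eqP; rewrite -subr_eq0; apply/eqP.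
  have -> : a - (b - (p - q) * x) = ((l - p) * (l * x - a) - (l - q) * (l * x - b)) -
      ((l + 1 - p) * ((l + 1) * x - a) - (l + 1 - q) * ((l + 1) * x - b)) by ring.
  by rewrite k1 k2 subrr.
have b_px : b = p * x.
  apply: (mulfI pq); apply/eqP; rewrite -subr_eq0; apply/eqP.
  by rewrite -[RHS]k1 ea; ring.
by split=> //; rewrite ea b_px; ring.
Qed.

(** Conjugation by [g = f^-1] transports the matrices with image in [Im e] that vanish on it: they
   only depend on the subspace [Im e], on which [S] and [f] agree. *)
Lemma raising_transport (B : nzRingType) (S Si e f g Y : B) :
  S * Si = 1 -> Si * S = 1 -> S * e = f * e -> e * e = e -> f * g = 1 -> g * f = 1 ->
  (S * e * Si * Y = Y /\ Y * (S * e * Si) = 0) <->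
  (e * (g * Y * f) = g * Y * f /\ g * Y * f * e = 0).
Proof.
move=> SSi SiS Se ee fg gf; have gSe : g * (S * e) = e by rewrite Se mulrA gf mul1r.
split=> -[H1 H2]; split.
- have gY : g * Y = e * Si * Y by rewrite -{1}H1 !mulrA -(mulrA g) gSe.
  by rewrite !mulrA -(mulrA e) gY !mulrA ee.
- rewrite -mulrA -Se -!mulrA; have := congr1 (fun X => g * (X * S)) H2.
  by rewrite mul0r mulr0 -!mulrA SiS mulr1.
- have Yf : Y * f = S * e * (g * Y * f) by rewrite Se -(mulrA f) H1 !mulrA fg mul1r.
  have -> : Y = Y * f * g by rewrite -mulrA fg mulr1.
  rewrite !mulrA -(mulrA _ Y) Yf !mulrA; congr (_ * _ * _ * _ * _).
  by rewrite -(mulrA _ Si) SiS mulr1 -!mulrA ee.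
- rewrite mulrA Se mulrA; have -> : Y * f * e = f * (g * Y * f * e) by rewrite !mulrA fg mul1r.
  by rewrite H2 mulr0 mul0r.
Qed.

Section ConjugationByResolvent.
Variables (F : fieldType) (n : nat).
Local Notation M := 'M[F]_n.+1.

(** If [Y] maps an eigenspace of [D] to another one, conjugation by the resolvent factor [m - D]
   multiplies it by a scalar. *)
Lemma resolvent_conj (H D Y : M) (c m p q : F) : c *: H = m *: 1 - D -> c != 0 -> m - q != 0 ->
  D * Y = p *: Y -> Y * D = q *: Y -> H * Y = ((m - p) / (m - q)) *: (Y * H).
Proof.
move=> cH c0 mq DY YD; apply: (scalerI c0).
have -> : c *: (H * Y) = (m - p) *: Y.
  by rewrite scalerAl cH mulrBl DY -scalerAl mul1r scalerBl.
have e : c *: (Y * H) = (m - q) *: Y.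
  by rewrite scalerAr cH mulrBr YD -scalerAr mulr1 scalerBl.
by rewrite scalerA mulrC -scalerA e scalerA divfK.
Qed.

Lemma resolvent_cross (H D T : M) (c l x y : F) : c *: H = l *: 1 - D -> y != 0 ->
  (x / y) *: (T * H) = H * T -> x *: (T * (l *: 1 - D)) = y *: ((l *: 1 - D) * T).
Proof.
move=> <- y0 e; rewrite -scalerAr -scalerAl -e !scalerA; congr (_ *: _).
by field.
Qed.

Lemma conj_eigen (H Hi Y : M) (c : F) : H * Hi = 1 -> H * Y = c *: (Y * H) ->
  H * Y * Hi = c *: Y.
Proof. by move=> HHi ->; rewrite -scalerAl -mulrA HHi mulr1. Qed.

Lemma conj_eigenV (H Hi Y : M) (c : F) : Hi * H = 1 -> c *: Y = H * Y * Hi ->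
  c *: (Y * H) = H * Y.
Proof. by move=> HiH e; rewrite scalerAl e -(mulrA (H * Y)) HiH mulr1. Qed.

End ConjugationByResolvent.

Section SimpleElementReality.
Variables (R : realType) (n : nat).
Local Notation C := R[i].
Local Notation M := 'M[C]_n.+1.
Variables (s : {rmorphism C -> C}) (phi Phi : M -> M).
Hypotheses (sR : forall r : R, s r%:C = r%:C) (sK : involutive s)
  (hphi : lie_involution s phi) (hPhi : induced_involution s phi Phi).
Variable eps : C.
Hypotheses (eps2 : eps * eps = 1) (seps : s eps = eps).
Local Notation gl := (gl_ext phi).

Definition nu (p : C) : C := eps * s p.

Lemma nuK p : nu (nu p) = p.
Proof. by rewrite /nu rmorphM seps sK mulrA eps2 mul1r. Qed.
Lemma nuB p q : nu (p - q) = nu p - nu q.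
Proof. by rewrite /nu rmorphB mulrBr. Qed.
Lemma nu_inj : injective nu.
Proof. exact: can_inj nuK. Qed.
Lemma s_nu p : s (nu p) = eps * p.
Proof. by rewrite /nu rmorphM seps sK. Qed.
Lemma eps_norm : `|eps| = 1.
Proof.
have /eqP : eps ^+ 2 = 1 by rewrite expr2.
by rewrite sqrf_eq1 => /orP[] /eqP ->; rewrite ?normrN normr1.
Qed.

Variables (al1 al2 : C) (pi : M).
Hypotheses (pi2 : pi *m pi = pi) (al12 : al1 != al2) (pi0 : pi <> 0) (pi1 : 1 - pi <> 0).
Local Notation h := (simple_element al1 al2 pi).
Local Notation D0 := (Delta0 al1 al2 pi).
Hypothesis hreal : forall l, l \notin [:: al1; al2] -> nu l \notin [:: al1; al2] ->
  Phi (h (nu l)) = h l.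

Lemma simple_elementE l : l != al1 -> (l - al1) *: h l = l *: 1 - D0.
Proof.
move=> l1; rewrite -[h l]/(1 + ((al1 - al2) / (l - al1)) *: (1 - pi) : M) /Delta0.
rewrite scalerDr scalerA mulrC divfK ?subr_eq0 //.
by move: (1 : M) => I; mx_linear.
Qed.

Lemma simple_unit l : l \notin [:: al1; al2] -> h l \in unitmx.
Proof.
rewrite !inE negb_or => /andP[l1 l2].
have pp : pi * pi = pi by [].
have l1' : l - al1 != 0 by rewrite subr_eq0.
have l2' : l - al2 != 0 by rewrite subr_eq0.
suff /mulmx1_unit[] : h l *m (1 + ((al2 - al1) / (l - al2)) *: (1 - pi)) = 1 by [].
rewrite -[h l]/(1 + ((al1 - al2) / (l - al1)) *: (1 - pi) : M).
set x := _ / (l - al1); set y := _ / (l - al2).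
have ff : (1 - pi) * (1 - pi) = 1 - pi.
  by rewrite mulrBr mulr1 mulrBl mul1r pp subrr subr0.
rewrite [_ *m _]mulrDr mulr1 mulrDl mul1r -scalerAl -scalerAr ff.
have e : x + y + x * y = 0 by rewrite /x /y; field; rewrite l1' l2'.
rewrite !scalerA -!addrA -!scalerDl [y + _]addrC addrA.
by rewrite addrAC e scale0r addr0.
Qed.

(** Real [l] of modulus greater than those of [al1] and [al2]; [nu] is an isometry. *)
Lemma good_points : exists l, forall m, (m == l) || (m == l + 1) ->
  [/\ m \notin [:: al1; al2], nu m \notin [:: al1; al2] & s m = m].
Proof.
pose nr (z : C) : R := Re `|z|.
have nE (z : C) : `|z| = (nr z)%:C by rewrite RRe_real // ger0_real.
have n0 z : 0 <= nr z by rewrite -ler0c -nE.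
suff H (r : R) : 1 + nr al1 + nr al2 <= r ->
    [/\ r%:C \notin [:: al1; al2], nu r%:C \notin [:: al1; al2] & s r%:C = r%:C].
  exists (1 + nr al1 + nr al2)%:C => m /orP[]/eqP ->; first exact: H.
  rewrite -(rmorph1 (real_complex R)) -rmorphD; apply: H.
  by rewrite lerDl.
move=> hr; have r0 : 0 <= r by apply: le_trans hr; rewrite !addr_ge0.
have big z : `|z| = r%:C -> z \notin [:: al1; al2].
  move=> zr; rewrite !inE; apply/negP => /orP[] /eqP zal; move: zr; rewrite zal nE => /complexI e;
    move: hr; rewrite -e; apply/negP; rewrite -ltNge.
    by rewrite addrAC ltrDr ltr_wpDr.
  by rewrite ltrDr ltr_wpDr.
have nr' : `|r%:C : C| = r%:C by rewrite ger0_norm ?ler0c.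
by split=> //; apply: big => //; rewrite /nu sR normrM eps_norm mul1r.
Qed.

(** The group elements [h (nu l)] and [h l] correspond under [Phi], hence so do their adjoint actions
   under [phi]; [Y] is an eigenvector of the first with eigenvalue [(nu l - p) / (nu l - q)].  This
   gives a relation for [phi Y], affine in [l], whose two coefficients are the conclusions. *)
Lemma eigen_image Y p q : p \in [:: al1; al2] -> q \in [:: al1; al2] -> p != q ->
  D0 * Y = p *: Y -> Y * D0 = q *: Y ->
  D0 * gl Y = nu p *: gl Y /\ gl Y * D0 = nu q *: gl Y.
Proof.
move=> pal qal pq DY YD; set T := gl Y.
have [l0 good] := good_points.
have key l : l \notin [:: al1; al2] -> nu l \notin [:: al1; al2] ->
    (l - nu p) *: (T * (l *: 1 - D0)) = (l - nu q) *: ((l *: 1 - D0) * T).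
  move=> gl1 gl2; have un := simple_unit gl2; have ul := simple_unit gl1.
  have nl1 : nu l - al1 != 0.
    by rewrite subr_eq0; apply: contraNneq gl2 => ->; rewrite inE eqxx.
  have ll1 : l - al1 != 0.
    by rewrite subr_eq0; apply: contraNneq gl1 => ->; rewrite inE eqxx.
  have nlq : nu l - q != 0.
    by rewrite subr_eq0; apply: contraNneq gl2 => ->.
  have lq : l - nu q != 0.
    by rewrite subr_eq0; apply: contraNneq nlq => ->; rewrite nuK subrr.
  have nl1' : nu l != al1 by rewrite -subr_eq0.
  have ll1' : l != al1 by rewrite -subr_eq0.
  have hY := resolvent_conj (simple_elementE nl1') nl1 nlq DY YD.
  have hYh : h (nu l) * Y * invmx (h (nu l)) = ((nu l - p) / (nu l - q)) *: Y.
    exact: conj_eigen (mulmxV un) hY.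
  have := gl_ext_Ad sR hPhi Y un; rewrite hYh (gl_extZ hphi) hreal // -/T.
  move=> /(conj_eigenV (mulVmx ul)).
  have -> : s ((nu l - p) / (nu l - q)) = (l - nu p) / (l - nu q).
    rewrite rmorphM fmorphV !rmorphB s_nu.
    have sq : s q = eps * nu q by rewrite /nu mulrA eps2 mul1r.
    have sp : s p = eps * nu p by rewrite /nu mulrA eps2 mul1r.
    rewrite sq sp -!mulrBr invfM mulrACA divff ?mul1r //.
    by apply: contraTneq (oner_neq0 C) => e0; rewrite -eps2 e0 mul0r eqxx.
  exact: (resolvent_cross (simple_elementE ll1') lq).
have [g1 g2 _] := good l0 (predU1l _ (erefl l0)).
have [g3 g4 _] := good (l0 + 1) (introT orP (or_intror (eqxx _))).
have k1 := key _ g1 g2; have {key} k2 := key _ g3 g4.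
have npq : nu p - nu q != 0.
  by rewrite subr_eq0; apply: contraNneq pq => /nu_inj ->.
move: k1 k2; rewrite !mulrBr !mulrBl -!(scalerAl, scalerAr) !mulr1 !mul1r.
move: (T * D0) (D0 * T) => A B; move: (T) (nu p) (nu q) npq => X p' q' npq k1 k2.
have H i j : B i j = p' * X i j /\ A i j = q' * X i j.
  move/matrixP/(_ i j): k1; move/matrixP/(_ i j): k2; rewrite !mxE => k2 k1.
  exact: (two_points npq k1 k2).
by split; apply/matrixP => i j; rewrite mxE; case: (H i j).
Qed.

(** The eigenprojection of [D0] for the eigenvalue [p], the other eigenvalue, and the matrices that
   map the complementary eigenspace to the image of [e]. *)
Definition eproj p : M := if p == al1 then pi else 1 - pi.
Definition eother p : C := if p == al1 then al2 else al1.
Definition raising (e Y : M) := e * Y = Y /\ Y * e = 0.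

Lemma eproj_idem p : eproj p * eproj p = eproj p.
Proof.
have pp : pi * pi = pi by []; rewrite /eproj; case: eqP => // _.
by rewrite mulrBr mulr1 mulrBl mul1r pp subrr subr0.
Qed.

Lemma D0_eproj p : p \in [:: al1; al2] -> D0 = eother p *: 1 + (p - eother p) *: eproj p.
Proof.
rewrite !inE /eproj /eother => /orP[]/eqP ->; first by rewrite eqxx.
rewrite (eq_sym al2 al1) (negbTE al12) /Delta0; move: (1 : M) => I; mx_linear.
Qed.

Lemma eother_neq p : p \in [:: al1; al2] -> p - eother p != 0.
Proof.
rewrite !inE /eother subr_eq0 => /orP[]/eqP ->; first by rewrite eqxx.
by rewrite (eq_sym al2 al1) (negbTE al12) eq_sym.
Qed.
Lemma eother_in p : eother p \in [:: al1; al2].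
Proof. by rewrite /eother; case: ifP => _; rewrite !inE eqxx ?orbT. Qed.

Lemma raisingP p Y : p \in [:: al1; al2] ->
  raising (eproj p) Y <-> D0 * Y = p *: Y /\ Y * D0 = eother p *: Y.
Proof.
move=> pal; have pq := eother_neq pal; rewrite (D0_eproj pal).
rewrite mulrDl mulrDr -!(scalerAl, scalerAr) mul1r mulr1; split=> [[eY Ye]|[H1 H2]].
  by rewrite eY Ye scaler0 addr0 -scalerDl addrC subrK.
split; apply: (scalerI pq); apply: (addrI (eother p *: Y)).
  by rewrite H1 -scalerDl addrC subrK.
by rewrite H2 scaler0 addr0.
Qed.

Lemma raising_tr e Y : raising e Y -> in_sl Y.
Proof. by case=> eY Ye; rewrite /in_sl -eY mxtrace_mulC [Y *m e]Ye linear0. Qed.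

Lemma eproj_neq0 p : eproj p <> 0 /\ 1 - eproj p <> 0.
Proof. by rewrite /eproj; case: ifP => _; split=> //; rewrite opprB addrC subrK. Qed.

Lemma raising_sandwich e X : e * e = e -> raising e (e * X * (1 - e)).
Proof. by move=> ee; split; rewrite -!mulrA ?mulrBl ?mul1r ?ee ?subrr ?mulr0 // !mulrA ee. Qed.

(** The image of a nonzero raising matrix under [phi] is nonzero, with eigenvalues [nu p] and
   [nu q] for the multiplications by [D0], whose only eigenvalues are [al1] and [al2]. *)
Lemma nu_perm p : p \in [:: al1; al2] ->
  nu p \in [:: al1; al2] /\ nu (eother p) = eother (nu p).
Proof.
move=> pal; have [e0 f0] := eproj_neq0 p.
have [Y [rY Y0]] : exists Y, raising (eproj p) Y /\ Y <> 0.
  apply: contrapT => H; apply: e0; apply: (sandwich_eq0 f0) => X.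
  apply: contrapT => H'; apply: H; exists (eproj p * X * (1 - eproj p)); split=> //.
  exact/raising_sandwich/eproj_idem.
have [DY YD] := (raisingP Y pal).1 rY.
have pq : p != eother p by rewrite -subr_eq0 eother_neq.
have [DT TD] := eigen_image pal (eother_in p) pq DY YD.
have T0 : gl Y <> 0.
  move=> T0; apply: Y0; have := gl_extK hphi Y; rewrite T0 (gl_ext0 hphi).
  by rewrite sl_part_id //; exact: raising_tr rY.
have D0q : (D0 - al1 *: 1) * (D0 - al2 *: 1) = 0.
  have pp : pi * pi = pi by [].
  rewrite /Delta0 [X in _ * X]addrAC subrr add0r -scalerAr mulrBl mulrDl -!scalerAl mul1r pp.
  by rewrite -scalerDl -scalerBl [al2 + _]addrC subrK subrr scale0r scaler0.
have eig : forall r, D0 * gl Y = r *: gl Y -> r \in [:: al1; al2].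
  move=> r Dr; have : ((r - al1) * (r - al2)) *: gl Y = 0.
    rewrite -(mul0r (gl Y)) -D0q -mulrA [(D0 - al2 *: 1) * _]mulrBl Dr -scalerAl mul1r -scalerBl.
    by rewrite -scalerAr [(D0 - _) * _]mulrBl Dr -scalerAl mul1r -scalerBl scalerA mulrC.
  move=> /eqP; rewrite scaler_eq0 => /orP[|/eqP //].
  by rewrite mulf_eq0 !subr_eq0 !inE.
have eig' : forall r, gl Y * D0 = r *: gl Y -> r \in [:: al1; al2].
  move=> r Dr; have : ((r - al1) * (r - al2)) *: gl Y = 0.
    rewrite -(mulr0 (gl Y)) -D0q mulrA [gl Y * _]mulrBr Dr -scalerAr mulr1 -scalerBl.
    by rewrite -scalerAl [gl Y * _]mulrBr Dr -scalerAr mulr1 -scalerBl scalerA mulrC.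
  move=> /eqP; rewrite scaler_eq0 => /orP[|/eqP //].
  by rewrite mulf_eq0 !subr_eq0 !inE.
have nup := eig _ DT; have nuq := eig' _ TD; split=> //.
have : nu p != nu (eother p) by rewrite (inj_eq nu_inj).
move: nup nuq; rewrite /eother !inE => /orP[]/eqP -> /orP[]/eqP ->; rewrite ?eqxx //.
by rewrite (eq_sym al2 al1) (negbTE al12).
Qed.

Lemma raising_image p Y : p \in [:: al1; al2] -> raising (eproj p) Y ->
  raising (eproj (nu p)) (gl Y).
Proof.
move=> pal /(raisingP Y pal)[DY YD]; have [nup nuq] := nu_perm pal.
apply/raisingP => //; rewrite -nuq; apply: eigen_image => //; first exact: eother_in.
by rewrite -subr_eq0 eother_neq.
Qed.

Section Frame.
Variables (S : M) (F E : C -> M).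
Hypotheses (uS : S \in unitmx) (FE : forall p, F p * E p = 1) (EF : forall p, E p * F p = 1).
Hypotheses (S1 : S * pi = F al1 * pi) (S2 : S * (1 - pi) = F al2 * (1 - pi)).
Hypothesis reality : forall p Z, gl (F (nu p) * Z * E (nu p)) = F p * gl Z * E p.

Definition conj_frame (e : M) : M := S * e * invmx S.

Lemma S_eproj p : p \in [:: al1; al2] -> S * eproj p = F p * eproj p.
Proof.
rewrite !inE /eproj => /orP[]/eqP ->; first by rewrite eqxx.
by rewrite (eq_sym al2 al1) (negbTE al12).
Qed.

Lemma SV : S * invmx S = 1. Proof. exact: mulmxV. Qed.
Lemma VS : invmx S * S = 1. Proof. exact: mulVmx. Qed.

(** A raising matrix depends only on the image subspace, which [E] transports. *)
Lemma raising_conj p Y : p \in [:: al1; al2] ->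
  raising (conj_frame (eproj p)) Y <-> raising (eproj p) (E p * Y * F p).
Proof.
move=> pal; exact: (raising_transport _ SV VS (S_eproj pal) (eproj_idem p) (FE p) (EF p)).
Qed.

Lemma raising_conj_image p Y : p \in [:: al1; al2] -> raising (conj_frame (eproj p)) Y ->
  raising (conj_frame (eproj (nu p))) (gl Y).
Proof.
move=> pal /(raising_conj Y pal) /(raising_image pal) rY.
have [nup _] := nu_perm pal; apply/raising_conj => //.
have := reality (nu p) (E p * Y * F p); rewrite nuK.
rewrite !mulrA FE mul1r -mulrA FE mulr1 => ->.
by rewrite !mulrA EF mul1r -mulrA EF mulr1.
Qed.

Lemma conj_frame_Delta p : p \in [:: al1; al2] ->
  conj_frame D0 = eother p *: 1 + (p - eother p) *: conj_frame (eproj p).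
Proof.
move=> pal; rewrite /conj_frame {1}(D0_eproj pal) mulrDr mulrDl -!(scalerAr, scalerAl) mulr1.
by rewrite SV.
Qed.

Lemma raising_comm p Y : p \in [:: al1; al2] -> raising (conj_frame (eproj p)) Y ->
  lie (conj_frame D0) Y = (p - eother p) *: Y.
Proof.
move=> pal [eY Ye]; rewrite (conj_frame_Delta pal) lieE mulrDl mulrDr -!(scalerAr, scalerAl).
by rewrite eY Ye mul1r mulr1 scaler0 addr0 addrAC subrr add0r.
Qed.

(** The brackets of [phi (D)] and of [eps D] with a raising matrix are the same multiple of it, since
   [phi] maps raising matrices to raising matrices; so the difference commutes with both kinds. *)
Lemma conj_frame_reality : exists c, gl (conj_frame D0) - eps *: conj_frame D0 = c *: 1.
Proof.
set D := conj_frame D0; set Z := _ - _.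
have comm p Y : p \in [:: al1; al2] -> raising (conj_frame (eproj p)) Y -> Z * Y = Y * Z.
  move=> pal rY; have rT := raising_conj_image pal rY; have [nup nuq] := nu_perm pal.
  have := raising_comm nup rT => /(congr1 gl).
  rewrite -nuq -nuB (gl_ext_lie hphi) (gl_extZ hphi) (gl_extK hphi).
  rewrite (sl_part_id (raising_tr rY)) s_nu -scalerA -(raising_comm pal rY) -/D.
  rewrite !lieE => /eqP; rewrite -subr_eq0 => /eqP e.
  apply/eqP; rewrite -subr_eq0 -[0]e /Z; apply/eqP.
  rewrite mulrBl mulrBr -scalerAl -scalerAr.
  move: (gl D * Y) (Y * gl D) (D * Y) (Y * D) => x1 x2 x3 x4; mx_linear.
have idem p : conj_frame (eproj p) * conj_frame (eproj p) = conj_frame (eproj p).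
  by rewrite /conj_frame !mulrA -(mulrA _ (invmx S) S) VS mulr1 -(mulrA S) eproj_idem.
have one : 1 - conj_frame (eproj al1) = conj_frame (eproj al2).
  rewrite /conj_frame /eproj eqxx (eq_sym al2 al1) (negbTE al12) mulrBr mulr1 mulrBl.
  by rewrite SV.
have neq0 p : conj_frame (eproj p) <> 0.
  move=> /(congr1 (fun X => invmx S * X * S)); rewrite mulr0 mul0r /conj_frame.
  rewrite !mulrA VS mul1r -mulrA VS mulr1.
  by case: (eproj_neq0 p).
have a1 : al1 \in [:: al1; al2] by rewrite inE eqxx.
have a2 : al2 \in [:: al1; al2] by rewrite !inE eqxx orbT.
apply: (@scalar_of_commuting _ _ (conj_frame (eproj al1))).
- exact: idem.
- exact: neq0.
- by rewrite one; exact: neq0.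
- by move=> X; apply: (comm _ _ a1); exact: raising_sandwich.
- move=> X; rewrite one; apply: (comm _ _ a2).
  have -> : conj_frame (eproj al1) = 1 - conj_frame (eproj al2) by rewrite -one opprB addrC subrK.
  exact: raising_sandwich.
Qed.

End Frame.

End SimpleElementReality.

(** * Reality of the dressed solution *)

Section DressedReality.
Variables (R : realType) (n : nat).
Local Notation C := R[i].
Local Notation M := 'M[C]_n.+1.
Variables (a b : M) (Q : nat -> 'M[dpoly R n]_n.+1) (j : nat).
Hypotheses (ha : is_diag_mx a) (hb : forall X, a * X = X * a -> b * X = X * b)
  (hQ : is_Q_family a b Q).
Variables (D : set (R * R)) (u : R -> R -> M) (E : R -> R -> C -> M).
Hypotheses (oD : open D) (cD : connected D) (D0 : D (0, 0)) (su : msmooth2 D u)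
  (hE : trivialization a Q j D u E).
Hypothesis pu : forall x t, D (x, t) -> cent_part a (u x t) = 0.

(** The coefficients of the two linear equations of the trivialization. *)
Definition lax c l x t : M :=
  if c then l *: a + u x t else \sum_(k < j.+1) l ^+ (j - k) *: dmev (ujet u x t) (Q k).

Lemma triv_origin l : E 0 0 l = 1. Proof. by case: (hE l). Qed.
Lemma triv_smooth l : msmooth2 D (fun x t => E x t l). Proof. by case: (hE l). Qed.
Lemma triv_deriv l c x t : D (x, t) -> mpd c (fun x t => E x t l) x t = E x t l * lax c l x t.
Proof. by case: (hE l) => _ _ H1 H2; case: c => Dxt; [exact: H1 | exact: H2]. Qed.

Section OneInvolution.
Variables (s : {rmorphism C -> C}) (phi : M -> M) (eps : C).
Hypotheses (sR : forall r : R, s r%:C = r%:C) (sK : involutive s)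
  (hphi : lie_involution s phi) (eps2 : eps * eps = 1) (seps : s eps = eps)
  (ea : gl_ext phi a = eps *: a) (eb : gl_ext phi b = eps *: b).
Hypothesis fu : forall x t, D (x, t) -> gl_ext phi (u x t) = u x t.

Lemma ujet_compact x t : D (x, t) -> jets_in (compact_perp phi a) (ujet u x t).
Proof.
move=> Dxt k; split; first exact: (ujet_in oD su (@real_linear_cent_part R n a) pu Dxt).
have Ld : real_linear (fun X => gl_ext phi X - X).
  move=> r X Y; rewrite (gl_extP hphi) sR; move: (gl_ext phi X) (gl_ext phi Y) => x1 x2.
  by mx_linear.
have Lu y t' : D (y, t') -> gl_ext phi (u y t') - u y t' = 0.
  by move=> /fu ->; rewrite subrr.
by apply/eqP; rewrite -subr_eq0; apply/eqP; exact: (ujet_in oD su Ld Lu Dxt).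
Qed.

Lemma tr_lax l c x t : in_sl a -> in_sl b -> D (x, t) -> \tr (lax c l x t) = 0.
Proof.
move=> sa sb Dxt; have H k := tr_Q_jet sR hphi ha hQ eps2 ea eb k (ujet_compact Dxt).
case: c => /=; last first.
  rewrite (big_morph _ (@mxtraceD C n.+1) (mxtrace0 _ _)).
  by rewrite big1 // => k _; rewrite linearZ /= H mulr0.
rewrite linearD linearZ /= sa mulr0 add0r.
have := gl_ext_sl hphi (u x t); by rewrite fu.
Qed.

Hypothesis trlax : forall l c x t, D (x, t) -> \tr (lax c l x t) = 0.
Hypothesis eps_j : eps ^+ j.+1 = 1.
Local Notation nu := (nu s eps).

Lemma gl_lax c l x t : D (x, t) -> gl_ext phi (lax c (nu l) x t) = lax c l x t.
Proof.
move=> Dxt; case: c => /=.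
  by rewrite (gl_extP hphi) (s_nu sK seps) ea fu // scalerA mulrAC eps2 mul1r.
rewrite (gl_ext_sum hphi); apply: eq_bigr => k _.
rewrite (gl_extZ hphi) (Q_reality sR hphi ha hQ eps2 ea eb k (ujet_compact Dxt)).
rewrite rmorphXn (s_nu sK seps) scalerA exprMn mulrAC -exprD.
by rewrite addnS subnK ?eps_j ?mul1r // -ltnS ltn_ord.
Qed.

Variables (Phi : M -> M) (hPhi : induced_involution s phi Phi).
Variables (al1 al2 : C) (pi : M) (pi2 : pi *m pi = pi).
Hypothesis hreal : forall l, l \notin [:: al1; al2] -> nu l \notin [:: al1; al2] ->
  Phi (simple_element al1 al2 pi (nu l)) = simple_element al1 al2 pi l.
Variable W : set (R * R).
Hypotheses (WD : W `<=` D)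
  (capW : forall x t, W (x, t) -> ((tV1 E al1 pi x t)^T :&: (tV2 E al2 pi x t)^T)%MS = 0).

(** When [al1 = al2] or [pi] is 0 or 1, [Delta] is scalar and there is nothing to reflect; otherwise
   [phi (Delta)] is [eps Delta] up to scalars, and [phi a = eps a]. *)
Lemma gl_lie_Delta x t : W (x, t) ->
  gl_ext phi (lie a (Delta E al1 al2 pi x t)) = lie a (Delta E al1 al2 pi x t).
Proof.
move=> Wxt; have Dxt := WD Wxt.
have DE := DeltaE oD cD D0 triv_origin triv_smooth triv_deriv trlax pi2 WD capW Wxt.
have uS := frame_unit oD cD D0 triv_origin triv_smooth triv_deriv trlax WD capW Wxt.
have lie1 c : lie a (c *: (1 : M)) = 0.
  by rewrite lieE -scalerAl -scalerAr mulr1 mul1r subrr.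
have scal c : Delta0 al1 al2 pi = c *: 1 ->
    gl_ext phi (lie a (Delta E al1 al2 pi x t)) = lie a (Delta E al1 al2 pi x t).
  move=> e; suff -> : lie a (Delta E al1 al2 pi x t) = 0 by rewrite (gl_ext0 hphi).
  by rewrite DE e -scalerAr mulr1 -scalerAl [_ * _]mulmxV // lie1.
have [al12|al12] := eqVneq al1 al2.
  by apply: (scal al2); rewrite /Delta0 al12 subrr scale0r addr0.
have [pi0|/eqP pi0] := eqVneq pi 0.
  by apply: (scal al2); rewrite /Delta0 pi0 scaler0 addr0.
have [pi1|/eqP pi1] := eqVneq (1 - pi) 0.
  apply: (scal al1); rewrite /Delta0.
  by move/eqP: pi1; rewrite subr_eq0 => /eqP <-; rewrite -scalerDl addrC subrK.
have rE p Z := E_reality oD cD D0 triv_origin triv_smooth triv_deriv trlax (real_linear_gl_ext sR hphi)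
  (gl_ext_lie hphi) (fun c => @gl_lax c p) Z Dxt.
have [c e] := conj_frame_reality sR sK hphi hPhi eps2 seps pi2 al12 pi0 pi1 hreal uS
  (fun p => EinvE oD cD D0 triv_origin triv_smooth triv_deriv trlax p Dxt)
  (fun p => EEinv oD cD D0 triv_origin triv_smooth triv_deriv trlax p Dxt)
  (frame_pi E al1 al2 pi2 x t) (frame_piC E al1 al2 pi2 x t) rE.
rewrite (gl_ext_lie hphi) ea DE -/(conj_frame _ _).
move/eqP: e; rewrite subr_eq => /eqP ->.
rewrite !lieE mulrDr mulrDl -!(scalerAl, scalerAr) mulr1 mul1r !scalerA eps2 !scale1r.
by rewrite opprD addrACA (mulrC c) subrr add0r.
Qed.

End OneInvolution.
End DressedReality.

(** * The dressed solution of the hierarchy *)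

Section DressedFlow.
Variables (R : realType) (n : nat).
Local Notation C := R[i].
Local Notation M := 'M[C]_n.+1.
Variables (a b : M) (Q : nat -> 'M[dpoly R n]_n.+1) (j : nat).
Hypotheses (ha : is_diag_mx a) (hb : forall X, a * X = X * a -> b * X = X * b)
  (hQ : is_Q_family a b Q).
Variables (D : set (R * R)) (u : R -> R -> M) (E : R -> R -> C -> M).
Hypotheses (oD : open D) (cD : connected D) (D0 : D (0, 0))
  (hE : trivialization a Q j D u E) (pu : forall x t, D (x, t) -> cent_part a (u x t) = 0).
Hypothesis trlax : forall l c x t, D (x, t) -> \tr (lax a Q j u c l x t) = 0.
Variables (al1 al2 : C) (pi : M) (pi2 : pi *m pi = pi).
Variable W : set (R * R).
Hypotheses (oW : open W) (WD : W `<=` D)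
  (capW : forall x t, W (x, t) -> ((tV1 E al1 pi x t)^T :&: (tV2 E al2 pi x t)^T)%MS = 0).

Local Notation Del := (Delta E al1 al2 pi).
Local Notation fr := (frame E al1 al2 pi).

(** The frame satisfies [S_x = - (u + a Delta) S]. *)
Lemma Delta_x_flow x t : W (x, t) ->
  mpd true Del x t = - (lie (u x t) (Del x t) + lie a (Del x t) * Del x t).
Proof.
move=> Wxt; rewrite (Delta_derive oD cD D0 (triv_origin hE) (triv_smooth hE) (triv_deriv hE)
  trlax pi2 oW WD capW
  (B := fun x t => u x t + a * Del x t)) //; last first.
  rewrite /lax [RHS]mulrDl -[a * Del x t * _]mulrA.
  rewrite (Delta_frame pi2 capW Wxt).
  rewrite -[Delta0 _ _ _]expr1 frame_Delta0X // !expr1 /frame.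
  move: (Einv E al1 x t * pi) (Einv E al2 x t * (1 - pi)) (u x t) => A1 A2 U.
  rewrite !(mulrDl, mulrDr) -!(scalerAl, scalerAr).
  move: (a * A1) (a * A2) (U * A1) (U * A2) => x1 x2 x3 x4.
  by mx_linear.
rewrite !lieE; move: (Del x t) (u x t) => d U; rewrite mulrDr !mulrDl mulNr !mulrA.
move: (d * U) (d * a * d) (U * d) (a * d * d) => x1 x2 x3 x4.
by mx_linear.
Qed.

(** The frame satisfies [S_t = - (sum_k Q_k Delta^(j-k)) S]. *)
Lemma Delta_t_flow x t : W (x, t) -> mpd false Del x t =
  Del x t * t_coef Q u Del j x t - t_coef Q u Del j x t * Del x t.
Proof.
move=> Wxt; apply: (Delta_derive oD cD D0 (triv_origin hE) (triv_smooth hE) (triv_deriv hE)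
  trlax pi2 oW WD capW) => //.
rewrite /lax /t_coef !mulr_suml -big_split; apply: eq_bigr => k _ /=.
rewrite -mulrA (DeltaX_frame pi2 capW) //.
rewrite frame_Delta0X //; move: (Einv E al1 x t * pi) (Einv E al2 x t * (1 - pi)) => A1 A2.
by rewrite mulrDr -!(scalerAl, scalerAr).
Qed.

Lemma flow_dressing : flow_solution Q j D u ->
  flow_solution Q j W (dressing a u E al1 al2 pi).
Proof.
move=> [su fl].
have suW := smoothW WD su.
have -> : dressing a u E al1 al2 pi = dressed a u Del.
  by apply/funext => x; apply/funext => t; exact: dressingE.
apply: (flow_dressed ha hb hQ oW suW _ _ Delta_x_flow _ Delta_t_flow).
- exact: (msmooth_Delta oD cD D0 (triv_origin hE) (triv_smooth hE) (triv_deriv hE)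
    trlax pi2 oW WD capW).
- by move=> x t /WD; exact: pu.
- by split=> // x t /WD; exact: fl.
Qed.

End DressedFlow.

(** The case of a single involution, [eps = 1] and [nu] the complex conjugation. *)
Lemma U_dressing (R : realType) (n : nat) (tau tauhat : 'M[R[i]]_n.+1 -> 'M[R[i]]_n.+1)
  (a b : 'M[R[i]]_n.+1) (Q : nat -> 'M[dpoly R n]_n.+1) (j : nat) (D W : set (R * R))
  (u : R -> R -> 'M[R[i]]_n.+1) (E : R -> R -> R[i] -> 'M[R[i]]_n.+1)
  (al1 al2 : R[i]) (pi : 'M[R[i]]_n.+1) :
  lie_involution (@conjc R) tau -> induced_involution (@conjc R) tau tauhat ->
  is_diag_mx a -> (forall X, a * X = X * a -> b * X = X * b) -> is_Q_family a b Q ->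
  local_domain D -> trivialization a Q j D u E -> pi *m pi = pi ->
  dressing_domain D E al1 al2 pi W ->
  U_solution tau a b Q j D u ->
  U_reality tauhat [:: al1; al2] (simple_element al1 al2 pi) ->
  U_solution tau a b Q j W (dressing a u E al1 al2 pi).
Proof.
move=> htau htauhat ha hb hQ [oD cD D0] hE pi2 [oW _ WD capW] [Ua Ub Uu fl] hreal.
have su : msmooth2 D u by case: fl.
have sR (r : R) : (@conjc R : {rmorphism R[i] -> R[i]}) r%:C = r%:C by exact: conjc_real.
have sK : involutive (@conjc R : {rmorphism R[i] -> R[i]}) by exact: conjcK.
have pu x t : D (x, t) -> cent_part a (u x t) = 0 by move=> /Uu[/(sl_perpP ha)].
have ea : gl_ext tau a = 1 *: a by case: Ua => sa ta; rewrite gl_ext_id // ta scale1r.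
have eb : gl_ext tau b = 1 *: b by case: Ub => sb tb; rewrite gl_ext_id // tb scale1r.
have fu x t : D (x, t) -> gl_ext tau (u x t) = u x t.
  by move=> /Uu[_ [sx tx]]; rewrite gl_ext_id.
have e2 : 1 * 1 = 1 :> R[i] by rewrite mulr1.
have tr l c x t : D (x, t) -> \tr (lax a Q j u c l x t) = 0.
  by apply: (tr_lax j ha hQ oD su pu sR htau e2 ea eb fu); [case: Ua | case: Ub].
split=> //; last exact: (flow_dressing ha hb hQ oD cD D0 hE pu tr pi2 oW WD capW fl).
move=> x t Wxt; have Dxt := WD _ Wxt.
have pu' : in_sl_perp a (dressing a u E al1 al2 pi x t).
  by apply/(sl_perpP ha); rewrite dressingE cent_partD pu // add0r cent_part_ad.
split=> //; split; first by case: pu'.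
case: pu' => s' _; rewrite -(gl_ext_id tau s') dressingE (gl_extD htau) fu //; congr (_ + _).
apply: (gl_lie_Delta ha hQ oD cD D0 su hE pu sR sK htau e2 (rmorph1 _) ea eb fu tr (expr1n _ _)
  htauhat pi2 _ WD capW Wxt).
move=> l lS; rewrite /nu mul1r; exact: hreal.
Qed.

Theorem mainTheorem2 (R : realType) (n : nat)
  (tau sigma tauhat sigmahat : 'M[R[i]]_n.+1 -> 'M[R[i]]_n.+1)
  (htau : lie_involution (@conjc R) tau)
  (hsigma : lie_involution id sigma)
  (hcomm : forall X, in_sl X -> sigma (tau X) = tau (sigma X))
  (htauhat : induced_involution (@conjc R) tau tauhat)
  (hsigmahat : induced_involution id sigma sigmahat)
  (a b : 'M[R[i]]_n.+1)
  (ha_diag : is_diag_mx a) (ha_sl : in_sl a) (ha_neq0 : a <> 0)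
  (hb : exists p : {poly R[i]}, b = horner_mx a p)
  (Q : nat -> 'M[dpoly R n]_n.+1) (hQ : is_Q_family a b Q)
  (j : nat)
  (D : set (R * R)) (hD : local_domain D)
  (u : R -> R -> 'M[R[i]]_n.+1)
  (E : R -> R -> R[i] -> 'M[R[i]]_n.+1)
  (hE : trivialization a Q j D u E)
  (hwave : has_local_reduced_wave_function a b j D u E)
  (al1 al2 : R[i]) (pi : 'M[R[i]]_n.+1) (hpi : pi *m pi = pi)
  (W : set (R * R)) (hW : dressing_domain D E al1 al2 pi W) :
  (U_solution tau a b Q j D u ->
   U_reality tauhat [:: al1; al2] (simple_element al1 al2 pi) ->
   U_solution tau a b Q j W (dressing a u E al1 al2 pi))
  /\
  (UK_solution tau sigma a b Q j D u ->
   UK_reality tauhat sigmahat [:: al1; al2] (simple_element al1 al2 pi) ->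
   UK_solution tau sigma a b Q j W (dressing a u E al1 al2 pi)).

Proof.
case: hb => p hb.
have comm X : a * X = X * a -> b * X = X * b by rewrite hb; exact: comm_horner_mx.
have main : U_solution tau a b Q j D u ->
    U_reality tauhat [:: al1; al2] (simple_element al1 al2 pi) ->
    U_solution tau a b Q j W (dressing a u E al1 al2 pi).
  exact: (U_dressing htau htauhat ha_diag comm hQ hD hE hpi hW).
split=> // -[oj [Ua sa] [Ub sb] UKu fl] [hr1 hr2].
have Usol : U_solution tau a b Q j D u by split=> // x t /UKu[].
have [_ _ Wperp Wfl] := main Usol hr1; split=> // x t Wxt; split; last exact: Wperp.
split; first by case: (Wperp x t Wxt).
case: hD => oD cD D0; case: hW => oW _ WD capW; have Dxt := WD _ Wxt.
have su : msmooth2 D u by case: fl.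
have pu y s : D (y, s) -> cent_part a (u y s) = 0 by move=> /UKu[_ [/(sl_perpP ha_diag)]].
have e2 : 1 * 1 = 1 :> R[i] by rewrite mulr1.
have tr l c y s : D (y, s) -> \tr (lax a Q j u c l y s) = 0.
  apply: (tr_lax j ha_diag hQ oD su pu (s := @conjc R) (@conjc_real R) htau e2).
  - by case: Ua => ta1 ta2; rewrite gl_ext_id // ta2 scale1r.
  - by case: Ub => tb1 tb2; rewrite gl_ext_id // tb2 scale1r.
  - by move=> y' s' /UKu[_ [_ [? ?]]]; rewrite gl_ext_id.
  - by case: Ua.
  - by case: Ub.
have slu : in_sl (dressing a u E al1 al2 pi x t) by case: (Wperp x t Wxt) => [[]].
have sid : forall r : R, (idfun : {rmorphism R[i] -> R[i]}) r%:C = r%:C by [].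
have N2 : (-1) * (-1) = 1 :> R[i] by rewrite mulrNN mulr1.
have ea : gl_ext sigma a = (-1) *: a by rewrite gl_ext_id ?sa ?scaleN1r //; case: Ua.
have eb : gl_ext sigma b = (-1) *: b by rewrite gl_ext_id ?sb ?scaleN1r //; case: Ub.
have fu y s : D (y, s) -> gl_ext sigma (u y s) = u y s.
  by move=> /UKu[[[sl _] su'] _]; rewrite gl_ext_id.
have ej : (-1) ^+ j.+1 = 1 :> R[i] by rewrite -signr_odd /= oj.
rewrite -(gl_ext_id sigma slu) dressingE (gl_extD (s := idfun) hsigma) fu //; congr (_ + _).
apply: (gl_lie_Delta ha_diag hQ oD cD D0 su hE pu sid (s := idfun) _ hsigma N2 _ ea eb fu tr ej
  hsigmahat hpi _ WD capW Wxt) => //.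
by move=> l lS; rewrite /nu mulN1r; exact: hr2.
Qed.
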